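(* Let $\{d_{ij}\}_{i,j\in[n]}$ be nonnegative distances with aspect ratio $\Delta$, and let $\{w_{ij}\}_{i,j\in[n]}$ be weights with $0\le w_{ij}\le 1$ such that the corresponding weighted graph is $(\delta n)$-regular for some $0<\delta<1$, i.e. $\sum_{j\in[n]}w_{ij}=\delta n$ for every $i$. Given an integer $k\in\mathbb{N}$ and $0<\varepsilon<1$, there exists an algorithm that runs in time $(n\Delta)^{\mathcal{O}(k^2\log(\Delta k/(\varepsilon\delta))/(\varepsilon^2\delta^{11}))}$ and with probability at least $0.99$ outputs an embedding $\hat x_1,\ldots,\hat x_n\in\mathbb{R}^k$ such that \[ \mathbb{E}_{i,j\sim W}\big(d_{ij}-\|\hat x_i-\hat x_j\|\big)^2\le \mathrm{OPT}_{\mathrm{WEMV}}+\varepsilon\cdot\mathbb{E}_{i,j\sim W}d_{ij}^2 . \]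
   Context: The aspect ratio of the distances is $\Delta=\max_{i,j}d_{ij}/\min_{i,j}d_{ij}$. For the weight matrix $W=(w_{ij})$, $\mathbb{E}_{i,j\sim W}f(i,j)=\sum_{i,j\in[n]}w_{ij}f(i,j)\big/\sum_{i,j\in[n]}w_{ij}$. The weighted $k$-EMV optimum is \[ \mathrm{OPT}_{\mathrm{WEMV}}=\min_{x_1,\ldots,x_n\in\mathbb{R}^k}\ \mathbb{E}_{i,j\sim W}\big(d_{ij}-\|x_i-x_j\|_2\big)^2 . \] $\|\cdot\|$ is the Euclidean norm.
   Formalization: The exponent O(g) is read as C·max(1,g), since for k=Δ=1 and ε,δ→1 the bare bound leaves no time to output n points; Δ is taken over i≠j with positive minimum distance, the weighted graph is undirected (w symmetric), and k≥1. *)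

(* Defs.v *)
From mathcomp Require Import all_boot all_order all_algebra.
From mathcomp Require Import boolp classical_sets reals exp.

Set Implicit Arguments.
Unset Strict Implicit.
Unset Printing Implicit Defensive.

Import Order.TTheory GRing.Theory Num.Theory.

Local Open Scope ring_scope.

(** * Model of computation

    A randomized real RAM, presented as a structured language.  There are two
    unbounded, indirectly addressable memories, one of natural numbers and one
    of real numbers.  Arithmetic on naturals is limited to addition and
    truncated subtraction; arithmetic on reals is [+ - * /] (with [x / 0 = 0])
    and comparison.  There is no rounding or cast from reals to naturals, no
    root extraction, and the only constants are natural numbers, so a program
    is a finite object that carries no real-valued advice.  Every constant,
    memory access, operation, test, assignment and coin flip costs 1. *)

Inductive nexp :=
  | NCst of nat
  | NGet of nexp
  | NAdd of nexp & nexp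
  | NSub of nexp & nexp.

Inductive rexp :=
  | RCst of nat
  | RGet of nexp
  | RAdd of rexp & rexp
  | RSub of rexp & rexp
  | RMul of rexp & rexp
  | RDiv of rexp & rexp.

Inductive bexp :=
  | BNle of nexp & nexp
  | BRle of rexp & rexp
  | BNot of bexp.

Inductive cmd :=
  | Skip
  | NSet of nexp & nexp
  | RSet of nexp & rexp
  | Flip of nexp
  | Seq of cmd & cmd
  | If of bexp & cmd & cmd
  | While of bexp & cmd.

Fixpoint ncost (e : nexp) : nat :=
  match e with
  | NCst _ => 1
  | NGet a => (ncost a).+1
  | NAdd a b | NSub a b => (ncost a + ncost b).+1%N
  end.

Fixpoint rcost (e : rexp) : nat :=
  match e with
  | RCst _ => 1
  | RGet a => (ncost a).+1
  | RAdd a b | RSub a b | RMul a b | RDiv a b => (rcost a + rcost b).+1%N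
  end.

Fixpoint bcost (e : bexp) : nat :=
  match e with
  | BNle a b => (ncost a + ncost b).+1%N
  | BRle a b => (rcost a + rcost b).+1%N
  | BNot a => (bcost a).+1
  end.

Record state (R : realType) := State {
  nmem : nat -> nat;
  rmem : nat -> R
}.

Definition upd (T : Type) (f : nat -> T) (a : nat) (v : T) : nat -> T :=
  fun b => if b == a then v else f b.

Section Semantics.
Variable R : realType.
Implicit Types (s : state R) (r : seq bool).

Fixpoint neval s (e : nexp) : nat :=
  match e with
  | NCst c => c
  | NGet a => nmem s (neval s a)
  | NAdd a b => (neval s a + neval s b)%N
  | NSub a b => (neval s a - neval s b)%N
  end.

Fixpoint reval s (e : rexp) : R :=
  match e with
  | RCst c => c%:R
  | RGet a => rmem s (neval s a)
  | RAdd a b => reval s a + reval s b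
  | RSub a b => reval s a - reval s b
  | RMul a b => reval s a * reval s b
  | RDiv a b => reval s a / reval s b
  end.

Fixpoint beval s (e : bexp) : bool :=
  match e with
  | BNle a b => (neval s a <= neval s b)%N
  | BRle a b => reval s a <= reval s b
  | BNot a => ~~ beval s a
  end.

Definition nset s (a v : nat) : state R := State (upd (nmem s) a v) (rmem s).

Definition rset s (a : nat) (v : R) : state R :=
  State (nmem s) (upd (rmem s) a v).

(** [exec c s r s' r' t]: started in [s] with the coin tosses [r] still to be
    consumed, [c] halts in [s'] after time [t], leaving the tosses [r']. *)
Inductive exec :
    cmd -> state R -> seq bool -> state R -> seq bool -> nat -> Prop :=
  | exec_skip s r : exec Skip s r s r 1
  | exec_nset a e s r :
      exec (NSet a e) s r (nset s (neval s a) (neval s e)) r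
        (ncost a + ncost e).+1%N
  | exec_rset a e s r :
      exec (RSet a e) s r (rset s (neval s a) (reval s e)) r
        (ncost a + rcost e).+1%N
  | exec_flip a s (b : bool) r :
      exec (Flip a) s (b :: r) (nset s (neval s a) b) r (ncost a).+1
  | exec_seq c1 c2 s r s1 r1 t1 s2 r2 t2 :
      exec c1 s r s1 r1 t1 -> exec c2 s1 r1 s2 r2 t2 ->
      exec (Seq c1 c2) s r s2 r2 (t1 + t2)%N
  | exec_if b c1 c2 s r s' r' t :
      exec (if beval s b then c1 else c2) s r s' r' t ->
      exec (If b c1 c2) s r s' r' (bcost b + t).+1%N
  | exec_while_end b c s r :
      ~~ beval s b -> exec (While b c) s r s r (bcost b).+1
  | exec_while_loop b c s r s1 r1 t1 s2 r2 t2 :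
      beval s b -> exec c s r s1 r1 t1 -> exec (While b c) s1 r1 s2 r2 t2 ->
      exec (While b c) s r s2 r2 (bcost b + t1 + t2).+1%N.

Lemma exec_det c s r s1 r1 t1 s2 r2 t2 :
  exec c s r s1 r1 t1 -> exec c s r s2 r2 t2 ->
  [/\ s1 = s2, r1 = r2 & t1 = t2].
Proof.
move=> E; elim: E s2 r2 t2 => {c s r s1 r1 t1}.
- by move=> s r s2 r2 t2 H; inversion H; subst.
- by move=> a e s r s2 r2 t2 H; inversion H; subst.
- by move=> a e s r s2 r2 t2 H; inversion H; subst.
- by move=> a s b r s2 r2 t2 H; inversion H; subst.
- move=> c1 c2 s r s1 r1 t1 s2 r2 t2 _ IH1 _ IH2 s3 r3 t3 H.
  inversion H as [| | | |? ? ? ? s4 r4 t4 ? ? t5 H1 H2| | |]; subst.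
  case: (IH1 _ _ _ H1) => e1 e2 e3; subst.
  by case: (IH2 _ _ _ H2) => e1 e2 e3; subst.
- move=> b c1 c2 s r s' r' t _ IH s2 r2 t2 H.
  inversion H as [| | | | |? ? ? ? ? ? ? ? H1| |]; subst.
  by case: (IH _ _ _ H1) => e1 e2 e3; subst.
- move=> b c s r nb s2 r2 t2 H.
  inversion H as [| | | | | | |? ? ? ? ? ? ? ? ? ? hb]; subst => //.
  by rewrite hb in nb.
- move=> b c s r s1 r1 t1 s2 r2 t2 hb _ IH1 _ IH2 s3 r3 t3 H.
  inversion H as [| | | | | |? ? ? ? nb|? ? ? ? s4 r4 t4 ? ? t5 ? H1 H2]; subst.
    by rewrite hb in nb.
  case: (IH1 _ _ _ H1) => e1 e2 e3; subst.
  by case: (IH2 _ _ _ H2) => e1 e2 e3; subst.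
Qed.

(** [run_on p s r s' t]: with coin tosses [r], [p] halts in [s'] in time [t];
    tosses left over are ignored. *)
Definition run_on (p : cmd) s r (s' : state R) (t : nat) : Prop :=
  exists r', exec p s r s' r' t.

(** Probability of an event under [m] independent fair coin tosses. *)
Definition coin_prob (m : nat) (P : seq bool -> Prop) : R :=
  #|[set r : m.-tuple bool | `[< P r >]]%SET|%:R / (2 ^ m)%:R.

End Semantics.

(** * Weighted Euclidean metric violation *)

Section WEMV.
Variable R : realType.

(** The norm [`|v|] that the library puts on ['rV_k] is the sup norm. *)
Definition enorm (k : nat) (v : 'rV[R]_k) : R :=
  Num.sqrt (\sum_(l < k) v 0 l ^+ 2).

Definition wmean (n : nat) (w : 'M[R]_n) (f : 'I_n -> 'I_n -> R) : R :=
  (\sum_i \sum_j w i j * f i j) / (\sum_i \sum_j w i j).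

Definition wemv (n k : nat) (d w : 'M[R]_n) (x : 'I_n -> 'rV[R]_k) : R :=
  wmean w (fun i j => (d i j - enorm (x i - x j)) ^+ 2).

(** The minimum is attained, so it is the infimum. *)
Definition opt_wemv (n k : nat) (d w : 'M[R]_n) : R :=
  inf (range (@wemv n k d w)).

(** Diagonal entries are distances from a point to itself and take no part in
    the aspect ratio. *)
Definition is_aspect_ratio (n : nat) (d : 'M[R]_n) (Delta : R) : Prop :=
  exists dmin dmax : R,
    [/\ 0 < dmin,
        exists i j, i != j /\ d i j = dmin,
        exists i j, i != j /\ d i j = dmax,
        forall i j, i != j -> dmin <= d i j <= dmax
      & Delta = dmax / dmin].

Definition weighted_graph (n : nat) (w : 'M[R]_n) : Prop :=
  (forall i j, w i j = w j i) /\ (forall i j, 0 <= w i j <= 1).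

Definition regular (n : nat) (w : 'M[R]_n) (D : R) : Prop :=
  forall i, \sum_j w i j = D.

(** Natural memory: [n], [k].  Real memory: [eps], then [d] and [w] in
    row-major order.  All other cells are 0. *)
Definition wemv_input (n k : nat) (eps : R) (d w : 'M[R]_n) : state R :=
  State (nth 0%N [:: n; k])
        (nth 0 (eps :: [seq d i j | i <- enum 'I_n, j <- enum 'I_n]
                    ++ [seq w i j | i <- enum 'I_n, j <- enum 'I_n])).

(** Coordinate [l] of point [i] is left in cell [i * k + l] of the real
    memory. *)
Definition wemv_output (n k : nat) (s : state R) : 'I_n -> 'rV[R]_k :=
  fun i => \row_(l < k) rmem s (i * k + l)%N.

(** [(n Delta) ^ O(g)], with constant [C] in the O.  As usual the argument of
    the O is understood to be bounded below by a positive constant: here [g]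
    tends to 0 when [k = Delta = 1] and [eps, delta] tend to 1, where the bare
    [(n Delta) ^ (C g)] would not leave time to write the output. *)
Definition wemv_time (C : R) (n k : nat) (Delta eps delta : R) : R :=
  let g := k%:R ^+ 2 * ln (Delta * k%:R / (eps * delta))
           / (eps ^+ 2 * delta ^+ 11) in
  (n%:R * Delta) `^ (C * Num.max 1 g).

End WEMV.

Arguments wemv_output {R} n k s i.

(* Main.v *)
Require Import Defs.
From mathcomp Require Import all_boot all_order all_algebra.
From mathcomp Require Import boolp classical_sets reals exp.
From mathcomp Require Import sequences.
From mathcomp Require Import zify ring lra.

Set Implicit Arguments.
Unset Strict Implicit.
Unset Printing Implicit Defensive.

Import Order.TTheory GRing.Theory Num.Theory.

Local Open Scope ring_scope.

(** The algorithm is deterministic.  Reflecting the coordinates at the walls of a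
    box of side [O(k dmax / eps)], with the best of [O(k / eps)] phases, spoils few
    distances, so the points may be rounded to the grid of mesh
    [h = eps dmin / (32 k)] in that box.  A point is then one of [L = Q ^ k] labels,
    with [Q = O(k ^ 2 Delta / eps ^ 2)], and it remains to minimise a sum of
    pairwise costs over the labellings, up to [eps / 2] times [\sum w d ^ 2].

    If [n <= K0 = O(k / (eps delta) ^ 2)], all labellings are tried.  Otherwise one
    enumerates all samples of [s = O(K0 log Q)] indices together with all
    labellings of the sample.  Given these, the indices are labelled greedily: [i]
    receives, among the labels near the weighted mean of the sampled labels, one
    whose cost against the indices before [i] and the sampled indices after [i] is
    minimal.  When the sample is labelled as in an optimal labelling, passing from
    the latter to the greedy one an index at a time bounds the loss by deviations
    of sampled sums.  Second moments and a Chernoff bound that is uniform over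
    pairs of labels make their mean over the samples small, hence some sample
    succeeds.

    With [X] a bound on all numbers that occur, of the order of the number
    [n ^ s L ^ s] of guesses, the program runs in time [X ^ 240]. *)

(** * Sampling with replacement *)

(** The obstacle is the quadratic part of the costs: squared distances between labels are not
    bounded by the data, so sampled sums of them need not concentrate. Two facts tame them. An
    optimal label lies within O(beta) of the weighted mean of the labels of its neighbours, [beta]
    being the mean distance of the index, so labels near the sampled mean suffice. And for two such
    labels, the squared distances expanded about the true mean become products of O(beta) label
    factors with [k + 1] deviations that do not involve the labels, for which second moments are
    enough. Only the term linear in [d] depends on the pair of labels. It is Lipschitz, hence has
    envelope O(beta w d), and the union over [L ^ 2] pairs costs only ln L = k ln Q; this is the
    origin of the factor [k] in [K0] and of log Q in [s].

    The condition [K0 < n] is used twice: it makes the degrees [delta n] large, so that diagonal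
    weights are negligible, and it bounds ln (k / (eps delta)) by ln n in the running time.

    As the machine has no roots, distances between labels are rounded down to integers; grid points
    being integral, this only doubles the Lipschitz constant. *)

Section Sampling.
Variable R : realType.
Variables n s : nat.
Hypothesis n0 : (0 < n)%N.
Local Notation sample := {ffun 'I_s -> 'I_n}.

Definition mean (phi : 'I_n -> R) : R := (\sum_j phi j) / n%:R.
Definition Ex (g : sample -> R) : R := (\sum_(f : sample) g f) / (n ^ s)%:R.

Lemma n_gt0 : 0 < n%:R :> R. Proof. by rewrite ltr0n. Qed.
Lemma n_neq0 : n%:R != 0 :> R. Proof. by rewrite pnatr_eq0 -lt0n. Qed.
Lemma ns_gt0 : 0 < (n ^ s)%:R :> R. Proof. by rewrite ltr0n expn_gt0 n0. Qed.

Lemma ExD g1 g2 : Ex (fun f => g1 f + g2 f) = Ex g1 + Ex g2.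
Proof. by rewrite /Ex big_split mulrDl. Qed.

Lemma ExZ a g : Ex (fun f => a * g f) = a * Ex g.
Proof. by rewrite /Ex -mulr_sumr mulrA. Qed.

Lemma Ex_sum (I : finType) (g : I -> sample -> R) :
  Ex (fun f => \sum_i g i f) = \sum_i Ex (g i).
Proof. by rewrite /Ex exchange_big /= mulr_suml. Qed.

Lemma Ex_le g1 g2 : (forall f, g1 f <= g2 f) -> Ex g1 <= Ex g2.
Proof.
move=> H; rewrite /Ex ler_wpM2r ?invr_ge0 ?ler0n//.
by apply: ler_sum => f _; apply: H.
Qed.

Lemma eq_Ex g1 g2 : g1 =1 g2 -> Ex g1 = Ex g2.
Proof. by move=> H; rewrite /Ex; under eq_bigr do rewrite H. Qed.

Lemma Ex_cst c : Ex (fun=> c) = c.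
Proof.
rewrite /Ex sumr_const card_ffun !card_ord -[c *+ _]mulr_natr mulfK//.
by rewrite gt_eqF// ns_gt0.
Qed.

Lemma Ex_exists g : exists f, g f <= Ex g.
Proof.
apply: contrapT => /forallNP H.
have : Ex g < Ex g; last by rewrite ltxx.
rewrite -{1}(Ex_cst (Ex g)) /Ex ltr_pM2r ?invr_gt0 ?ns_gt0//.
have j0 : 'I_n by exact: Ordinal n0.
apply: ltr_sum => [|f _]; last by rewrite ltNge; apply/negP/H.
by apply/hasP; exists [ffun=> j0]; rewrite ?mem_index_enum.
Qed.

(** The draws are independent: expanding the product of the [s] sums over ['I_n] gives one term per
    sample. *)
Lemma Ex_prod (psi : 'I_s -> 'I_n -> R) :
  Ex (fun f => \prod_t psi t (f t)) = \prod_t mean (psi t).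
Proof.
rewrite /Ex -(bigA_distr_bigA psi) /mean big_split /= prodr_const card_ord.
by rewrite natrX exprVn.
Qed.

Lemma mean_cst c : mean (fun=> c) = c.
Proof. by rewrite /mean sumr_const card_ord -[c *+ _]mulr_natr mulfK ?n_neq0. Qed.

Lemma meanD p1 p2 : mean (fun j => p1 j + p2 j) = mean p1 + mean p2.
Proof. by rewrite /mean big_split mulrDl. Qed.

Lemma meanZ a p : mean (fun j => a * p j) = a * mean p.
Proof. by rewrite /mean -mulr_sumr mulrA. Qed.

Lemma mean_le p1 p2 : (forall j, p1 j <= p2 j) -> mean p1 <= mean p2.
Proof.
move=> H; rewrite /mean ler_wpM2r ?invr_ge0 ?ler0n//.
by apply: ler_sum => f _; apply: H.
Qed.

Lemma eq_mean p1 p2 : p1 =1 p2 -> mean p1 = mean p2.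
Proof. by move=> H; rewrite /mean; under eq_bigr do rewrite H. Qed.

Lemma prod_pick (t : 'I_s) (F : 'I_s -> R) :
  \prod_u (if u == t then F u else 1) = F t.
Proof. by rewrite -big_mkcond /= big_pred1_eq. Qed.

Lemma Ex1 t phi : Ex (fun f => phi (f t)) = mean phi.
Proof.
pose psi (u : 'I_s) (j : 'I_n) := if u == t then phi j else 1.
rewrite (@eq_Ex _ (fun f => \prod_u psi u (f u))) => [|f].
  rewrite Ex_prod -(prod_pick t (fun=> mean phi)).
  by apply: eq_bigr => u _; rewrite /psi; case: eqP => _; rewrite ?mean_cst.
by rewrite /psi (prod_pick t (fun u => phi (f u))).
Qed.

Lemma Ex2 t u phi chi : t != u ->
  Ex (fun f => phi (f t) * chi (f u)) = mean phi * mean chi.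
Proof.
move=> tu.
pose psi (v : 'I_s) (j : 'I_n) :=
  (if v == t then phi j else 1) * (if v == u then chi j else 1).
rewrite (@eq_Ex _ (fun f => \prod_v psi v (f v))) => [|f].
  rewrite Ex_prod -(prod_pick t (fun=> mean phi)) -(prod_pick u (fun=> mean chi)).
  rewrite -big_split; apply: eq_bigr => v _; rewrite /psi /=.
  case: (eqVneq v t) => [->|_]; first by rewrite (negbTE tu) mulr1; apply: eq_mean => j; rewrite mulr1.
  by case: eqP => _; rewrite mul1r ?mulr1 ?mean_cst//; apply: eq_mean => j; rewrite mul1r.
rewrite /psi big_split /= (prod_pick t (fun u => phi (f u))).
by rewrite (prod_pick u (fun u => chi (f u))).
Qed.

(** The cross terms vanish by [Ex2], distinct draws being independent and centred. *)
Lemma Ex_sqr phi : mean phi = 0 ->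
  Ex (fun f => (\sum_t phi (f t)) ^+ 2) = s%:R * mean (fun j => phi j ^+ 2).
Proof.
move=> m0.
rewrite (@eq_Ex _ (fun f => \sum_t \sum_u phi (f t) * phi (f u))) => [|f]; last first.
  by rewrite expr2 mulr_suml; apply: eq_bigr => t _; rewrite mulr_sumr.
rewrite Ex_sum.
have H t : Ex (fun f => \sum_u phi (f t) * phi (f u)) = mean (fun j => phi j ^+ 2).
  rewrite Ex_sum (bigD1 t)//= big1 ?addr0 => [|u ut]; last first.
    by rewrite Ex2 1?eq_sym// m0 mul0r.
  by rewrite -(Ex1 t); apply: eq_Ex => f; rewrite expr2.
by under eq_bigr do rewrite H; rewrite sumr_const card_ord mulr_natl.
Qed.

(** Error of the sample sum, scaled by [n / s] to be unbiased, as an estimate of the sum over all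
    indices. *)
Definition dvn (f : sample) (phi : 'I_n -> R) : R :=
  n%:R / s%:R * (\sum_t phi (f t)) - \sum_j phi j.

Hypothesis s0 : (0 < s)%N.
Lemma s_gt0 : 0 < s%:R :> R. Proof. by rewrite ltr0n. Qed.
Lemma s_neq0 : s%:R != 0 :> R. Proof. by rewrite pnatr_eq0 -lt0n. Qed.

Lemma dvnD f p1 p2 : dvn f (fun j => p1 j + p2 j) = dvn f p1 + dvn f p2.
Proof. by rewrite /dvn !big_split /=; ring. Qed.

Lemma dvnZ f a p : dvn f (fun j => a * p j) = a * dvn f p.
Proof. by rewrite /dvn -!mulr_sumr; ring. Qed.

Lemma dvn_sum f (I : finType) (p : I -> 'I_n -> R) :
  dvn f (fun j => \sum_i p i j) = \sum_i dvn f (p i).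
Proof.
rewrite /dvn exchange_big /= [X in _ - X]exchange_big /= mulr_sumr.
by rewrite -sumrB.
Qed.

Lemma eq_dvn f p1 p2 : p1 =1 p2 -> dvn f p1 = dvn f p2.
Proof.
by move=> H; rewrite /dvn; congr (_ * _ - _); apply: eq_bigr => ? _; rewrite H.
Qed.

Lemma dvnE f phi :
  dvn f phi = n%:R / s%:R * \sum_t (phi (f t) - mean phi).
Proof.
rewrite sumrB sumr_const card_ord -[mean phi *+ s]mulr_natl /dvn /mean.
by field; rewrite s_neq0 n_neq0.
Qed.

Lemma mean_center phi : mean (fun j => phi j - mean phi) = 0.
Proof. by rewrite meanD mean_cst subrr. Qed.

Lemma mean_center_sqr phi :
  mean (fun j => (phi j - mean phi) ^+ 2) <= mean (fun j => phi j ^+ 2).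
Proof.
rewrite (@eq_mean _ (fun j => phi j ^+ 2 + (- 2 * mean phi * phi j + mean phi ^+ 2)));
  last by move=> j; ring.
rewrite meanD meanD meanZ mean_cst gerDl.
rewrite -mulrA -expr2; have := sqr_ge0 (mean phi); lra.
Qed.

Lemma Ex_dvn_sqr phi :
  Ex (fun f => dvn f phi ^+ 2) <= n%:R / s%:R * \sum_j phi j ^+ 2.
Proof.
rewrite (@eq_Ex _ (fun f => (n%:R / s%:R) ^+ 2 * (\sum_t (phi (f t) - mean phi)) ^+ 2));
  last by move=> f; rewrite dvnE exprMn.
rewrite ExZ (Ex_sqr (mean_center phi)).
have -> : n%:R / s%:R * (\sum_j phi j ^+ 2) =
    (n%:R / s%:R) ^+ 2 * (s%:R * mean (fun j => phi j ^+ 2)).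
  by rewrite /mean; field; rewrite s_neq0 n_neq0.
by rewrite ler_wpM2l ?sqr_ge0// ler_wpM2l ?ler0n// mean_center_sqr.
Qed.

(** Squaring exp(u/2) <= 1 / (1 - u/2) gives a rational bound, and (1 + u + 2u^2)(1 - u/2)^2 - 1 =
    u^2 (1 - u)(5/4 - u/2) is nonnegative on the interval. *)
Lemma expR_quad (u : R) : -1 <= u <= 1 -> expR u <= 1 + u + 2 * u ^+ 2.
Proof.
move=> /andP[u1 u2].
have h0 : 0 < 1 - u / 2 by lra.
have h1 : expR (u / 2) <= (1 - u / 2)^-1.
  rewrite -[u / 2]opprK expRN lef_pV2 ?posrE ?expR_gt0//; last by rewrite opprK.
  by have := expR_ge1Dx (- (u / 2)); rewrite !opprK; lra.
have -> : u = u / 2 + u / 2 by lra.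
rewrite expRD.
have h2 : expR (u / 2) * expR (u / 2) <= (1 - u / 2)^-1 * (1 - u / 2)^-1.
  by rewrite ler_pM// ?expR_ge0.
apply: (le_trans h2).
rewrite -invfM -[leLHS]mul1r ler_pdivrMr ?mulr_gt0//.
have -> : u / 2 + u / 2 = u by lra.
have -> : (1 + u + 2 * u ^+ 2) * ((1 - u / 2) * (1 - u / 2)) =
    1 + u ^+ 2 * ((1 - u) * (5 / 4 - u / 2)) by field.
rewrite lerDl mulr_ge0 ?sqr_ge0// mulr_ge0//; lra.
Qed.

(** * Mean of a supremum of sampled deviations *)

Section SupDev.
Variable I : finType.
Variables (Y : I -> 'I_n -> R) (p : 'I_n -> R) (lam Gam : R).
Hypothesis lam0 : 0 < lam.
Hypothesis Yp : forall i j, `|Y i j| <= p j.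
Hypothesis cardI : 2 * #|I|%:R <= expR Gam.

(** Truncation: entries whose envelope exceeds 1 / (2 lam) are too large for an exponential moment.
    They are cut off, and [q] majorises what is lost, uniformly in the family. *)
Let Z i j := if 2 * lam * p j <= 1 then Y i j else 0.
Let q j := if 2 * lam * p j <= 1 then 0 else p j.
Let v := mean (fun j => p j ^+ 2).
(** Chosen so that [ZZ] has mean at most [expR kap]: the term [Gam] pays for the two signs and for
    the union over [I]. *)
Let kap := Gam + s%:R * (2 * lam ^+ 2 * v).
Let y i (f : sample) := lam * \sum_t (Z i (f t) - mean (Z i)).
Let ZZ (f : sample) := \sum_i (expR (y i f) + expR (- y i f)).

Let YZq i j : `|Y i j - Z i j| <= q j.
Proof. by rewrite /Z /q; case: ifP => _; rewrite ?subrr ?normr0// subr0. Qed.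

(** Where the cut occurs, 1 < 2 lam p, so the lost first power of [p] is paid by a second power. The
    tail thus becomes comparable to the variance term. *)
Let q_le j : q j <= 2 * lam * p j ^+ 2.
Proof.
rewrite /q; case: ifP => H.
  by apply: mulr_ge0 (sqr_ge0 _); rewrite mulr_ge0// ltW.
move/negbT: H; rewrite -ltNge => H.
have p0 : 0 < p j.
  have : 0 < 2 * lam * p j by lra.
  by rewrite pmulr_rgt0 ?mulr_gt0.
by rewrite expr2 mulrA -[leLHS]mul1r ler_pM2r// ltW.
Qed.

Let Zsmall i j : `|lam * Z i j| <= 1 / 2.
Proof.
rewrite /Z; case: ifP => H; last by rewrite mulr0 normr0; lra.
rewrite normrM gtr0_norm// (le_trans (ler_wpM2l (ltW lam0) (Yp i j)))//.
by lra.
Qed.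

Let Z_p i j : Z i j ^+ 2 <= p j ^+ 2.
Proof.
have p0 : 0 <= p j by exact: le_trans (normr_ge0 _) (Yp i j).
rewrite /Z; case: ifP => _; last by rewrite expr0n sqr_ge0.
by rewrite -real_normK ?num_real// ler_sqr ?nnegrE.
Qed.

Let meanZsmall i : `|lam * mean (Z i)| <= 1 / 2.
Proof.
rewrite -meanZ ler_norml -{1}(mean_cst (- (1 / 2))) -{2}(mean_cst (1 / 2)).
by apply/andP; split; apply: mean_le => j; have := Zsmall i j; rewrite ler_norml => /andP[].
Qed.

(** Each draw contributes an exponent in [-1, 1] with mean 0, so [expR_quad] leaves only its second
    moment. *)
Let mgf i (sg : R) : sg = 1 \/ sg = -1 ->
  Ex (fun f => expR (sg * y i f)) <= expR (s%:R * (2 * lam ^+ 2 * v)).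
Proof.
move=> Hsg.
have sg2 : sg ^+ 2 = 1 by case: Hsg => ->; rewrite ?expr1n// sqrrN expr1n.
have nsg : `|sg| = 1 by case: Hsg => ->; rewrite ?normrN normr1.
pose u j := sg * (lam * Z i j - lam * mean (Z i)).
rewrite (@eq_Ex _ (fun f => \prod_t expR (u (f t)))) => [|f]; last first.
  rewrite /y /u -expR_sum; congr expR; rewrite -[RHS]mulr_sumr.
  by congr (_ * _); rewrite mulr_sumr; apply: eq_bigr => t _; rewrite mulrBr.
rewrite (Ex_prod (fun _ j => expR (u j))) prodr_const card_ord.
rewrite expRM_natl.
have e0 : 0 <= mean (fun j => expR (u j)).
  by rewrite -(mean_cst 0); apply: mean_le => j; rewrite expR_ge0.
rewrite lerXn2r ?nnegrE ?expR_ge0//.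
apply: le_trans (expR_ge1Dx _).
have mu : mean u = 0.
  by rewrite /u meanZ meanD meanZ mean_cst subrr mulr0.
have m2 : mean (fun j => u j ^+ 2) <= lam ^+ 2 * v.
  rewrite (@eq_mean _ (fun j => lam ^+ 2 * (Z i j - mean (Z i)) ^+ 2)) => [|j]; last first.
    by rewrite /u exprMn sg2 mul1r -mulrBr exprMn.
  rewrite meanZ ler_wpM2l ?sqr_ge0//.
  by rewrite (le_trans (mean_center_sqr _))// mean_le.
apply: (@le_trans _ _ (mean (fun j => 1 + u j + 2 * u j ^+ 2))).
  apply: mean_le => j; apply: expR_quad; rewrite -ler_norml /u normrM nsg mul1r.
  rewrite (le_trans (ler_normB _ _))//.
  have := Zsmall i j; have := meanZsmall i; lra.
rewrite !meanD mean_cst mu meanZ; lra.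
Qed.

(** The supremum is replaced by a majorant built from the exponential sum [ZZ]. It is bounded in
    mean rather than in probability, so that it can be added to second moments. Of the 6 [lam], two
    come from the variance in [kap] and two from each of the two sums of [q]. *)
Lemma sup_dev : exists G : sample -> R,
  (forall f i, `|dvn f (Y i)| <= G f) /\
  Ex G <= n%:R * Gam / (lam * s%:R) + 6 * lam * \sum_j p j ^+ 2.
Proof.
have ns : 0 < n%:R / s%:R :> R by rewrite divr_gt0 ?n_gt0 ?s_gt0.
exists (fun f => n%:R / s%:R / lam * (kap - 1 + expR (- kap) * ZZ f) +
  (n%:R / s%:R * (\sum_t q (f t)) + \sum_j q j)); split.
  move=> f i.
  have -> : dvn f (Y i) = dvn f (Z i) + dvn f (fun j => Y i j - Z i j).
    by rewrite -dvnD; apply: eq_dvn => j; ring.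
  rewrite (le_trans (ler_normD _ _))// lerD//; last first.
    rewrite /dvn (le_trans (ler_normB _ _))// lerD//.
      rewrite normrM (gtr0_norm ns) ler_pM2l// (le_trans (ler_norm_sum _ _ _))//.
      by apply: ler_sum.
    by rewrite (le_trans (ler_norm_sum _ _ _))// ler_sum.
  have -> : dvn f (Z i) = n%:R / s%:R / lam * y i f.
    by rewrite dvnE /y mulrA divfK// gt_eqF.
  have ns' : 0 < n%:R / s%:R / lam by rewrite divr_gt0.
  rewrite normrM (gtr0_norm ns') ler_pM2l//.
  (* The exponential lies above its tangent line at [kap]. *)
  have key (z : R) : expR z <= ZZ f -> z <= kap - 1 + expR (- kap) * ZZ f.
    move=> Hz; have := expR_ge1Dx (z - kap); rewrite expRD mulrC => H.
    have : expR (- kap) * expR z <= expR (- kap) * ZZ f by rewrite ler_pM2l ?expR_gt0.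
    lra.
  have Zi : expR (y i f) + expR (- y i f) <= ZZ f.
    rewrite /ZZ (bigD1 i)//= lerDl sumr_ge0// => i' _.
    by rewrite addr_ge0 ?expR_ge0.
  have e1 := expR_ge0 (y i f); have e2 := expR_ge0 (- y i f).
  rewrite ler_norml; apply/andP; split; last by apply: key; lra.
  by rewrite lerNl; apply: key; lra.
rewrite ExD ExZ ExD Ex_cst ExZ ExD Ex_cst ExZ.
have EZ : Ex ZZ <= expR kap.
  rewrite /ZZ Ex_sum (@le_trans _ _ (\sum_(i : I) 2 * expR (s%:R * (2 * lam ^+ 2 * v))))//.
    apply: ler_sum => i _; rewrite ExD.
    have := @mgf i 1 (or_introl erefl); have := @mgf i (-1) (or_intror erefl).
    rewrite (@eq_Ex _ (fun f => expR (- y i f))); last by move=> f; rewrite mulN1r.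
    rewrite (@eq_Ex (fun f => expR (1 * y i f)) (fun f => expR (y i f))); last by move=> f; rewrite mul1r.
    lra.
  rewrite sumr_const -[leLHS]mulr_natl mulrA [_ * 2]mulrC /kap expRD.
  by rewrite ler_pM2r ?expR_gt0.
have -> : Ex (fun f : sample => \sum_t q (f t)) = s%:R * mean q.
  rewrite Ex_sum; under eq_bigr do rewrite Ex1.
  by rewrite sumr_const card_ord [RHS]mulr_natl.
have sq : \sum_j q j <= 2 * lam * \sum_j p j ^+ 2.
  by rewrite mulr_sumr; apply: ler_sum.
have -> : n%:R / s%:R * (s%:R * mean q) = \sum_j q j.
  by rewrite /mean; field; rewrite s_neq0 n_neq0.
have le1 : expR (- kap) * Ex ZZ <= 1.
  have : expR (- kap) * Ex ZZ <= expR (- kap) * expR kap.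
    by rewrite ler_pM2l ?expR_gt0.
  by rewrite -expRD addNr expR0.
have le2 : n%:R / s%:R / lam * (kap - 1 + expR (- kap) * Ex ZZ) <=
    n%:R / s%:R / lam * kap.
  have ns' : 0 < n%:R / s%:R / lam by rewrite divr_gt0.
  by rewrite (ler_pM2l ns'); lra.
have e3 : n%:R / s%:R / lam * kap = n%:R * Gam / (lam * s%:R) + 2 * lam * \sum_j p j ^+ 2.
  by rewrite /kap /v /mean; field; rewrite s_neq0 n_neq0 gt_eqF.
lra.
Qed.

End SupDev.
End Sampling.

(** * Greedy labelling from a sample *)

Lemma amgm2 (R : realType) (e u v : R) : 0 < e -> 2 * u * v <= u ^+ 2 / e + e * v ^+ 2.
Proof.
move=> e0; have : 0 <= (u - e * v) ^+ 2 / e by rewrite divr_ge0 ?sqr_ge0// ltW.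
have -> : (u - e * v) ^+ 2 / e = u ^+ 2 / e + e * v ^+ 2 - 2 * u * v.
  by field; rewrite gt_eqF.
lra.
Qed.

Lemma sqrD2_le (R : realType) (u v : R) : (u + v) ^+ 2 <= 2 * u ^+ 2 + 2 * v ^+ 2.
Proof. by have := sqr_ge0 (u - v); nra. Qed.

Lemma sqrD3_le (R : realType) (u v t : R) :
  (u + v + t) ^+ 2 <= 3 * u ^+ 2 + 3 * v ^+ 2 + 3 * t ^+ 2.
Proof. by have := sqr_ge0 (u - v); have := sqr_ge0 (u - t); have := sqr_ge0 (v - t); nra. Qed.

Lemma le_norm_sqr (R : realType) (u v : R) : 0 <= v -> u ^+ 2 <= v ^+ 2 -> `|u| <= v.
Proof. by move=> v0 H; rewrite -ler_sqr ?nnegrE// real_normK// num_real. Qed.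

Section Nsq.
Variables (R : realType) (k : nat).
Implicit Types u v t : 'I_k -> R.
Definition nsq u : R := \sum_l u l ^+ 2.

Lemma nsq_ge0 u : 0 <= nsq u.
Proof. by apply: sumr_ge0 => l _; exact: sqr_ge0. Qed.

Lemma nsq_tri2 u v t : nsq (fun l => u l - t l) <=
  2 * nsq (fun l => u l - v l) + 2 * nsq (fun l => v l - t l).
Proof.
rewrite /nsq !mulr_sumr -big_split /=; apply: ler_sum => l _.
by have := sqrD2_le (u l - v l) (v l - t l); rewrite addrA subrK.
Qed.

Lemma nsq_tri3 u v t x : nsq (fun l => u l - x l) <=
  3 * nsq (fun l => u l - v l) + 3 * nsq (fun l => v l - t l)
  + 3 * nsq (fun l => t l - x l).
Proof.
rewrite /nsq !mulr_sumr -!big_split /=; apply: ler_sum => l _.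
have := sqrD3_le (u l - v l) (v l - t l) (t l - x l).
by have -> : u l - v l + (v l - t l) + (t l - x l) = u l - x l by ring.
Qed.

Lemma nsqC u v : nsq (fun l => u l - v l) = nsq (fun l => v l - u l).
Proof. by apply: eq_bigr => l _; ring. Qed.

End Nsq.

(** * Greedy against optimal labelling, for an abstract pair cost *)

Section Core.
Variable R : realType.
Variables (n s k : nat) (A : finType).
Variables (p : A -> 'I_k -> R) (r : A -> A -> R).
Variables (w d : 'I_n -> 'I_n -> R).
Variables (delta eta M Gam : R).

Definition D2 a b : R := nsq (fun l => p a l - p b l).
(** The weighted squared error without its constant [d ^ 2], and with [r ^ 2] replaced by the exact
    squared distance. A pair with equal labels costs 0. *)
Definition pcost i j a b : R := w i j * (D2 a b - 2 * d i j * r a b).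
Definition fcost (y : 'I_n -> A) : R := \sum_i \sum_j pcost i j (y i) (y j).

Hypothesis n0 : (0 < n)%N.
Hypothesis s0 : (0 < s)%N.
Hypothesis k0 : (0 < k)%N.
Hypothesis w_sym : forall i j, w i j = w j i.
Hypothesis w_01 : forall i j, 0 <= w i j <= 1.
Hypothesis d_sym : forall i j, d i j = d j i.
Hypothesis d_ge0 : forall i j, 0 <= d i j.
Hypothesis delta01 : 0 < delta <= 1.
Hypothesis w_row : forall i, \sum_j w i j = delta * n%:R.
Hypothesis r_sym : forall a b, r a b = r b a.
Hypothesis r_le : forall a b, r a b ^+ 2 <= D2 a b.
Hypothesis r_lip : forall a b x, (r a x - r b x) ^+ 2 <= 4 * D2 a b.
Hypothesis p_box : forall a l, 0 <= p a l <= M.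
(** Displaces [a] towards [c] by at most the length of [c - m]. With [c] the sampled mean and [m]
    the true one, it makes the optimal label feasible at the price of the error of the mean; with
    [m] the point of [a] itself, it rounds [c] to the grid. *)
Hypothesis near : forall a (c m : 'I_k -> R), (forall l, 0 <= c l <= M) ->
  exists2 b, D2 b a <= nsq (fun l => c l - m l) &
    nsq (fun l => p b l - c l) <= 2 * nsq (fun l => p a l - m l) + 2 * k%:R.

Definition beta i : R := (\sum_j w i j * d i j) / (delta * n%:R).
Definition Qd i : R := \sum_j w i j * d i j ^+ 2.
Definition Sd : R := \sum_i Qd i.

(** The grid is fine compared with the mean distance of every index, so rounding errors O(k) are
    absorbed in [beta ^ 2]. *)
Hypothesis beta_k : forall i, k%:R <= beta i ^+ 2.

Let W := delta * n%:R.

Let dl0 : 0 < delta. Proof. by case/andP: delta01. Qed.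
Let nR0 : 0 < n%:R :> R. Proof. by rewrite ltr0n. Qed.
Let W0 : 0 < W. Proof. by rewrite mulr_gt0. Qed.
Let Wn : W <= n%:R.
Proof. by rewrite /W -[leRHS]mul1r ler_pM2r//; case/andP: delta01. Qed.
Let w0 i j : 0 <= w i j. Proof. by case/andP: (w_01 i j). Qed.
Let w1 i j : w i j <= 1. Proof. by case/andP: (w_01 i j). Qed.

Let k1 : 1 <= k%:R :> R. Proof. by rewrite ler1n. Qed.

Let beta0 i : 0 <= beta i.
Proof. by rewrite divr_ge0 ?(ltW W0)// sumr_ge0// => j _; rewrite mulr_ge0. Qed.
Let beta1 i : 1 <= beta i.
Proof.
rewrite leNgt; apply/negP => H; have := beta_k i.
have : beta i ^+ 2 < 1 by rewrite expr_lt1// beta0.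
have := k1; lra.
Qed.

Lemma D2_ge0 a b : 0 <= D2 a b. Proof. exact: nsq_ge0. Qed.
Lemma D2C a b : D2 a b = D2 b a. Proof. exact: nsqC. Qed.
Lemma D2xx a : D2 a a = 0.
Proof. by rewrite /D2 /nsq big1// => l _; rewrite subrr expr0n. Qed.
Let rxx a : r a a = 0.
Proof.
apply/eqP; rewrite -sqrf_eq0 eq_le sqr_ge0 andbT.
by rewrite -(D2xx a) r_le.
Qed.
Let pcostC i j a b : pcost i j a b = pcost j i b a.
Proof. by rewrite /pcost w_sym d_sym r_sym D2C. Qed.
Let pcostxx i a : pcost i i a a = 0.
Proof. by rewrite /pcost D2xx rxx mulr0 subr0 mulr0. Qed.

(** Nonnegativity of the weighted variance of the distances about their mean [beta i]. *)
Let Qd_beta i : W * beta i ^+ 2 <= Qd i.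
Proof.
have : 0 <= \sum_j w i j * (d i j - beta i) ^+ 2.
  by apply: sumr_ge0 => j _; rewrite mulr_ge0 ?sqr_ge0.
have -> : \sum_j w i j * (d i j - beta i) ^+ 2 =
   Qd i + (- 2 * beta i) * (\sum_j w i j * d i j) + beta i ^+ 2 * (\sum_j w i j).
  rewrite /Qd !mulr_sumr -!big_split /=; apply: eq_bigr => j _; ring.
rewrite w_row -/W.
have -> : \sum_j w i j * d i j = beta i * W by rewrite /beta divfK// gt_eqF.
nra.
Qed.

(** The factor 2 comes from the symmetry of the pair cost, the excluded index from its vanishing on
    the diagonal. *)
Lemma fcost_upd (y : 'I_n -> A) i a :
  fcost (fun j => if j == i then a else y j) - fcost y =
  2 * \sum_(j | j != i) (pcost i j a (y j) - pcost i j (y i) (y j)).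
Proof.
have E z : fcost z = 2 * \sum_(j | j != i) pcost i j (z i) (z j)
    + \sum_(l | l != i) \sum_(j | j != i) pcost l j (z l) (z j).
  rewrite /fcost (bigD1 i)//= (bigD1 i)//= pcostxx add0r.
  have -> : \sum_(l | l != i) \sum_j pcost l j (z l) (z j) =
     \sum_(l | l != i) (pcost i l (z i) (z l) + \sum_(j | j != i) pcost l j (z l) (z j)).
    by apply: eq_bigr => l _; rewrite (bigD1 i)//= pcostC.
  by rewrite big_split /=; ring.
rewrite !E eqxx sumrB mulrBr.
have -> : \sum_(l | l != i) \sum_(j | j != i) pcost l j (if l == i then a else y l)
     (if j == i then a else y j) = \sum_(l | l != i) \sum_(j | j != i) pcost l j (y l) (y j).
  apply: eq_bigr => l /negbTE ->; apply: eq_bigr => j /negbTE -> //.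
have -> : \sum_(j | j != i) pcost i j a (if j == i then a else y j) =
  \sum_(j | j != i) pcost i j a (y j) by apply: eq_bigr => j /negbTE ->.
ring.
Qed.

Variable x : 'I_n -> A.
Hypothesis x_opt : forall y, fcost x <= fcost y.

Definition cen i l : R := (\sum_j w i j * p (x j) l) / (delta * n%:R).
Definition Td i : R := \sum_j w i j * D2 (x i) (x j).

Let cen0 i l : \sum_j w i j * (p (x j) l - cen i l) = 0.
Proof.
under eq_bigr do rewrite mulrBr.
rewrite sumrB -mulr_suml w_row /cen [X in _ - X]mulrC divfK ?subrr// gt_eqF//.
Qed.

(** Parallel axis theorem: the cross term vanishes because [cen i] is the weighted mean. *)
Lemma centroid i (y : 'I_k -> R) :
  \sum_j w i j * nsq (fun l => y l - p (x j) l) =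
  \sum_j w i j * nsq (fun l => cen i l - p (x j) l)
  + W * nsq (fun l => y l - cen i l).
Proof.
rewrite /nsq.
under eq_bigr do rewrite mulr_sumr.
under [X in _ = X + _]eq_bigr do rewrite mulr_sumr.
rewrite exchange_big [X in _ = X + _]exchange_big /= mulr_sumr -big_split /=.
apply: eq_bigr => l _.
have -> : W * (y l - cen i l) ^+ 2 = (\sum_j w i j) * (y l - cen i l) ^+ 2.
  by rewrite w_row.
have : - 2 * (y l - cen i l) * (\sum_j w i j * (p (x j) l - cen i l)) = 0.
  by rewrite cen0 mulr0.
rewrite mulr_sumr mulr_suml => E.
rewrite -big_split -[RHS]addr0 -[X in _ + X]E -big_split /=.
apply: eq_bigr => j _; ring.
Qed.

Lemma Td_ge i : \sum_j w i j * nsq (fun l => cen i l - p (x j) l) <= Td i.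
Proof.
rewrite /Td /D2 (centroid i (p (x i))) lerDl mulr_ge0 ?(ltW W0)//.
exact: nsq_ge0.
Qed.

(** A constant labelling costs 0, so the optimal cost is at most 0. Hence the squared distances are
    outweighed by the cross terms [2 d r], of which [r ^ 2 <= D2] lets half of the squared distances
    absorb all but 2 [d ^ 2]. *)
Lemma sum_Td : \sum_i Td i <= 4 * Sd.
Proof.
have a0 : A by exact: x (Ordinal n0).
have F0 : fcost (fun=> a0) = 0.
  rewrite /fcost big1// => i _; rewrite big1// => j _.
  by rewrite /pcost D2xx rxx mulr0 subr0 mulr0.
have := x_opt (fun=> a0); rewrite F0 /fcost => H.
have : \sum_i \sum_j (w i j * D2 (x i) (x j) / 2 - 2 * (w i j * d i j ^+ 2)) <=
   \sum_i \sum_j pcost i j (x i) (x j).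
  apply: ler_sum => i _; apply: ler_sum => j _; rewrite /pcost.
  have := w0 i j; have := r_le (x i) (x j).
  have := amgm2 (d i j) (r (x i) (x j)) (ltr0Sn R 1).
  set D := D2 _ _; set rr := r _ _; move=> h1 h2 h3.
  have : 2 * d i j * rr <= D / 2 + 2 * d i j ^+ 2.
    have := sqr_ge0 (2 * d i j - rr); nra.
  have : 0 <= w i j by []. nra.
have -> : \sum_i \sum_j (w i j * D2 (x i) (x j) / 2 - 2 * (w i j * d i j ^+ 2)) =
  (\sum_i Td i) / 2 - 2 * Sd.
  rewrite /Sd mulr_suml mulr_sumr -sumrB; apply: eq_bigr => i _.
  by rewrite /Td /Qd mulr_suml mulr_sumr -sumrB.
lra.
Qed.

(** Optimality against moving [i] to a label near [cen i]. By [centroid], the quadratic part would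
    fall by about W z, while the Lipschitz property limits the growth of the cross terms to O(W beta
    (beta + sqrt z)); hence z = O(beta^2). *)
Lemma opt_cen i : nsq (fun l => p (x i) l - cen i l) <= 38 * beta i ^+ 2.
Proof.
have cbox l : 0 <= cen i l <= M.
  rewrite divr_ge0 ?(ltW W0)//=; last first.
    by apply: sumr_ge0 => j _; rewrite mulr_ge0//; case/andP: (p_box (x j) l).
  rewrite ler_pdivrMr// -(w_row i) mulr_sumr; apply: ler_sum => j _.
  by rewrite mulrC ler_wpM2r//; case/andP: (p_box (x j) l).
have [b bD bc] := near (x i) (p (x i)) cbox.
set z := nsq _.
have {}bc : nsq (fun l => p b l - cen i l) <= 2 * k%:R.
  have e0 : nsq (fun l => p (x i) l - p (x i) l) = 0 by exact: D2xx.
  by rewrite e0 mulr0 add0r in bc.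
have {bD} bD : D2 b (x i) <= 2 * z + 4 * k%:R.
  have := nsq_tri2 (p b) (cen i) (p (x i)); rewrite -/(D2 _ _).
  have := nsqC (cen i) (p (x i)); rewrite -/z => ->; lra.
have := x_opt (fun j => if j == i then b else x j).
rewrite -subr_ge0 fcost_upd => H.
have {}H : 0 <= \sum_(j | j != i) (pcost i j b (x j) - pcost i j (x i) (x j)) by lra.
have b0 : 0 < beta i by have := beta1 i; lra.
have : \sum_(j | j != i) (pcost i j b (x j) - pcost i j (x i) (x j)) <=
  \sum_j (w i j * D2 b (x j) - w i j * D2 (x i) (x j) +
          2 * (8 * beta i + D2 b (x i) / (8 * beta i)) * (w i j * d i j)).
  rewrite [leRHS](bigD1 i)//= -[leLHS]add0r; apply: lerD.
    have b8 : 0 <= 8 * beta i by rewrite mulr_ge0.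
    have q0 : 0 <= 8 * beta i + D2 b (x i) / (8 * beta i).
      by apply: addr_ge0 => //; apply: divr_ge0 => //; exact: D2_ge0.
    rewrite D2xx mulr0 subr0; apply: addr_ge0.
      by rewrite mulr_ge0 ?D2_ge0.
    by apply: mulr_ge0; [rewrite mulr_ge0|rewrite mulr_ge0].
  apply: ler_sum => j _; rewrite /pcost.
  have := amgm2 (1 : R) (r (x i) (x j) - r b (x j)) (mulr_gt0 (ltr0Sn R 15) b0).
  have := r_lip (x i) b (x j); rewrite D2C; set rr := _ - _ => h1 h2.
  (* The weight 16 [beta] leaves a quarter of [D2 b (x i)], that is half of [z], to be absorbed by
     the gain. *)
  have : rr <= 8 * beta i + D2 b (x i) / (8 * beta i).
    have := amgm2 rr (1 : R) (mulr_gt0 (ltr0Sn R 15) b0).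
    have : rr ^+ 2 / (16 * beta i) <= 4 * D2 b (x i) / (16 * beta i).
      by rewrite ler_pM2r// invr_gt0 mulr_gt0.
    have -> : 4 * D2 b (x i) / (16 * beta i) = 2 * (D2 b (x i) / (8 * beta i)).
      by field; rewrite gt_eqF.
    lra.
  set q := 8 * _ + _; move=> h3.
  have wd : 0 <= w i j * d i j by rewrite mulr_ge0.
  have : w i j * d i j * rr <= w i j * d i j * q by rewrite ler_wpM2l.
  rewrite /rr; nra.
move=> /(le_trans H); rewrite big_split /= sumrB -mulr_sumr.
have c1 := centroid i (p b); have c2 := centroid i (p (x i)).
rewrite /D2 c1 c2 -/(D2 b (x i)) -/z.
have -> : \sum_j w i j * d i j = beta i * W by rewrite /beta divfK// gt_eqF.
have e1 : 2 * (8 * beta i + D2 b (x i) / (8 * beta i)) * (beta i * W) =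
   W * (16 * beta i ^+ 2 + D2 b (x i) / 4) by field; rewrite gt_eqF.
rewrite e1 => H2.
have : 0 <= W * (2 * k%:R - z + (16 * beta i ^+ 2 + (2 * z + 4 * k%:R) / 4)).
  apply: (le_trans H2); set C0 := \sum_j _.
  have : W * nsq (fun l => p b l - cen i l) <= W * (2 * k%:R) by rewrite ler_pM2l.
  have : W * D2 b (x i) <= W * (2 * z + 4 * k%:R) by rewrite ler_pM2l.
  nra.
rewrite pmulr_rge0//; have := beta_k i; lra.
Qed.

(** Ratio estimator of [cen]. It is 0 when the sampled weights vanish, which still lies in the
    box. *)
Definition ctr (J : {ffun 'I_s -> 'I_n}) i l : R :=
  (\sum_t w i (J t) * p (x (J t)) l) / (\sum_t w i (J t)).
Definition mk (i j : 'I_n) : R := (i < j)%N%:R.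
(** Indices before [i] carry greedy labels and are summed exactly. Those after [i] carry optimal
    labels, which are known on the sample only, and are estimated. *)
Definition est (J : {ffun 'I_s -> 'I_n}) (xh : 'I_n -> A) (i : 'I_n) a : R :=
  \sum_(j < n | (j < i)%N) pcost i j a (xh j)
  + n%:R / s%:R * \sum_t mk i (J t) * pcost i (J t) a (x (J t)).
(** The squared radius 100 [beta ^ 2] admits the label of [comparator], which needs 2 * 38 + 2. *)
Definition feas J i a := nsq (fun l => p a l - ctr J i l) <= 100 * beta i ^+ 2.
Definition greedy J (xh : 'I_n -> A) := forall i a, feas J i a ->
  feas J i (xh i) /\ est J xh i (xh i) <= est J xh i a.

Definition dw (J : {ffun 'I_s -> 'I_n}) i := dvn J (fun j => mk i j * w i j).
Definition Vd (J : {ffun 'I_s -> 'I_n}) i l :=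
  dvn J (fun j => mk i j * w i j * (p (x j) l - cen i l)).
(** Two feasible labels always meet the distance condition, by [feasD2]. Building it into the family
    gives all pairs of labels the common envelope [40 * beta i * (w i j * d i j)]. *)
Definition Yd i (ab : A * A) (j : 'I_n) : R :=
  if D2 ab.1 ab.2 <= 400 * beta i ^+ 2 then
    mk i j * w i j * d i j * (r ab.1 (x j) - r ab.2 (x j)) else 0.
Definition ed J i : R := nsq (fun l => ctr J i l - cen i l).

Let mk01 i j : 0 <= mk i j <= 1.
Proof. by rewrite /mk; case: (_ < _)%N => /=; rewrite ?lexx ler01. Qed.
Let mk0 i j : 0 <= mk i j. Proof. by case/andP: (mk01 i j). Qed.
Let mk1 i j : mk i j <= 1. Proof. by case/andP: (mk01 i j). Qed.

Let M0 : 0 <= M.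
Proof.
by case/andP: (p_box (x (Ordinal n0)) (Ordinal k0)) => h1 h2; exact: le_trans h2.
Qed.

Lemma ctr_box J i l : 0 <= ctr J i l <= M.
Proof.
have p0 j : 0 <= p (x j) l <= M by exact: p_box.
rewrite divr_ge0 ?sumr_ge0//=; last by move=> t _; rewrite mulr_ge0//; case/andP: (p0 (J t)).
have [N0|N0] := eqVneq (\sum_t w i (J t)) 0.
  by rewrite /ctr N0 invr0 mulr0.
have Npos : 0 < \sum_t w i (J t) by rewrite lt0r N0 sumr_ge0.
rewrite /ctr ler_pdivrMr// mulr_sumr; apply: ler_sum => t _.
by rewrite mulrC ler_wpM2r//; case/andP: (p0 (J t)).
Qed.

Lemma cen_box i l : 0 <= cen i l <= M.
Proof.
rewrite divr_ge0 ?(ltW W0)//=; last first.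
  by apply: sumr_ge0 => j _; rewrite mulr_ge0//; case/andP: (p_box (x j) l).
rewrite ler_pdivrMr// -(w_row i) mulr_sumr; apply: ler_sum => j _.
by rewrite mulrC ler_wpM2r//; case/andP: (p_box (x j) l).
Qed.

Let dw_le J i : `|dw J i| <= n%:R.
Proof.
have mw j : 0 <= mk i j * w i j <= 1.
  by rewrite mulr_ge0//= -[leRHS]mulr1 ler_pM.
have h1 : 0 <= \sum_j mk i j * w i j <= n%:R.
  rewrite sumr_ge0 => [|j _]; last by case/andP: (mw j).
  rewrite (@le_trans _ _ (\sum_(j < n) 1))//; last by rewrite sumr_const card_ord.
  by apply: ler_sum => j _; case/andP: (mw j).
have h2 : 0 <= n%:R / s%:R * (\sum_t mk i (J t) * w i (J t)) <= n%:R.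
  have sR : 0 < s%:R :> R by rewrite ltr0n.
  rewrite mulr_ge0 ?divr_ge0 ?ler0n ?sumr_ge0//=; last by move=> t _; case/andP: (mw (J t)).
  rewrite mulrAC ler_pdivrMr// ler_pM2l//.
  rewrite (@le_trans _ _ (\sum_(t < s) 1))//; last by rewrite sumr_const card_ord.
  by apply: ler_sum => t _; case/andP: (mw (J t)).
rewrite /dw /dvn ler_norml; lra.
Qed.

(** * Loss of one hybrid step *)

Section Step.
Variables (J : {ffun 'I_s -> 'I_n}) (xh : 'I_n -> A) (G : 'I_n -> R).
Hypothesis gr : greedy J xh.
Hypothesis GY : forall i ab, `|dvn J (Yd i ab)| <= G i.
Hypothesis eta01 : 0 < eta <= 1.
Let eta0 : 0 < eta. Proof. by case/andP: eta01. Qed.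
Let eta1 : eta <= 1. Proof. by case/andP: eta01. Qed.

Let hyb (i : nat) (j : 'I_n) := if (j < i)%N then xh j else x j.

(** The hybrid at step [i] has greedy labels before [i] and optimal ones after it, just as [est]
    assumes; only the sampled half deviates. *)
Let true_est i a : \sum_(j | j != i) pcost i j a (hyb i j) =
  est J xh i a - dvn J (fun j => mk i j * pcost i j a (x j)).
Proof.
rewrite (bigID (fun j : 'I_n => (j < i)%N)) /= /est /dvn.
have -> : \sum_(j < n | (j != i) && (j < i)%N) pcost i j a (hyb i j) =
    \sum_(j < n | (j < i)%N) pcost i j a (xh j).
  apply: eq_big => [j|j /andP[_ ji]]; last by rewrite /hyb ji.
  by case: ltnP => ji; rewrite ?andbF// andbT -val_eqE /= ltn_eqF.
have -> : \sum_(j < n | (j != i) && ~~ (j < i)%N) pcost i j a (hyb i j) =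
    \sum_j mk i j * pcost i j a (x j).
  rewrite big_mkcond; apply: eq_bigr => j _; rewrite /mk /hyb -leqNgt ltnNge.
  rewrite -val_eqE /=; case: ltngtP => ji /=; rewrite ?mul1r ?mul0r//.
by ring.
Qed.

(** The optimal label need not be feasible. Its displacement by [near] is, and it stays within the
    error of the sampled mean. *)
Let comparator i : exists a, [/\ feas J i a & D2 a (x i) <= ed J i].
Proof.
have [a aD ac] := near (x i) (cen i) (ctr_box J i).
exists a; split=> //; apply: (le_trans ac).
have := opt_cen i; have := beta_k i; have := k1; lra.
Qed.

Let feasD2 i a b : feas J i a -> feas J i b -> D2 a b <= 400 * beta i ^+ 2.
Proof.
rewrite /feas => fa fb; have := nsq_tri2 (p a) (ctr J i) (p b).
rewrite -/(D2 a b) (nsqC (ctr J i) (p b)); lra.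
Qed.

Let feas_cen i a : feas J i a ->
  nsq (fun l => p a l - cen i l) <= 200 * beta i ^+ 2 + 2 * ed J i.
Proof.
rewrite /feas => fa; have := nsq_tri2 (p a) (ctr J i) (cen i).
rewrite -/(ed J i); lra.
Qed.

(** Expanding squared distances about [cen i] separates labels from sample: in the first two terms
    the deviations [dw] and [Vd] do not involve [a] and [b], so second moments suffice. Only the
    last term calls for a bound uniform over pairs of labels. *)
Let dev_split i a b :
  dvn J (fun j => mk i j * pcost i j a (x j)) - dvn J (fun j => mk i j * pcost i j b (x j)) =
  (nsq (fun l => p a l - cen i l) - nsq (fun l => p b l - cen i l)) * dw J i
  + \sum_l (- 2 * (p a l - p b l)) * Vd J i l
  + (- 2) * dvn J (fun j => mk i j * w i j * d i j * (r a (x j) - r b (x j))).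
Proof.
have -> : dvn J (fun j => mk i j * pcost i j a (x j))
    - dvn J (fun j => mk i j * pcost i j b (x j)) =
    dvn J (fun j => mk i j * pcost i j a (x j) + (- 1) * (mk i j * pcost i j b (x j))).
  by rewrite dvnD dvnZ mulN1r.
rewrite /dw /Vd -!dvnZ.
under [X in _ = _ + X + _]eq_bigr do rewrite -dvnZ.
rewrite -dvn_sum -!dvnD; apply: eq_dvn => j; rewrite /pcost.
have E : D2 a (x j) - D2 b (x j) =
    nsq (fun l => p a l - cen i l) - nsq (fun l => p b l - cen i l)
    + \sum_l (- 2 * (p a l - p b l)) * (p (x j) l - cen i l).
  rewrite /D2 /nsq -!sumrB -big_split /=; apply: eq_bigr => l _; ring.
have -> : \sum_l - 2 * (p a l - p b l) * (mk i j * w i j * (p (x j) l - cen i l)) =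
   mk i j * w i j * \sum_l (- 2 * (p a l - p b l)) * (p (x j) l - cen i l).
  rewrite mulr_sumr; apply: eq_bigr => l _; ring.
have -> : \sum_l (- 2 * (p a l - p b l)) * (p (x j) l - cen i l) =
  D2 a (x j) - D2 b (x j) -
   (nsq (fun l => p a l - cen i l) - nsq (fun l => p b l - cen i l)) by rewrite E; ring.
ring.
Qed.

(** The greedy label beats any feasible one on the estimate, so in true cost it loses at most a
    difference of two deviations. *)
Let part1 i a : feas J i a ->
  \sum_(j | j != i) (pcost i j (xh i) (hyb i j) - pcost i j a (hyb i j)) <=
  100 * beta i ^+ 2 * (eta * W + dw J i ^+ 2 / (eta * W)) + 2 * n%:R * ed J i
  + 400 * eta * W * beta i ^+ 2 + nsq (Vd J i) / (eta * W) + 2 * G i.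
Proof.
move=> fa; have [fb eb] := gr fa.
have eW : 0 < eta * W by rewrite mulr_gt0.
rewrite sumrB !true_est.
set b := xh i in fb eb *.
apply: (@le_trans _ _ (dvn J (fun j => mk i j * pcost i j a (x j))
   - dvn J (fun j => mk i j * pcost i j b (x j)))); first by lra.
rewrite dev_split.
have ab := feasD2 fa fb.
have t1 : (nsq (fun l => p a l - cen i l) - nsq (fun l => p b l - cen i l)) * dw J i <=
   100 * beta i ^+ 2 * (eta * W + dw J i ^+ 2 / (eta * W)) + 2 * n%:R * ed J i.
  have na := nsq_ge0 (fun l => p a l - cen i l).
  have nb := nsq_ge0 (fun l => p b l - cen i l).
  have := feas_cen fa; have := feas_cen fb.
  set Na := nsq _ in na *; set Nb := nsq _ in nb *; set B := 200 * _ + _ => hb ha.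
  have : (Na - Nb) * dw J i <= B * `|dw J i|.
    rewrite (le_trans (ler_norm _))// normrM ler_wpM2r// ler_norml; lra.
  rewrite /B => h1; have e0 : 0 <= ed J i by exact: nsq_ge0.
  have h2 : 2 * ed J i * `|dw J i| <= 2 * ed J i * n%:R.
    by rewrite ler_wpM2l ?mulr_ge0// dw_le.
  have := amgm2 `|dw J i| 1 eW; rewrite real_normK ?num_real// expr1n !mulr1 => h3.
  have h4 : 100 * beta i ^+ 2 * (2 * `|dw J i|) <=
     100 * beta i ^+ 2 * (eta * W + dw J i ^+ 2 / (eta * W)).
    apply: ler_wpM2l; first by rewrite mulr_ge0 ?sqr_ge0.
    by rewrite addrC.
  lra.
have t2 : \sum_l (- 2 * (p a l - p b l)) * Vd J i l <=
   400 * eta * W * beta i ^+ 2 + nsq (Vd J i) / (eta * W).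
  have : \sum_l (- 2 * (p a l - p b l)) * Vd J i l <=
     \sum_l (eta * W * (p a l - p b l) ^+ 2 + Vd J i l ^+ 2 / (eta * W)).
    apply: ler_sum => l _; have := amgm2 (- Vd J i l) (p a l - p b l) eW.
    rewrite sqrrN; lra.
  rewrite big_split /= -mulr_sumr -mulr_suml -/(nsq _) -/(D2 a b) -/(nsq _).
  have : eta * W * D2 a b <= eta * W * (400 * beta i ^+ 2) by rewrite ler_pM2l.
  lra.
have t3 := GY i (a, b); rewrite /Yd /= ab in t3.
move: t3; rewrite ler_norml => /andP[t3 t4]; lra.
Qed.

(** Weighted AM-GM charges [1 / eta] to the small error [ed] and only [eta] to the distances and the
    data. *)
Let part2 i a : D2 a (x i) <= ed J i ->
  \sum_(j | j != i) (pcost i j a (hyb i j) - pcost i j (x i) (hyb i j)) <=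
  6 / eta * (W * ed J i) + eta * Qd i + eta * \sum_j w i j * D2 (x i) (hyb i j).
Proof.
move=> aD.
have e0 : 0 <= ed J i by exact: nsq_ge0.
have i0 : 1 <= eta^-1 by rewrite invf_ge1.
have : \sum_(j | j != i) (pcost i j a (hyb i j) - pcost i j (x i) (hyb i j)) <=
  \sum_j (6 / eta * ed J i * w i j + eta * (w i j * d i j ^+ 2)
          + eta * (w i j * D2 (x i) (hyb i j))).
  have nn j : 0 <= 6 / eta * ed J i * w i j + eta * (w i j * d i j ^+ 2)
          + eta * (w i j * D2 (x i) (hyb i j)).
    apply: addr_ge0; first apply: addr_ge0; apply: mulr_ge0 => //.
    - by rewrite mulr_ge0// mulr_ge0// invr_ge0 ltW.
    - exact: ltW.
    - by rewrite mulr_ge0// sqr_ge0.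
    - exact: ltW.
    - by rewrite mulr_ge0// D2_ge0.
  rewrite [leRHS](bigD1 i)//= -[leLHS]add0r; apply: lerD => //.
  apply: ler_sum => j _; rewrite /pcost; set h := hyb i j.
  have q1 : D2 a h <= (1 + eta^-1) * ed J i + (1 + eta) * D2 (x i) h.
    apply: (@le_trans _ _ ((1 + eta^-1) * D2 a (x i) + (1 + eta) * D2 (x i) h)).
      rewrite /D2 /nsq !mulr_sumr -big_split /=; apply: ler_sum => l _.
      have := amgm2 (p a l - p (x i) l) (p (x i) l - p h l) eta0; nra.
    rewrite lerD2r ler_wpM2l//; lra.
  have q2 := r_lip a (x i) h.
  have q3 : - (2 * d i j * (r a h - r (x i) h)) <= eta * d i j ^+ 2 + 4 * eta^-1 * ed J i.
    have := amgm2 (- (r a h - r (x i) h)) (d i j) eta0.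
    have : (r a h - r (x i) h) ^+ 2 / eta <= 4 * ed J i / eta.
      by rewrite ler_wpM2r ?invr_ge0 ?(ltW eta0)//; lra.
    rewrite sqrrN; lra.
  have : w i j * (D2 a h - D2 (x i) h - 2 * d i j * (r a h - r (x i) h)) <=
     w i j * (6 / eta * ed J i + eta * d i j ^+ 2 + eta * D2 (x i) h).
    rewrite ler_wpM2l//.
    have : ed J i <= eta^-1 * ed J i by rewrite -[leLHS]mul1r ler_wpM2r.
    lra.
  lra.
rewrite !big_split /= -!mulr_sumr w_row -/W -/(Qd i); lra.
Qed.

(** The comparator shows that a feasible label exists, without which [greedy] would say nothing.
    Then 414 = 3 * (38 + 100). *)
Let distx j : D2 (x j) (xh j) <= 414 * beta j ^+ 2 + 3 * ed J j.
Proof.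
have [a [fa _]] := comparator j; have [fb _] := gr fa.
have := nsq_tri3 (p (x j)) (cen j) (ctr J j) (p (xh j)).
rewrite -/(D2 _ _) (nsqC (cen j) (ctr J j)) -/(ed J j) (nsqC (ctr J j) (p (xh j))).
have := opt_cen j; move: fb; rewrite /feas; lra.
Qed.

Let step_le (i : 'I_n) : fcost (hyb i.+1) - fcost (hyb i) <=
  2 * (501 * eta * Qd i + 100 * beta i ^+ 2 * (dw J i ^+ 2 / (eta * W))
       + nsq (Vd J i) / (eta * W) + 2 * G i + 8 * n%:R / eta * ed J i
       + 2 * eta * Td i
       + 2 * eta * \sum_j w i j * (414 * beta j ^+ 2 + 3 * ed J j)).
Proof.
have -> : hyb i.+1 = (fun j => if j == i then xh i else hyb i j).
  apply/funext => j; rewrite /hyb ltnS -val_eqE /=.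
  by case: ltngtP => // ji; congr xh; apply: val_inj.
rewrite fcost_upd ler_pM2l//.
have -> : hyb i i = x i by rewrite /hyb ltnn.
have [a [fa aD]] := comparator i.
have := part1 fa; have := part2 aD; rewrite !sumrB => h2 h1.
have h3 : \sum_j w i j * D2 (x i) (hyb i j) <=
    2 * Td i + 2 * \sum_j w i j * (414 * beta j ^+ 2 + 3 * ed J j).
  rewrite /Td !mulr_sumr -big_split /=; apply: ler_sum => j _.
  have q1 := nsq_tri2 (p (x i)) (p (x j)) (p (hyb i j)).
  have q2 : D2 (x j) (hyb i j) <= 414 * beta j ^+ 2 + 3 * ed J j.
    rewrite /hyb; case: ifP => _; first exact: distx.
    by rewrite D2xx addr_ge0// mulr_ge0 ?sqr_ge0// nsq_ge0.
  have : w i j * D2 (x i) (hyb i j) <=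
     w i j * (2 * D2 (x i) (x j) + 2 * (414 * beta j ^+ 2 + 3 * ed J j)).
    by rewrite ler_wpM2l// (le_trans q1)// lerD2l ler_pM2l.
  lra.
have {}h3 : eta * (\sum_j w i j * D2 (x i) (hyb i j)) <=
    eta * (2 * Td i + 2 * \sum_j w i j * (414 * beta j ^+ 2 + 3 * ed J j)).
  by rewrite ler_pM2l.
have h4 : 500 * eta * (W * beta i ^+ 2) <= 500 * eta * Qd i.
  by rewrite ler_wpM2l ?Qd_beta// mulr_ge0// ltW.
have e0 : 0 <= ed J i by exact: nsq_ge0.
have i0 : 1 <= eta^-1 by rewrite invf_ge1.
have h5 : 6 / eta * (W * ed J i) <= 6 / eta * (n%:R * ed J i).
  by rewrite ler_wpM2l ?divr_ge0 ?(ltW eta0)// ler_wpM2r.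
have h6 : 2 * n%:R * ed J i <= 2 * n%:R * ed J i / eta.
  by rewrite -[leLHS]mulr1 ler_wpM2l// mulr_ge0// mulr_ge0// ler0n.
lra.
Qed.

(** The hybrid steps telescope. The constants collect as 2674 = 2 * (501 + 2 * 4 + 2 * 414) and 14 =
    8 + 2 * 3. *)
Lemma greedy_le : fcost xh - fcost x <= 2674 * eta * Sd +
  2 * \sum_i (100 * beta i ^+ 2 * (dw J i ^+ 2 / (eta * W))
       + nsq (Vd J i) / (eta * W) + 2 * G i + 14 * n%:R / eta * ed J i).
Proof.
have -> : fcost xh = fcost (hyb n).
  by congr fcost; apply/funext => j; rewrite /hyb ltn_ord.
have -> : fcost x = fcost (hyb 0) by [].
have tel : forall m, (m <= n)%N -> fcost (hyb m) - fcost (hyb 0) =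
    \sum_(i < n | (i < m)%N) (fcost (hyb i.+1) - fcost (hyb i)).
  elim=> [|m IH] mn; first by rewrite subrr big_pred0.
  rewrite (bigD1 (Ordinal mn))//= -[LHS](subrKA (fcost (hyb m))); congr (_ + _).
  rewrite IH; last exact: ltnW.
  apply: eq_bigl => j; rewrite ltnS -val_eqE /=; case: ltngtP => //.
rewrite tel//.
have -> : \sum_(i < n | (i < n)%N) (fcost (hyb i.+1) - fcost (hyb i)) =
   \sum_(i < n) (fcost (hyb i.+1) - fcost (hyb i)).
  by apply: eq_bigl => j; rewrite ltn_ord.
apply: le_trans (ler_sum _ (fun i _ => step_le i)) _.
rewrite -mulr_sumr !big_split /= -!mulr_sumr.
have e1 : \sum_i \sum_j w i j * (414 * beta j ^+ 2 + 3 * ed J j) =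
   414 * (\sum_i W * beta i ^+ 2) + 3 * W * \sum_i ed J i.
  rewrite exchange_big /= !mulr_sumr -big_split /=; apply: eq_bigr => j _.
  have -> : W = \sum_i w i j.
    by rewrite /W -(w_row j); apply: eq_bigr => i _; rewrite w_sym.
  rewrite -mulr_suml; ring.
rewrite e1.
have e2 : \sum_i W * beta i ^+ 2 <= Sd by apply: ler_sum => i _; exact: Qd_beta.
have e3 := sum_Td.
have E0 : 0 <= \sum_i ed J i by apply: sumr_ge0 => i _; exact: nsq_ge0.
have e4 : eta * (\sum_i Td i) <= eta * (4 * Sd) by rewrite ler_pM2l.
have e5 : eta * (\sum_i W * beta i ^+ 2) <= eta * Sd by rewrite ler_pM2l.
have i0 : 1 <= eta^-1 by rewrite invf_ge1.
have e6 : eta * W * (\sum_i ed J i) <= n%:R / eta * (\sum_i ed J i).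
  rewrite ler_wpM2r// mulrC; apply: ler_pM;
    [exact: ltW|exact: ltW|exact: Wn|exact: le_trans eta1 i0].
rewrite -/Sd; lra.
Qed.

End Step.

(** * Mean loss over the samples *)

Section Expectation.
Hypothesis eta01 : 0 < eta <= 1.
Hypothesis Gam1 : 1 <= Gam.
Hypothesis sG : Gam <= s%:R * (eta ^+ 2 * delta ^+ 2).
Hypothesis cardA : 2 * (#|A| * #|A|)%:R <= expR Gam.
(** The squared diameter of the box times a bound on the probability that the sampled weights fall
    below a quarter of their mean. *)
Hypothesis bad : k%:R * M ^+ 2 * expR (- (s%:R * delta / 4)) <= eta ^+ 2 * delta / 14.
Let eta0 : 0 < eta. Proof. by case/andP: eta01. Qed.
Let eta1 : eta <= 1. Proof. by case/andP: eta01. Qed.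
Let sR : 0 < s%:R :> R. Proof. by rewrite ltr0n. Qed.
Let dl1 : delta <= 1. Proof. by case/andP: delta01. Qed.

Let mw2 i j : (mk i j * w i j) ^+ 2 <= w i j.
Proof.
have : 0 <= mk i j * w i j <= w i j.
  by rewrite mulr_ge0//= -[leRHS]mul1r ler_wpM2r.
have := w0 i j; have := w1 i j; nra.
Qed.

Let Ex_dw i : Ex (fun J => dw J i ^+ 2) <= n%:R / s%:R * W.
Proof.
rewrite (le_trans (Ex_dvn_sqr n0 s0 _))// ler_wpM2l ?divr_ge0 ?ler0n//.
rewrite /W -(w_row i); apply: ler_sum => j _; exact: mw2.
Qed.

Let Ex_V i : Ex (fun J => nsq (Vd J i)) <= n%:R / s%:R * Td i.
Proof.
rewrite /nsq Ex_sum.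
apply: (@le_trans _ _ (\sum_l n%:R / s%:R *
   \sum_j (mk i j * w i j * (p (x j) l - cen i l)) ^+ 2)).
  by apply: ler_sum => l _; exact: Ex_dvn_sqr.
rewrite -mulr_sumr ler_wpM2l ?divr_ge0 ?ler0n//.
apply: le_trans (Td_ge i); rewrite exchange_big /=; apply: ler_sum => j _.
rewrite /nsq mulr_sumr; apply: ler_sum => l _.
rewrite exprMn -[_ - p _ _]opprB sqrrN ler_wpM2r ?sqr_ge0//.
Qed.

Let sGd : Gam / (eta * delta) <= s%:R * eta.
Proof.
rewrite ler_pdivrMr ?mulr_gt0//; apply: (le_trans sG).
have -> : s%:R * (eta ^+ 2 * delta ^+ 2) = s%:R * eta * (eta * delta) * delta by ring.
rewrite -[leRHS]mulr1 ler_pM2l//.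
by rewrite mulr_gt0 // mulr_gt0.
Qed.

Let s1d : 1 <= s%:R * eta ^+ 2 * delta ^+ 2.
Proof. by apply: le_trans Gam1 _; rewrite -mulrA. Qed.

Let s1 : 1 <= s%:R * eta ^+ 2 * delta.
Proof.
apply: (le_trans s1d); apply: ler_wpM2l.
  by apply: mulr_ge0; [exact: ler0n|exact: sqr_ge0].
by rewrite expr2 -[leRHS]mul1r ler_wpM2r// ltW.
Qed.

(** The choice [lam = eta * W / Qd i] makes both terms of [sup_dev] O(eta Qd): the first by [sGd],
    the second because the squared envelope sums to O(beta^2 Qd) and W beta^2 <= Qd. *)
Let Ex_G i : exists G : {ffun 'I_s -> 'I_n} -> R,
  (forall J ab, `|dvn J (Yd i ab)| <= G J) /\ Ex G <= 9601 * eta * Qd i.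
Proof.
have Q0 : 0 < Qd i.
  apply: lt_le_trans (Qd_beta i); rewrite mulr_gt0// exprn_gt0//.
  by have := beta1 i; lra.
pose lam := eta * W / Qd i.
have lam0 : 0 < lam by rewrite divr_gt0 ?mulr_gt0.
pose pp j := 40 * beta i * (w i j * d i j).
have Yp (ab : A * A) j : `|Yd i ab j| <= pp j.
  have p0 : 0 <= pp j by apply: mulr_ge0; apply: mulr_ge0.
  rewrite /Yd; case: ifP => [H|_]; last by rewrite normr0.
  have h : `|r ab.1 (x j) - r ab.2 (x j)| <= 40 * beta i.
    apply: le_norm_sqr; first by rewrite mulr_ge0.
    apply: (le_trans (r_lip _ _ _)); rewrite exprMn; lra.
  rewrite normrM (ger0_norm (_ : 0 <= mk i j * w i j * d i j)) ?mulr_ge0//.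
  rewrite /pp mulrC ler_pM// ?mulr_ge0//.
  by rewrite -mulrA -[leRHS]mul1r ler_wpM2r// mulr_ge0.
have cI : 2 * #|{: A * A}|%:R <= expR Gam by rewrite card_prod.
have [G [G1 G2]] := sup_dev n0 s0 lam0 Yp cI.
exists G; split=> //; apply: (le_trans G2).
have e1 : n%:R * Gam / (lam * s%:R) = Gam / (eta * delta) / s%:R * Qd i.
  by rewrite /lam /W; field; rewrite !gt_eqF.
have h1 : Gam / (eta * delta) / s%:R <= eta.
  by rewrite ler_pdivrMr// [leRHS]mulrC.
have h2 : n%:R * Gam / (lam * s%:R) <= eta * Qd i by rewrite e1 ler_pM2r.
have h3 : \sum_j pp j ^+ 2 <= 1600 * beta i ^+ 2 * Qd i.
  rewrite /Qd mulr_sumr; apply: ler_sum => j _; rewrite /pp.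
  have -> : (40 * beta i * (w i j * d i j)) ^+ 2 =
     1600 * beta i ^+ 2 * (w i j * (w i j * d i j ^+ 2)) by ring.
  apply: ler_wpM2l; first by apply: mulr_ge0; [|exact: sqr_ge0].
  rewrite -[leRHS]mul1r; apply: ler_wpM2r => //.
  by apply: mulr_ge0; [|exact: sqr_ge0].
have h4 : 6 * lam * (\sum_j pp j ^+ 2) <= 6 * lam * (1600 * beta i ^+ 2 * Qd i).
  by rewrite ler_wpM2l// mulr_ge0// ltW.
have e2 : 6 * lam * (1600 * beta i ^+ 2 * Qd i) = 9600 * eta * (W * beta i ^+ 2).
  by rewrite /lam; field; rewrite gt_eqF.
have h5 : 9600 * eta * (W * beta i ^+ 2) <= 9600 * eta * Qd i.
  by rewrite ler_wpM2l ?Qd_beta// mulr_ge0// ltW.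
lra.
Qed.

Let U i (J : {ffun 'I_s -> 'I_n}) : R :=
  nsq (fun l => \sum_t w i (J t) * (p (x (J t)) l - cen i l)).
Let NN i (J : {ffun 'I_s -> 'I_n}) : R := \sum_t w i (J t).

(** Either the sampled weight is at least a quarter of its mean [s * delta], and dividing by it is
    harmless, or the box bounds the error. The exponential majorises the indicator of the second
    case, and its mean factorises over the draws. *)
Let ed_le i J : ed J i <= 16 / (s%:R * delta) ^+ 2 * U i J
   + k%:R * M ^+ 2 * expR (s%:R * delta / 4 - NN i J).
Proof.
have sd : 0 < s%:R * delta by rewrite mulr_gt0.
have U0 : 0 <= U i J by exact: nsq_ge0.
have [H|H] := leP (s%:R * delta / 4) (NN i J); last first.
  have e1 : 1 <= expR (s%:R * delta / 4 - NN i J).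
    by apply: le_trans (expR_ge1Dx _); lra.
  have : ed J i <= k%:R * M ^+ 2.
    rewrite /ed /nsq; apply: (@le_trans _ _ (\sum_(l < k) M ^+ 2)); last first.
      by rewrite sumr_const card_ord [leRHS]mulr_natl.
    apply: ler_sum => l _; have := ctr_box J i l; have := cen_box i l; nra.
  have : k%:R * M ^+ 2 * 1 <= k%:R * M ^+ 2 * expR (s%:R * delta / 4 - NN i J).
    by rewrite ler_wpM2l// mulr_ge0 ?sqr_ge0.
  have : 0 <= 16 / (s%:R * delta) ^+ 2 * U i J.
    by rewrite mulr_ge0// divr_ge0 ?sqr_ge0.
  lra.
have N0 : 0 < NN i J by lra.
have -> : ed J i = U i J / NN i J ^+ 2.
  rewrite /ed /U /nsq mulr_suml; apply: eq_bigr => l _.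
  have -> : \sum_t w i (J t) * (p (x (J t)) l - cen i l) =
     (ctr J i l - cen i l) * NN i J.
    under eq_bigr do rewrite mulrBr.
    by rewrite sumrB -mulr_suml /ctr -/(NN i J); field; rewrite gt_eqF.
  by field; rewrite gt_eqF.
have h1 : U i J / NN i J ^+ 2 <= 16 / (s%:R * delta) ^+ 2 * U i J.
  rewrite ler_pdivrMr ?exprn_gt0//.
  have -> : 16 / (s%:R * delta) ^+ 2 * U i J * NN i J ^+ 2 =
      U i J * (NN i J / (s%:R * delta / 4)) ^+ 2.
    by field; rewrite !gt_eqF.
  rewrite -[leLHS]mulr1 ler_wpM2l// exprn_ege1// ler_pdivlMr ?mul1r//.
  by rewrite divr_gt0.
have : 0 <= k%:R * M ^+ 2 * expR (s%:R * delta / 4 - NN i J).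
  by rewrite mulr_ge0 ?expR_ge0// mulr_ge0 ?sqr_ge0.
lra.
Qed.

Let Ex_U i : Ex (U i) <= s%:R / n%:R * Td i.
Proof.
rewrite /U /nsq Ex_sum.
apply: (@le_trans _ _ (\sum_l s%:R / n%:R * \sum_j w i j * (p (x j) l - cen i l) ^+ 2)).
  apply: ler_sum => l _.
  rewrite (@Ex_sqr R n s n0 (fun j => w i j * (p (x j) l - cen i l))); last first.
    by rewrite /mean cen0 mul0r.
  have E (z : R) : s%:R * (z / n%:R) = s%:R / n%:R * z by ring.
  rewrite /mean E; apply: ler_wpM2l; first by rewrite divr_ge0 ?ler0n.
  apply: ler_sum => j _; rewrite exprMn ler_wpM2r ?sqr_ge0//.
  by have := w0 i j; have := w1 i j; nra.
rewrite -mulr_sumr ler_wpM2l ?divr_ge0 ?ler0n//.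
apply: le_trans (Td_ge i); rewrite exchange_big /=; apply: ler_sum => j _.
rewrite /nsq mulr_sumr; apply: ler_sum => l _.
by rewrite -[_ - p _ _]opprB sqrrN.
Qed.

(** Since exp(-w) <= 1 - w/2 on [0, 1], each draw contributes at most 1 - delta/2 <=
    exp(-delta/2). *)
Let Ex_N i : Ex (fun J => expR (- NN i J)) <= expR (- (s%:R * delta / 2)).
Proof.
rewrite (@eq_Ex _ _ _ _ (fun J => \prod_t expR (- w i (J t)))); last first.
  by move=> J; rewrite -expR_sum sumrN.
rewrite (Ex_prod (fun _ j => expR (- w i j))) prodr_const card_ord.
have -> : - (s%:R * delta / 2) = s%:R * (- (delta / 2)) by lra.
rewrite expRM_natl lerXn2r ?nnegrE ?expR_ge0//.
  by rewrite -(mean_cst n0 0); apply: mean_le => j; exact: expR_ge0.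
apply: le_trans (expR_ge1Dx _).
apply: (@le_trans _ _ (mean (fun j => 1 + (- 2^-1) * w i j))).
  apply: mean_le => j; rewrite expRN.
  have h := expR_ge1Dx (w i j); have := w0 i j; have := w1 i j => hw1 hw0.
  rewrite invf_ple ?posrE ?expR_gt0//; last by lra.
  apply: le_trans h; rewrite -[leLHS]mul1r ler_pdivrMr; last by lra.
  nra.
rewrite meanD mean_cst// meanZ /mean w_row.
have -> : delta * n%:R / n%:R = delta by field; rewrite gt_eqF.
lra.
Qed.

Let Ex_ed i : Ex (fun J => ed J i) <=
  16 / (s%:R * delta ^+ 2 * n%:R) * Td i + eta ^+ 2 * delta / 14.
Proof.
apply: (le_trans (Ex_le (ed_le i))).
rewrite ExD !ExZ.
have -> : Ex (fun J => expR (s%:R * delta / 4 - NN i J)) =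
   expR (s%:R * delta / 4) * Ex (fun J => expR (- NN i J)).
  by rewrite -ExZ; apply: eq_Ex => J; rewrite expRD.
have kM : 0 <= k%:R * M ^+ 2 by rewrite mulr_ge0 ?sqr_ge0.
apply: lerD.
  apply: (@le_trans _ _ (16 / (s%:R * delta) ^+ 2 * (s%:R / n%:R * Td i))).
    by rewrite ler_wpM2l ?divr_ge0 ?sqr_ge0.
  suff -> : 16 / (s%:R * delta) ^+ 2 * (s%:R / n%:R * Td i) =
    16 / (s%:R * delta ^+ 2 * n%:R) * Td i by [].
  by field; rewrite !gt_eqF.
apply: le_trans bad.
have -> : - (s%:R * delta / 4) = s%:R * delta / 4 + - (s%:R * delta / 2) by lra.
by rewrite expRD; apply: ler_wpM2l => //; apply: ler_wpM2l; rewrite ?expR_ge0.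
Qed.

(** A sample no worse than the average is taken. Here 500 * 100 rounds up 2674 + 2 * 204 * 100,
    where 204 * 100 rounds up 194 * 100 + 4 * 225 + 1 and 194 * 100 rounds up 100 + 2 * 9601. *)
Lemma sampling_core : exists J, forall xh, greedy J xh ->
  fcost xh <= fcost x + (500 * 100) * eta * Sd.
Proof.
have [G HG] := choice Ex_G.
pose Er J := \sum_i (100 * beta i ^+ 2 * (dw J i ^+ 2 / (eta * W))
   + nsq (Vd J i) / (eta * W) + 2 * G i J + 14 * n%:R / eta * ed J i).
have [J HJ] := Ex_exists n0 Er.
exists J => xh gr.
have := @greedy_le J xh (fun i => G i J) gr (fun i ab => (HG i).1 J ab) eta01.
rewrite -/(Er J) => le1.
have S0 : 0 <= eta * Sd.
  apply: mulr_ge0; first exact: ltW.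
  by apply: sumr_ge0 => i _; apply: sumr_ge0 => j _; rewrite mulr_ge0 ?sqr_ge0.
suff : Ex Er <= (204 * 100) * eta * Sd by move: HJ le1 S0; lra.
have T0 i : 0 <= Td i by apply: sumr_ge0 => j _; rewrite mulr_ge0// D2_ge0.
rewrite /Er Ex_sum.
apply: (@le_trans _ _ (\sum_i ((194 * 100) * eta * Qd i + 225 * eta * Td i + eta * W))).
  apply: ler_sum => i _; rewrite !ExD !ExZ.
  have -> : Ex (fun J => dw J i ^+ 2 / (eta * W)) = Ex (fun J => dw J i ^+ 2) / (eta * W).
    by rewrite [RHS]mulrC -ExZ; apply: eq_Ex => J'; rewrite [LHS]mulrC.
  have -> : Ex (fun J => nsq (Vd J i) / (eta * W)) = Ex (fun J => nsq (Vd J i)) / (eta * W).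
    by rewrite [RHS]mulrC -ExZ; apply: eq_Ex => J'; rewrite [LHS]mulrC.
  have eW : 0 < eta * W by rewrite mulr_gt0.
  have s1' : (s%:R * eta * delta)^-1 <= eta.
    rewrite invf_ple ?posrE ?mulr_gt0// -[leLHS]mul1r ler_pdivrMr//.
    by have := s1; rewrite expr2; lra.
  have h1 : 100 * beta i ^+ 2 * (Ex (fun J => dw J i ^+ 2) / (eta * W)) <= 100 * eta * Qd i.
    apply: (@le_trans _ _ (100 * beta i ^+ 2 * (n%:R / s%:R * W / (eta * W)))).
      apply: ler_wpM2l; first by apply: mulr_ge0; [|exact: sqr_ge0].
      by apply: ler_wpM2r (Ex_dw i); rewrite invr_ge0 ltW.
    have -> : 100 * beta i ^+ 2 * (n%:R / s%:R * W / (eta * W)) =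
        (100 * (W * beta i ^+ 2)) * (s%:R * eta * delta)^-1.
      by rewrite /W; field; rewrite !gt_eqF.
    have -> : 100 * eta * Qd i = 100 * Qd i * eta by ring.
    have b2 : 0 <= W * beta i ^+ 2 by rewrite mulr_ge0 ?sqr_ge0// ltW.
    apply: ler_pM => //; first by rewrite mulr_ge0.
      by rewrite invr_ge0; apply: mulr_ge0; [apply: mulr_ge0|]; rewrite ltW.
    by rewrite ler_pM2l// Qd_beta.
  have h2 : Ex (fun J => nsq (Vd J i)) / (eta * W) <= eta * Td i.
    apply: (@le_trans _ _ (n%:R / s%:R * Td i / (eta * W))).
      by apply: ler_wpM2r (Ex_V i); rewrite invr_ge0 ltW.
    have -> : n%:R / s%:R * Td i / (eta * W) = (s%:R * eta * delta)^-1 * Td i.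
      by rewrite /W; field; rewrite !gt_eqF.
    by rewrite ler_wpM2r.
  have h3 := (HG i).2.
  have Q0 : 0 <= eta * Qd i.
    apply: mulr_ge0; first exact: ltW.
    by apply: sumr_ge0 => j _; rewrite mulr_ge0 ?sqr_ge0.
  have h4 : 14 * n%:R / eta * Ex (fun J => ed J i) <= 224 * eta * Td i + eta * W.
    apply: (@le_trans _ _ (14 * n%:R / eta *
       (16 / (s%:R * delta ^+ 2 * n%:R) * Td i + eta ^+ 2 * delta / 14))).
      by apply: ler_wpM2l (Ex_ed i); rewrite divr_ge0 ?mulr_ge0 ?ler0n// ltW.
    have -> : 14 * n%:R / eta *
       (16 / (s%:R * delta ^+ 2 * n%:R) * Td i + eta ^+ 2 * delta / 14) =
       224 * ((s%:R * eta * delta ^+ 2)^-1 * Td i) + eta * W.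
      by rewrite /W; field; rewrite !gt_eqF.
    have : (s%:R * eta * delta ^+ 2)^-1 * Td i <= eta * Td i.
      rewrite ler_wpM2r// invf_ple ?posrE ?mulr_gt0 ?exprn_gt0//.
      rewrite -[leLHS]mul1r ler_pdivrMr//.
      by have := s1d; rewrite expr2; lra.
    lra.
  lra.
rewrite 2!big_split /= -[X in X + _ + _]mulr_sumr -[X in _ + X + _]mulr_sumr -/Sd.
have h1 : \sum_(i < n) eta * W <= eta * Sd.
  rewrite /Sd mulr_sumr; apply: ler_sum => i _; rewrite ler_pM2l//.
  apply: le_trans (Qd_beta i); rewrite -[leLHS]mulr1 ler_pM2l//.
  by have := beta_k i; have := k1; lra.
have h2 : eta * (\sum_i Td i) <= eta * (4 * Sd) by rewrite ler_pM2l// sum_Td.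
move: h1 h2 S0; lra.
Qed.

End Expectation.

End Core.

(** * Labels and rounding *)

Section Euclid.
Variables (R : realType) (k : nat).
Implicit Types u v t : 'I_k -> R.

Lemma cauchy_schwarz u v : (\sum_l u l * v l) ^+ 2 <= nsq u * nsq v.
Proof.
have [v0|v0] := eqVneq (nsq v) 0.
  have vl l : v l = 0.
    apply/eqP; rewrite -sqrf_eq0; apply/eqP.
    exact: (psumr_eq0P (fun i _ => sqr_ge0 (v i)) v0).
  by rewrite big1 ?expr0n ?v0 ?mulr0// => l _; rewrite vl mulr0.
have vpos : 0 < nsq v by rewrite lt0r v0 nsq_ge0.
have : 0 <= nsq (fun l => u l * nsq v - v l * \sum_l u l * v l) by exact: nsq_ge0.
set c := \sum_l _.
have -> : nsq (fun l => u l * nsq v - v l * c) = nsq v * (nsq u * nsq v - c ^+ 2).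
  transitivity (\sum_l (nsq v ^+ 2 * u l ^+ 2 - 2 * nsq v * c * (u l * v l)
      + c ^+ 2 * v l ^+ 2)).
    by apply: eq_bigr => l _; ring.
  rewrite big_split sumrB /= -!mulr_sumr -/c -/(nsq u) -/(nsq v); ring.
by rewrite pmulr_rge0// subr_ge0.
Qed.

Lemma sqrt_nsq_triangle u v t : Num.sqrt (nsq (fun l => u l - t l)) <=
  Num.sqrt (nsq (fun l => u l - v l)) + Num.sqrt (nsq (fun l => v l - t l)).
Proof.
set a := nsq (fun l => u l - v l); set b := nsq (fun l => v l - t l).
have a0 : 0 <= a by exact: nsq_ge0.
have b0 : 0 <= b by exact: nsq_ge0.
have sa := sqrtr_ge0 a; have sb := sqrtr_ge0 b.
rewrite -ler_sqr ?nnegrE ?addr_ge0 ?sqrtr_ge0// sqr_sqrtr ?nsq_ge0//.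
rewrite sqrrD !sqr_sqrtr//.
pose c := \sum_l (u l - v l) * (v l - t l).
have -> : nsq (fun l => u l - t l) = a + c *+ 2 + b.
  rewrite /a /b /c /nsq -sumrMnl -!big_split /=; apply: eq_bigr => l _; ring.
rewrite lerD2r lerD2l lerMn2r /=.
apply: (le_trans (ler_norm _)); apply: le_norm_sqr; first by rewrite mulr_ge0.
by rewrite exprMn !sqr_sqrtr//; exact: cauchy_schwarz.
Qed.

Lemma sqrt_nsq_lip u v t :
  `|Num.sqrt (nsq (fun l => u l - t l)) - Num.sqrt (nsq (fun l => v l - t l))|
  <= Num.sqrt (nsq (fun l => u l - v l)).
Proof.
have h1 := sqrt_nsq_triangle u v t; have := sqrt_nsq_triangle v u t.
rewrite (nsqC v u) => h2; rewrite ler_norml; lra.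
Qed.

End Euclid.

Lemma digits_exist b m (f : nat -> nat) : (forall t, (t < m)%N -> (f t < b)%N) ->
  exists2 N, (N < b ^ m)%N & forall t, (t < m)%N -> ((N %/ b ^ t) %% b)%N = f t.
Proof.
elim: m => [|m IH] fb; first by exists 0%N.
have [|N Nb HN] := IH; first by move=> t tm; apply: fb; exact: leqW.
have b0 : (0 < b)%N by apply: leq_ltn_trans (fb m (ltnSn m)).
exists (N + f m * b ^ m)%N.
  have : ((f m).+1 * b ^ m <= b * b ^ m)%N by rewrite leq_mul2r fb ?orbT.
  by rewrite expnS mulSn; lia.
move=> t; rewrite ltnS leq_eqVlt => /predU1P[->|tm].
  rewrite divnDr ?dvdn_mull// divn_small// add0n mulnK ?expn_gt0 ?b0//.
  by rewrite modn_small// fb.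
have e : (f m * b ^ m = f m * b ^ (m - t).-1 * b * b ^ t)%N.
  rewrite -!mulnA; congr (_ * _)%N; rewrite -expnS -expnD; congr (_ ^ _)%N; lia.
by rewrite e divnDMl ?expn_gt0 ?b0// -modnDmr modnMl addn0 HN.
Qed.

(** * Labels as base-[Q] numbers, and distances rounded down *)

Section Codes.
Variables (R : realType) (k Q : nat).
Hypothesis Q0 : (0 < Q)%N.

Definition dig (a l : nat) : nat := ((a %/ Q ^ l) %% Q)%N.
Definition pt (a : 'I_(Q ^ k)) (l : 'I_k) : R := (dig a l)%:R.

(** Integer part of the square root, for [z] up to (k Q)^2. Counting the squares that do not exceed
    [z] takes only sums and comparisons. *)
Definition flr (z : R) : R :=
  \sum_(m < k * Q) (if m.+1%:R ^+ 2 <= z then 1 else 0).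
Definition rr (a b : 'I_(Q ^ k)) : R := flr (D2 pt a b).

Lemma dig_lt a l : (dig a l < Q)%N. Proof. by rewrite ltn_mod. Qed.

Lemma pt_box a l : 0 <= pt a l <= Q.-1%:R.
Proof. by rewrite ler0n /= ler_nat -ltnS prednK// dig_lt. Qed.

Lemma pt_ex (f : 'I_k -> nat) : (forall l, (f l < Q)%N) ->
  exists a, forall l, pt a l = (f l)%:R.
Proof.
move=> fQ; pose g t := if insub t is Some l then f l else 0%N.
have [|N NL HN] := @digits_exist Q k g.
  by move=> t tk; rewrite /g; case: insubP.
by exists (Ordinal NL) => l; rewrite /pt /dig HN// /g valK.
Qed.

Lemma flrP z : 0 <= z -> z <= (k * Q)%:R ^+ 2 ->
  flr z <= Num.sqrt z < flr z + 1.
Proof.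
move=> z0 zk; set y := Num.sqrt z; have y0 : 0 <= y by exact: sqrtr_ge0.
have yk : y <= (k * Q)%:R by rewrite -ler_sqr ?nnegrE ?ler0n// sqr_sqrtr.
have -> : flr z = (Num.truncn y)%:R.
  rewrite /flr.
  have -> : \sum_(m < k * Q) (if m.+1%:R ^+ 2 <= z then 1 else 0) =
     \sum_(m < k * Q | (m < Num.truncn y)%N) (1 : R).
    rewrite [RHS]big_mkcond; apply: eq_bigr => m _.
    rewrite truncn_gt_nat -(@ler_sqr _ _ y) ?nnegrE ?ler0n// sqr_sqrtr//.
  have tk : (Num.truncn y <= k * Q)%N.
    by rewrite -(ler_nat R); case/andP: (truncn_itv y0) => h _; exact: le_trans yk.
  rewrite -(big_ord_widen _ (fun _ => 1 : R) tk) sumr_const card_ord//.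
by rewrite natr1; exact: truncn_itv.
Qed.

Lemma D2_pt_le a b : D2 pt a b <= (k * Q)%:R ^+ 2.
Proof.
have h l : (pt a l - pt b l) ^+ 2 <= Q%:R ^+ 2.
  have := pt_box a l; have := pt_box b l.
  have : Q.-1%:R <= Q%:R :> R by rewrite ler_nat leq_pred.
  nra.
apply: (le_trans (ler_sum _ (fun l _ => h l))).
rewrite sumr_const card_ord -[leLHS]mulr_natl natrM exprMn.
rewrite ler_wpM2r ?sqr_ge0// -natrX ler_nat; case: k => // m; rewrite leq_pmulr//.
Qed.

Lemma rrP a b : rr a b <= Num.sqrt (D2 pt a b) < rr a b + 1.
Proof. by apply: flrP; [exact: D2_ge0|exact: D2_pt_le]. Qed.

Lemma rr_ge0 a b : 0 <= rr a b.
Proof. by apply: sumr_ge0 => m _; case: ifP. Qed.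

Lemma rr_sym a b : rr a b = rr b a. Proof. by rewrite /rr D2C. Qed.

Lemma rr_le a b : rr a b ^+ 2 <= D2 pt a b.
Proof.
rewrite -[leRHS]sqr_sqrtr ?D2_ge0// ler_sqr ?nnegrE ?rr_ge0 ?sqrtr_ge0//.
by case/andP: (rrP a b).
Qed.

Lemma D2_pt_int a b : D2 pt a b = 0 \/ 1 <= D2 pt a b.
Proof.
have e l : (pt a l - pt b l) ^+ 2 =
    ((dig a l - dig b l) ^ 2 + (dig b l - dig a l) ^ 2)%N%:R.
  rewrite /pt; case: (leqP (dig a l) (dig b l)) => H.
    move: (H); rewrite -subn_eq0 => /eqP ->; rewrite add0n natrX natrB// -sqrrN opprB//.
  have H' := ltnW H; move: (H'); rewrite -subn_eq0 => /eqP ->.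
  by rewrite addn0 natrX natrB.
have -> : D2 pt a b =
   (\sum_(l < k) ((dig a l - dig b l) ^ 2 + (dig b l - dig a l) ^ 2))%N%:R.
  by rewrite natr_sum; apply: eq_bigr => l _; rewrite e.
case: (\sum_(l < k) _)%N => [|m]; first by left.
by right; rewrite ler1n.
Qed.

(** Rounding down costs an additive 1, but distinct grid points are at distance at least 1, so the
    loss becomes a factor 2 on the distance. *)
Lemma rr_lip a b x : (rr a x - rr b x) ^+ 2 <= 4 * D2 pt a b.
Proof.
have D0 := D2_ge0 pt a b.
have [H|H] := D2_pt_int a b.
  suff -> : rr a x = rr b x by rewrite subrr expr0n mulr_ge0.
  rewrite /rr; congr flr; apply: eq_bigr => l _; congr ((_ - _) ^+ 2).
  apply/eqP; rewrite -subr_eq0 -sqrf_eq0; apply/eqP.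
  exact: (psumr_eq0P (fun i _ => sqr_ge0 (pt a i - pt b i)) H).
have s1 : 1 <= Num.sqrt (D2 pt a b) by rewrite -sqrtr1 ler_sqrt//; lra.
have := sqrt_nsq_lip (pt a) (pt b) (pt x); rewrite -!/(D2 pt _ _).
have := rrP a x; have := rrP b x; move=> h1 h2; rewrite ler_norml => h3.
have : `|rr a x - rr b x| <= 2 * Num.sqrt (D2 pt a b) by rewrite ler_norml; lra.
rewrite -ler_sqr ?nnegrE ?mulr_ge0 ?sqrtr_ge0// real_normK ?num_real//.
by rewrite exprMn sqr_sqrtr//; lra.
Qed.

(** Move from [a] towards [c] by the integer part of min(|c - a|, |c - m|). If the first is the
    smaller, the end is within 1 of [c]; otherwise the remaining gap is at most |c - a| - |c - m| +
    1 <= |a - m| + 1. *)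
Lemma step_toward (a M : nat) (c m : R) : (a <= M)%N -> 0 <= c <= M%:R ->
  exists b : nat, [/\ (b <= M)%N, (b%:R - a%:R) ^+ 2 <= (c - m) ^+ 2 &
    (b%:R - c) ^+ 2 <= 2 * (a%:R - m) ^+ 2 + 2].
Proof.
move=> aM /andP[c0 cM].
suff [b [bM h1 h2]] : exists b : nat, [/\ (b <= M)%N, `|b%:R - a%:R| <= `|c - m| &
    `|b%:R - c| <= `|a%:R - m| + 1].
  exists b; split=> //.
    by rewrite -(real_normK (num_real (b%:R - a%:R))) -(real_normK (num_real (c - m)))
         ler_sqr ?nnegrE.
  rewrite -(real_normK (num_real (b%:R - c))) -(real_normK (num_real (a%:R - m))).
  have : `|b%:R - c| ^+ 2 <= (`|a%:R - m| + 1) ^+ 2.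
    by rewrite ler_sqr ?nnegrE ?addr_ge0.
  have := sqrD2_le `|a%:R - m| 1; rewrite expr1n; lra.
have tri : `|c - a%:R| <= `|c - m| + `|a%:R - m|.
  rewrite (distrC a%:R m); have -> : c - a%:R = (c - m) + (m - a%:R) by ring.
  exact: ler_normD.
have n0 := normr_ge0 (c - m); have n1 := normr_ge0 (a%:R - m).
have [H|H] := leP a%:R c.
  pose t := Num.truncn (Num.min (c - a%:R) `|c - m|).
  have m0 : 0 <= Num.min (c - a%:R) `|c - m| by rewrite le_min subr_ge0 H.
  have /andP[t1 t2] := truncn_itv m0; rewrite -/t -natr1 in t1 t2.
  move: t1; rewrite le_min => /andP[t1 t3].
  rewrite (ger0_norm (_ : 0 <= c - a%:R)) in tri; last by lra.
  have t0 : 0 <= t%:R :> R by exact: ler0n.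
  exists (a + t)%N; split.
  - by rewrite -(ler_nat R) natrD; lra.
  - by rewrite natrD addrC addKr ger0_norm.
  - rewrite natrD (distrC _ c) ger0_norm; last by lra.
    by move: t2; rewrite gt_min => /orP[] t2; lra.
pose t := Num.truncn (Num.min (a%:R - c) `|c - m|).
have m0 : 0 <= Num.min (a%:R - c) `|c - m| by rewrite le_min subr_ge0 (ltW H).
have /andP[t1 t2] := truncn_itv m0; rewrite -/t -natr1 in t1 t2.
move: t1; rewrite le_min => /andP[t1 t3].
rewrite (distrC c a%:R) (ger0_norm (_ : 0 <= a%:R - c)) in tri; last by lra.
have t0 : 0 <= t%:R :> R by exact: ler0n.
have ta : (t <= a)%N by rewrite -(ler_nat R); lra.
exists (a - t)%N; split.
- exact: leq_trans (leq_subr _ _) aM.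
- by rewrite natrB// addrC addKr normrN ger0_norm.
- rewrite natrB// ger0_norm; last by lra.
  by move: t2; rewrite gt_min => /orP[] t2; lra.
Qed.

Lemma pt_near a (c m : 'I_k -> R) : (forall l, 0 <= c l <= Q.-1%:R) ->
  exists2 b, D2 pt b a <= nsq (fun l => c l - m l) &
    nsq (fun l => pt b l - c l) <= 2 * nsq (fun l => pt a l - m l) + 2 * k%:R.
Proof.
move=> cM.
have aM (l : 'I_k) : (dig a l <= Q.-1)%N by rewrite -ltnS prednK// dig_lt.
have H l := step_toward (m l) (aM l) (cM l).
have [f Hf] := choice H.
have [|b Hb] := @pt_ex f; first by move=> l; case: (Hf l) => h _ _; rewrite -(prednK Q0) ltnS.
exists b.
  by apply: ler_sum => l _; rewrite Hb; case: (Hf l).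
have -> : 2 * k%:R = \sum_(l < k) (2 : R).
  by rewrite sumr_const card_ord -[RHS]mulr_natr.
rewrite /nsq mulr_sumr -big_split /=; apply: ler_sum => l _.
by rewrite Hb; case: (Hf l).
Qed.

End Codes.

(** * Folding the line into an interval *)

Section Fold.
Variable R : realType.
Variable T : R.
Hypothesis T0 : 0 < T.

(* The zigzag map of slope 1 and -1 on alternate intervals [zT, (z+1)T]. *)
Definition zigzag (y : R) : R :=
  let z := Num.floor (y / T) in
  if (2 %| z)%Z then y - z%:~R * T else (z + 1)%:~R * T - y.

Lemma floor_bounds y : let z := Num.floor (y / T) in
  z%:~R * T <= y < (z + 1)%:~R * T.
Proof.
by have := floor_itv (y / T); rewrite ler_pdivlMr// ltr_pdivrMr.
Qed.

Lemma zigzag_box y : 0 <= zigzag y <= T.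
Proof.
have /= := floor_bounds y; rewrite /zigzag intrD; case: ifP => _ /andP[h1 h2]; lra.
Qed.

Lemma zigzag_iso y y' : Num.floor (y / T) = Num.floor (y' / T) ->
  `|zigzag y - zigzag y'| = `|y - y'|.
Proof.
rewrite /zigzag => ->; case: ifP => _; first by congr `|_|; ring.
by rewrite distrC; congr `|_|; ring.
Qed.

(** The map is an isometry on one interval, its branches on adjacent intervals meet at the common
    wall, and for intervals farther apart |y - y'| already exceeds the length [T] of the range. *)
Lemma zigzag_lip y y' : `|zigzag y - zigzag y'| <= `|y - y'|.
Proof.
wlog yy : y y' / y <= y'.
  by move=> H; case: (leP y y') => [/H//|/ltW /H]; rewrite distrC [in leRHS]distrC.
have zz : Num.floor (y / T) <= Num.floor (y' / T).
  by apply: le_floor; rewrite ler_pM2r ?invr_gt0.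
have [e|ne] := eqVneq (Num.floor (y / T)) (Num.floor (y' / T)).
  by rewrite zigzag_iso.
have {zz ne} zz : Num.floor (y / T) + 1 <= Num.floor (y' / T).
  by rewrite lezD1 lt_neqAle ne zz.
have [e|ne] := eqVneq (Num.floor (y / T) + 1) (Num.floor (y' / T)).
  have /= b1 := floor_bounds y; have /= b2 := floor_bounds y'.
  move: b1 b2; rewrite /zigzag -e; set z := Num.floor (y / T).
  have -> : (2 %| z + 1)%Z = ~~ (2 %| z)%Z by lia.
  rewrite !intrD /=.
  case: (2 %| z)%Z => /= /andP[h1 h2] /andP[h3 h4];
    rewrite (ler0_norm (_ : y - y' <= 0)) ?subr_le0// ler_norml; lra.
have zz2 : Num.floor (y / T) + 2 <= Num.floor (y' / T).
  by move: zz ne; lia.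
have /= /andP[h1 h2] := floor_bounds y; have /= /andP[h3 h4] := floor_bounds y'.
have : (Num.floor (y / T) + 2)%:~R * T <= (Num.floor (y' / T))%:~R * T.
  by rewrite ler_pM2r// ler_int.
rewrite (ler0_norm (_ : y - y' <= 0)) ?subr_le0//.
have := zigzag_box y; have := zigzag_box y'; rewrite ler_norml.
move: h2; rewrite !intrD; lra.
Qed.

End Fold.

(** In phase [m] the walls are the multiples of [u] whose index is congruent to [m] modulo [N].
    Points less than [u] apart have at most one multiple of [u] between them, so only the residue of
    its index is bad. *)
Lemma zigzag_phase (R : realType) (u : R) (N : nat) (y y' : R) :
  0 < u -> (0 < N)%N -> `|y - y'| < u ->
  exists m0 : nat, forall m : nat, (m < N)%N -> m != m0 ->
    `|zigzag (N%:R * u) (y - m%:R * u) - zigzag (N%:R * u) (y' - m%:R * u)| = `|y - y'|.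
Proof.
move=> u0 N0 yu.
wlog yy : y y' yu / y <= y'.
  move=> H; case: (leP y y') => [/(H _ _ yu)//|/ltW yy].
  rewrite distrC in yu; have [m0 Hm] := H _ _ yu yy.
  by exists m0 => m mN /(Hm _ mN); rewrite distrC => ->; rewrite distrC.
rewrite distrC ger0_norm ?subr_ge0// in yu.
set T := N%:R * u; have N0R : 0 < N%:R :> R by rewrite ltr0n.
have T0 : 0 < T by rewrite mulr_gt0.
pose F := Num.floor (y' / u).
exists `|(F %% N%:Z)%Z|%N => m mN mm.
have -> : `|y - y'| = `|(y - m%:R * u) - (y' - m%:R * u)| by congr `|_|; ring.
apply: zigzag_iso => //.
set z := Num.floor ((y' - m%:R * u) / T).
have /= /andP[h1 h2] := floor_bounds T0 (y' - m%:R * u); rewrite -/z in h1 h2.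
apply/eqP; rewrite eq_le; apply/andP; split.
  by apply: le_floor; rewrite ler_pM2r ?invr_gt0//; lra.
rewrite floor_ge_int ler_pdivlMr//.
rewrite leNgt; apply/negP => h3; move/eqP: mm; apply.
have e : F = m%:Z + z * N%:Z.
  apply: floor_def; rewrite ler_pdivlMr// ltr_pdivrMr//.
  rewrite !intrD !intrM /= -!pmulrn; move: h1 h2 h3; rewrite /T; lra.
by rewrite e addrC modzMDl modz_small// ltz_nat mN.
Qed.

(** * From point configurations to labellings *)

Section Disc.
Variable R : realType.
Variables (n k : nat) (d w : 'M[R]_n).
Hypothesis w0 : forall i j, 0 <= w i j.
Hypothesis d0 : forall i j, 0 <= d i j.

Definition pdist (x : 'I_n -> 'rV[R]_k) i j : R :=
  Num.sqrt (nsq (fun l => x i 0 l - x j 0 l)).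
Definition ecost (x : 'I_n -> 'rV[R]_k) : R :=
  \sum_i \sum_j w i j * (d i j - pdist x i j) ^+ 2.
Definition SS : R := \sum_i \sum_j w i j * d i j ^+ 2.

Lemma enorm_pdist x i j : enorm (x i - x j) = pdist x i j.
Proof. by rewrite /enorm /pdist /nsq; congr Num.sqrt; apply: eq_bigr => l _; rewrite !mxE. Qed.

(** If b <= 2a then |a - b| <= a; otherwise [c] is at least as far from [a] as [b] is. *)
Lemma shrink_le (a b c : R) : 0 <= a -> 0 <= b <= c ->
  (a - b) ^+ 2 <= (a - c) ^+ 2 + a ^+ 2.
Proof.
move=> a0 /andP[b0 bc]; have [H|H] := leP b (2 * a).
  have := sqr_ge0 (a - c); nra.
have := sqr_ge0 a; nra.
Qed.

Lemma shrink_far (a b c : R) : 0 <= a -> 0 <= b <= c -> 2 * a <= c ->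
  (a - b) ^+ 2 <= (a - c) ^+ 2.
Proof. by move=> a0 /andP[b0 bc] H; nra. Qed.

Section FoldCoord.
Variables (u : R) (N : nat).
Hypothesis u0 : 0 < u.
Hypothesis N0 : (0 < N)%N.
Hypothesis du : forall i j, i != j -> 2 * d i j <= u.

(** Average over the [N] phases. A pair at distance at least 2 [d] loses nothing, since folding only
    shrinks distances. The coordinates of a closer pair differ by less than [u], so all phases but
    one preserve its distance, and the bad one costs at most [d ^ 2]. Some phase is as good as the
    average. *)
Lemma fold_coord (x : 'I_n -> 'rV[R]_k) (l0 : 'I_k) :
  exists x' : 'I_n -> 'rV[R]_k,
  [/\ forall i l, l != l0 -> x' i 0 l = x i 0 l,
      forall i, 0 <= x' i 0 l0 <= N%:R * u &
      ecost x' <= ecost x + SS / N%:R].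
Proof.
have NR : 0 < N%:R :> R by rewrite ltr0n.
have T0 : 0 < N%:R * u by rewrite mulr_gt0.
pose xm (m : nat) (i : 'I_n) : 'rV[R]_k :=
  \row_l if l == l0 then zigzag (N%:R * u) (x i 0 l0 - m%:R * u) else x i 0 l.
have shr m i j : 0 <= pdist (xm m) i j <= pdist x i j.
  rewrite sqrtr_ge0 /= ler_sqrt ?nsq_ge0//; apply: ler_sum => l _; rewrite !mxE.
  case: eqP => [->|//].
  rewrite -(real_normK (num_real (zigzag _ _ - _))) -(real_normK (num_real (x i 0 l0 - _))).
  rewrite ler_sqr ?nnegrE//; apply: (le_trans (zigzag_lip T0 _ _)).
  by rewrite le_eqVlt; apply/orP; left; apply/eqP; congr `|_|; ring.
have iso m i j : `|zigzag (N%:R * u) (x i 0 l0 - m%:R * u) -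
    zigzag (N%:R * u) (x j 0 l0 - m%:R * u)| = `|x i 0 l0 - x j 0 l0| ->
    pdist (xm m) i j = pdist x i j.
  move=> H; congr Num.sqrt; apply: eq_bigr => l _; rewrite !mxE.
  case: eqP => [->|//].
  by rewrite -(real_normK (num_real (zigzag _ _ - _))) H real_normK ?num_real.
have pair i j : \sum_(m < N) (d i j - pdist (xm m) i j) ^+ 2 <=
    N%:R * (d i j - pdist x i j) ^+ 2 + d i j ^+ 2.
  have cst (c : R) : N%:R * c = \sum_(m < N) c.
    by rewrite sumr_const card_ord [LHS]mulr_natl.
  have d2 := sqr_ge0 (d i j).
  (* The diagonal entries of [d] are not controlled by [u], but both distances are 0 there. *)
  have [->|ij] := eqVneq i j.
    rewrite cst -[leLHS]addr0; apply: lerD; last exact: sqr_ge0.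
    by apply: ler_sum => m _; rewrite iso// !subrr.
  have [far|near] := leP (2 * d i j) (pdist x i j).
    rewrite cst -[leLHS]addr0; apply: lerD => //.
    by apply: ler_sum => m _; apply: shrink_far.
  have yu : `|x i 0 l0 - x j 0 l0| < u.
    apply: lt_le_trans (du ij); apply: le_lt_trans near.
    rewrite -sqrtr_sqr ler_sqrt ?nsq_ge0// /nsq (bigD1 l0)//= lerDl.
    by apply: sumr_ge0 => l _; exact: sqr_ge0.
  have [m0 Hm] := zigzag_phase u0 N0 yu.
  apply: (@le_trans _ _ (\sum_(m < N) ((d i j - pdist x i j) ^+ 2 +
      (if (m : nat) == m0 then d i j ^+ 2 else 0)))).
    apply: ler_sum => m _; case: eqP => [_|/eqP mm]; first exact: shrink_le.
    by rewrite addr0 iso// Hm.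
  rewrite big_split /= -cst lerD2l -big_mkcond /=.
  have [m0N|m0N] := ltnP m0 N; last first.
    rewrite big1// => m /eqP E; move: (ltn_ord m); rewrite E ltnNge m0N//.
  rewrite (big_pred1 (Ordinal m0N))// => m.
have sum_le : \sum_(m < N) ecost (xm m) <= N%:R * ecost x + SS.
  rewrite /ecost /SS exchange_big mulr_sumr -big_split /=.
  apply: ler_sum => i _; rewrite exchange_big mulr_sumr -big_split /=.
  apply: ler_sum => j _; rewrite -mulr_sumr mulrCA -mulrDr ler_wpM2l//.
have [m Hm] : exists m : 'I_N, ecost (xm m) <= ecost x + SS / N%:R.
  apply: contrapT => /forallNP H.
  have : \sum_(m < N) ecost (xm m) > \sum_(m < N) (ecost x + SS / N%:R).
    apply: ltr_sum => [|m _]; last by rewrite ltNge; apply/negP/H.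
    by apply/hasP; exists (Ordinal N0); rewrite ?mem_index_enum.
  rewrite sumr_const card_ord -[X in X < _]mulr_natl mulrDr [X in _ + X]mulrCA.
  rewrite divff ?gt_eqF// mulr1; lra.
exists (xm m); split=> //.
- by move=> i l /negbTE ll; rewrite !mxE ll.
- by move=> i; rewrite !mxE eqxx; exact: zigzag_box.
Qed.

Lemma fold_all (x : 'I_n -> 'rV[R]_k) : exists x' : 'I_n -> 'rV[R]_k,
  (forall i l, 0 <= x' i 0 l <= N%:R * u) /\
  ecost x' <= ecost x + k%:R * (SS / N%:R).
Proof.
suff H : forall m, (m <= k)%N -> exists x' : 'I_n -> 'rV[R]_k,
    (forall i (l : 'I_k), (l < m)%N -> 0 <= x' i 0 l <= N%:R * u) /\
    ecost x' <= ecost x + m%:R * (SS / N%:R).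
  by have [x' [h1 h2]] := H k (leqnn k); exists x'; split=> // i l; apply: h1.
elim=> [|m IH] mk; first by exists x; split=> //; rewrite mul0r addr0.
have [x1 [h1 h2]] := IH (ltnW mk).
have [x2 [a1 a2 a3]] := fold_coord x1 (Ordinal mk).
exists x2; split.
  move=> i l; rewrite ltnS leq_eqVlt => /orP[/eqP E|lm].
    by have -> : l = Ordinal mk by exact: val_inj.
  rewrite a1; first exact: h1.
  by rewrite -val_eqE /= ltn_eqF.
by apply: (le_trans a3); rewrite -natr1 mulrDl mul1r addrA lerD2r.
Qed.

End FoldCoord.

Variables (Q : nat) (h eps dmin dmax : R).
Hypothesis k0 : (0 < k)%N.
Hypothesis Q0 : (0 < Q)%N.
Hypothesis eps01 : 0 < eps < 1.
Hypothesis dmin0 : 0 < dmin.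
Hypothesis d_off : forall i j, i != j -> dmin <= d i j <= dmax.
Hypothesis dmm : dmin <= dmax.
Hypothesis hE : h * (32 * k%:R) = eps * dmin.
(** With at most 9k/eps phases, the side h (Q - 1) of the box must reach 2 dmax per phase. This
    gives 576 = 2 * 9 * 32, and one more unit pays for the [- 1]. *)
Hypothesis Qbig : 577 * k%:R ^+ 2 * dmax <= Q%:R * (dmin * eps ^+ 2).

(** Exact squared distances, but rounded down distances in the cross term: everything is computable
    without roots, and the error is on the safe side, see [ecost_emb]. *)
Definition hcost (y : 'I_n -> 'I_(Q ^ k)) : R :=
  \sum_i \sum_j w i j * (d i j ^+ 2 - 2 * d i j * h * rr R (y i) (y j)
                         + h ^+ 2 * D2 (pt R (Q := Q)) (y i) (y j)).
Definition emb (y : 'I_n -> 'I_(Q ^ k)) (i : 'I_n) : 'rV[R]_k :=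
  \row_l (h * pt R (y i) l).

Let kR : 1 <= k%:R :> R. Proof. by rewrite ler1n. Qed.
Let eps0 : 0 < eps. Proof. by case/andP: eps01. Qed.
Let eps1 : eps < 1. Proof. by case/andP: eps01. Qed.
Let h0 : 0 < h.
Proof.
have : 0 < h * (32 * k%:R) by rewrite hE mulr_gt0.
have k32 : 0 < 32 * k%:R :> R by have := kR; lra.
by rewrite (pmulr_lgt0 _ k32).
Qed.

Let SS0 : 0 <= SS.
Proof. by apply: sumr_ge0 => i _; apply: sumr_ge0 => j _; rewrite mulr_ge0 ?sqr_ge0. Qed.

Lemma pdist_emb y i j : pdist (emb y) i j = h * Num.sqrt (D2 (pt R (Q := Q)) (y i) (y j)).
Proof.
rewrite -[X in X * _](gtr0_norm h0) -sqrtr_sqr -sqrtrM ?sqr_ge0//; congr Num.sqrt.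
by rewrite /D2 /nsq mulr_sumr; apply: eq_bigr => l _; rewrite !mxE; ring.
Qed.

Lemma ecost_emb y : ecost (emb y) <= hcost y.
Proof.
apply: ler_sum => i _; apply: ler_sum => j _; rewrite ler_wpM2l// pdist_emb.
have /andP[r1 _] := rrP R Q0 (y i) (y j).
set D := D2 _ _ _ in r1 *.
have D0 : 0 <= D by exact: D2_ge0.
have -> : (d i j - h * Num.sqrt D) ^+ 2 =
   d i j ^+ 2 - 2 * (d i j * h) * Num.sqrt D + h ^+ 2 * Num.sqrt D ^+ 2 by ring.
rewrite sqr_sqrtr//.
have : (d i j * h) * rr R (y i) (y j) <= (d i j * h) * Num.sqrt D.
  by rewrite ler_wpM2l// mulr_ge0// ltW.
lra.
Qed.

(** Rounding coordinates down changes a distance by at most k h = eps dmin / 32, a fraction eps / 32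
    of any off-diagonal [d]; passing to integer parts adds at most 2 d h. *)
Lemma round_box (x : 'I_n -> 'rV[R]_k) :
  (forall i l, 0 <= x i 0 l <= h * Q.-1%:R) ->
  exists y, hcost y <= (1 + eps / 32) * ecost x + eps / 8 * SS.
Proof.
move=> xb; have kR1 := kR; have ep0 := eps0; have ep1 := eps1; have hp0 := h0.
have fQ i (l : 'I_k) : (Num.truncn (x i 0 l / h)%R < Q)%N.
  have /andP[b1 b2] := xb i l.
  rewrite truncn_lt_nat ?divr_ge0 ?(ltW h0)// ltr_pdivrMr//.
  apply: (le_lt_trans b2); rewrite mulrC ltr_pM2r// ltr_nat prednK//.
have [y Hy] := choice (fun i => pt_ex R Q0 (fQ i)).
exists y.
have yb i l : 0 <= x i 0 l - h * pt R (y i) l <= h.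
  rewrite Hy; have /andP[b1 b2] := xb i l.
  have := truncn_itv (divr_ge0 b1 (ltW h0)); rewrite ler_pdivlMr// ltr_pdivrMr//.
  rewrite -natr1; lra.
pose tau := k%:R * h.
have tau0 : 0 < tau by rewrite mulr_gt0//; lra.
have tauE : tau = eps * dmin / 32 by rewrite /tau -hE; field.
have dist i j : `|pdist x i j - pdist (emb y) i j| <= tau.
  have -> : pdist x i j = Num.sqrt (nsq (fun l => (x i 0 l - x j 0 l) - 0)).
    by congr Num.sqrt; apply: eq_bigr => l _; rewrite subr0.
  have -> : pdist (emb y) i j = Num.sqrt (nsq (fun l => (emb y i 0 l - emb y j 0 l) - 0)).
    by congr Num.sqrt; apply: eq_bigr => l _; rewrite subr0.
  apply: (le_trans (sqrt_nsq_lip _ _ _)).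
  rewrite -[leRHS]ger0_norm ?(ltW tau0)// -sqrtr_sqr ler_sqrt ?sqr_ge0//.
  apply: (@le_trans _ _ (\sum_(l < k) h ^+ 2)).
    apply: ler_sum => l _; rewrite !mxE; have := yb i l; have := yb j l; nra.
  rewrite sumr_const card_ord -[leLHS]mulr_natl /tau exprMn ler_wpM2r ?sqr_ge0//.
  by rewrite expr2 -[leLHS]mul1r ler_wpM2r//; lra.
rewrite /ecost /SS !mulr_sumr -big_split /=; apply: ler_sum => i _.
rewrite !mulr_sumr -big_split /=; apply: ler_sum => j _.
rewrite !(mulrCA _ (w i j)) -mulrDr ler_wpM2l//.
have [->|ij] := eqVneq i j.
  have D0 : D2 (pt R (Q := Q)) (y j) (y j) = 0 by exact: D2xx.
  have r0 : rr R (y j) (y j) = 0.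
    apply/eqP; rewrite -sqrf_eq0 eq_le sqr_ge0 andbT -[leRHS]D0; exact: rr_le.
  have p0 : pdist x j j = 0.
    by rewrite /pdist /nsq big1 ?sqrtr0// => l _; rewrite subrr expr0n.
  rewrite D0 r0 p0 !mulr0 subr0 addr0 subr0; have := sqr_ge0 (d j j).
  have := eps0; nra.
have /andP[dl _] := d_off ij.
have := dist i j; rewrite pdist_emb; set D := D2 _ _ _; set r := pdist x i j.
have D0 : 0 <= D by exact: D2_ge0.
have := rrP R Q0 (y i) (y j); rewrite -/D; set rho := Num.sqrt D => /andP[_ r2].
have -> : D = rho ^+ 2 by rewrite sqr_sqrtr.
set f := rr _ _ _ in r2 *; set a := d i j in dl *; rewrite ler_norml => /andP[q1 q2].
have a0 : 0 <= a by exact: d0.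
have e1 : a ^+ 2 - 2 * a * h * f + h ^+ 2 * rho ^+ 2 =
  (a - h * rho) ^+ 2 + 2 * a * (h * (rho - f)) by ring.
have hf : h * (rho - f) <= h by rewrite -[leRHS]mulr1 ler_pM2l//; lra.
have h32 : h <= eps * dmin / 32.
  by rewrite -tauE /tau -[leLHS]mul1r ler_pM2r.
have t2 : 2 * a * (h * (rho - f)) <= eps / 16 * a ^+ 2.
  have : a * (h * (rho - f)) <= a * (eps * a / 32).
    rewrite ler_wpM2l//; apply: (le_trans hf); apply: (le_trans h32).
    have : eps * dmin <= eps * a by rewrite ler_pM2l.
    by lra.
  lra.
have t1 : (a - h * rho) ^+ 2 <= (1 + eps / 32) * (a - r) ^+ 2 + eps / 16 * a ^+ 2.
  set c := r - h * rho in q1 q2 *.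
  have -> : a - h * rho = (a - r) + c by rewrite /c; ring.
  have c2 : c ^+ 2 <= tau ^+ 2 by nra.
  have td : tau ^+ 2 <= (eps / 32) ^+ 2 * a ^+ 2.
    rewrite tauE -exprMn ler_sqr ?nnegrE; last by rewrite mulr_ge0// divr_ge0// ltW.
      have : eps * dmin <= eps * a by rewrite ler_pM2l.
      by lra.
    by rewrite divr_ge0// mulr_ge0// ltW.
  have e32 : 0 < eps / 32 by rewrite divr_gt0.
  have := amgm2 c (a - r) e32.
  have : c ^+ 2 / (eps / 32) <= (eps / 32) * a ^+ 2.
    rewrite ler_pdivrMr//; apply: (le_trans c2); apply: (le_trans td).
    by rewrite le_eqVlt; apply/orP; left; apply/eqP; ring.
  have : (eps / 32) ^+ 2 * a ^+ 2 <= (eps / 32) * a ^+ 2.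
    by rewrite ler_wpM2r ?sqr_ge0// expr2 -[leRHS]mul1r ler_pM2r//; lra.
  nra.
by rewrite e1; lra.
Qed.

Lemma discretize (x : 'I_n -> 'rV[R]_k) : exists y, hcost y <= ecost x + eps / 2 * SS.
Proof.
(* All points at 0 cost exactly [SS], so a costlier configuration may be replaced by that one. This
   turns the multiplicative loss of [round_box] into a multiple of [eps * SS]. *)
wlog xS : x / ecost x <= SS.
  move=> H; have [/H//|xS] := leP (ecost x) SS.
  have e0 : ecost (fun=> 0) = SS.
    apply: eq_bigr => i _; apply: eq_bigr => j _; congr (_ * _ ^+ 2).
    rewrite /pdist /nsq big1 ?sqrtr0 ?subr0// => l _.
    by rewrite subrr expr0n.
  have [|y Hy] := H (fun=> 0); first by rewrite e0.
  by exists y; move: Hy; rewrite e0; lra.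
have kR1 := kR; have ep0 := eps0; have ep1 := eps1; have hp0 := h0.
(* Makes the total loss k SS / N of the folds at most eps / 8 times [SS]. *)
pose N := (Num.truncn (8 * k%:R / eps)).+1.
have N8 : 8 * k%:R / eps < N%:R by rewrite /N truncnS_gt.
have p8 : 0 < 8 * k%:R / eps by rewrite divr_gt0// mulr_gt0//; lra.
have N9 : N%:R <= 9 * k%:R / eps.
  rewrite /N -natr1; have := truncn_le (8 * k%:R / eps); rewrite (ltW p8) => h1.
  have : 1 <= k%:R / eps by rewrite ler_pdivlMr// mul1r; lra.
  lra.
have NR : 0 < N%:R :> R by rewrite ltr0n.
have Q1 : 1 <= Q%:R :> R by rewrite ler1n.
pose u := h * Q.-1%:R / N%:R.
have Tu : N%:R * u = h * Q.-1%:R by rewrite /u mulrC divfK// gt_eqF.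
have hpos : h = eps * dmin / (32 * k%:R) by rewrite -hE mulfK// mulf_neq0//; apply: lt0r_neq0; lra.
have dmx0 : 0 < dmax by exact: lt_le_trans dmin0 dmm.
have uu : 2 * dmax <= u.
  rewrite /u ler_pdivlMr// -subn1 natrB//.
  apply: (@le_trans _ _ (2 * dmax * (9 * k%:R / eps))).
    by rewrite ler_pM2l// mulr_gt0.
  have k32 : 0 < 32 * k%:R :> R by lra.
  rewrite hpos [leRHS]mulrAC (ler_pdivlMr _ _ k32).
  have -> : 2 * dmax * (9 * k%:R / eps) * (32 * k%:R) = 576 * k%:R ^+ 2 * dmax / eps.
    by field; rewrite gt_eqF.
  rewrite ler_pdivrMr//.
  have : dmin * eps ^+ 2 <= k%:R ^+ 2 * dmax.
    have e2 : eps ^+ 2 <= 1 by rewrite exprn_ile1// ltW.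
    have k2 : 1 <= k%:R ^+ 2 :> R by rewrite exprn_ege1.
    have : dmin * eps ^+ 2 <= dmin * 1 by rewrite ler_pM2l.
    have : 1 * dmax <= k%:R ^+ 2 * dmax by rewrite ler_pM2r.
    by have := dmm; lra.
  have := Qbig; lra.
have u0 : 0 < u by lra.
have du i j : i != j -> 2 * d i j <= u by move=> /d_off /andP[_ h1]; lra.
have [x' [x1 x2]] := fold_all u0 (ltn0Sn _ : (0 < N)%N) du x.
have x3 : ecost x' <= ecost x + eps / 8 * SS.
  apply: (le_trans x2); rewrite lerD2l mulrA ler_pdivrMr//.
  have : k%:R <= eps / 8 * N%:R.
    have : eps / 8 * (8 * k%:R / eps) <= eps / 8 * N%:R.
      by rewrite ler_pM2l ?divr_gt0// ltW.
    by have -> : eps / 8 * (8 * k%:R / eps) = k%:R by field; rewrite gt_eqF.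
  have := SS0; nra.
have [|y Hy] := @round_box x'; first by move=> i l; rewrite -Tu; exact: x1.
exists y; apply: (le_trans Hy).
have : eps / 32 * ecost x' <= eps / 32 * (2 * SS).
  rewrite ler_pM2l ?divr_gt0//.
  have : eps / 8 * SS <= 1 / 8 * SS by rewrite ler_wpM2r//; lra.
  have := SS0; lra.
have := SS0; have : 0 <= eps * SS by rewrite mulr_ge0// ltW.
lra.
Qed.

(** [discretize] spends one half of [eps], which leaves the other half to the search. *)
Lemma opt_from_hcost y (W0 : 0 < \sum_i \sum_j w i j) :
  (forall y', hcost y <= hcost y' + eps / 2 * SS) ->
  wemv d w (emb y) <= opt_wemv k d w + eps * wmean w (fun i j => d i j ^+ 2).
Proof.
move=> yopt.
have wE x : wemv d w x = ecost x / \sum_i \sum_j w i j.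
  rewrite /wemv /wmean /ecost; congr (_ / _); apply: eq_bigr => i _.
  by apply: eq_bigr => j _; rewrite enorm_pdist.
rewrite -lerBlDr; apply: lb_le_inf; first by exists (wemv d w (emb y)); exists (emb y).
move=> _ [x _ <-]; rewrite !wE lerBlDr /wmean -/SS mulrA -mulrDl ler_pM2r ?invr_gt0//.
have [y' Hy'] := discretize x.
apply: (le_trans (ecost_emb y)); apply: (le_trans (yopt y')).
have := SS0; lra.
Qed.

End Disc.

(** * Compiling expressions *)

(* Expressions that [cN] and [cR] compile to commands.  The two memories are cut
   into seven arrays, entry [i] of array [al < 7] being cell [8 * i + al], and
   registers, the cells [8 * l + 7].  [Nt l] reads register [l], [Nr al i] and
   [Rr al i] read arrays, [Nd] and [No] are quotient and remainder, [Rsum l b f]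
   sums [f] over the values [< b] of register [l], and [Rif a b f g] is [f] if
   [a <= b], otherwise [g]. *)
Inductive ne :=
  | Nc of nat | Nt of nat | Nr of nat & ne
  | Na of ne & ne | Ns of ne & ne | Nm of ne & ne | Nd of ne & ne | No of ne & ne.

Inductive re :=
  | Rc of nat | Rr of nat & ne
  | Ra of re & re | Rs of re & re | Rm of re & re | Rd of re & re
  | Rsum of nat & ne & re
  | Rif of re & re & re & re
  | Rifn of ne & ne & re & re.

Definition reg (l : nat) : nexp := NCst (8 * l + 7).
Definition nreg l := NGet (reg l).
Definition rreg l := RGet (reg l).
Definition cell (al : nat) (i : nexp) : nexp :=
  NAdd (NAdd (NAdd (NAdd i i) (NAdd i i)) (NAdd (NAdd i i) (NAdd i i))) (NCst al).
Definition NSuc (e : nexp) := NAdd e (NCst 1).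

(** The result goes to register [dl], and scratch space starts there. Products compile to repeated
    additions, quotients and remainders to repeated subtractions. *)
Fixpoint cN (dl : nat) (e : ne) : cmd :=
  match e with
  | Nc c => NSet (reg dl) (NCst c)
  | Nt l => NSet (reg dl) (nreg l)
  | Nr al i => Seq (cN dl i) (NSet (reg dl) (NGet (cell al (nreg dl))))
  | Na a b => Seq (cN dl a) (Seq (cN dl.+1 b)
                (NSet (reg dl) (NAdd (nreg dl) (nreg dl.+1))))
  | Ns a b => Seq (cN dl a) (Seq (cN dl.+1 b)
                (NSet (reg dl) (NSub (nreg dl) (nreg dl.+1))))
  | Nm a b => Seq (cN dl a) (Seq (cN dl.+1 b) (Seq (NSet (reg dl.+2) (NCst 0))
                (Seq (While (BNot (BNle (nreg dl) (NCst 0)))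
                   (Seq (NSet (reg dl.+2) (NAdd (nreg dl.+2) (nreg dl.+1)))
                        (NSet (reg dl) (NSub (nreg dl) (NCst 1)))))
                (NSet (reg dl) (nreg dl.+2)))))
  | Nd a b => Seq (cN dl a) (Seq (cN dl.+1 b) (Seq (NSet (reg dl.+2) (NCst 0))
                (Seq (While (BNle (nreg dl.+1) (nreg dl))
                   (Seq (NSet (reg dl.+2) (NSuc (nreg dl.+2)))
                        (NSet (reg dl) (NSub (nreg dl) (nreg dl.+1)))))
                (NSet (reg dl) (nreg dl.+2)))))
  | No a b => Seq (cN dl a) (Seq (cN dl.+1 b) (Seq (NSet (reg dl.+2) (NCst 0))
                (While (BNle (nreg dl.+1) (nreg dl))
                   (Seq (NSet (reg dl.+2) (NSuc (nreg dl.+2)))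
                        (NSet (reg dl) (NSub (nreg dl) (nreg dl.+1)))))))
  end.

Fixpoint cR (dl : nat) (e : re) : cmd :=
  match e with
  | Rc c => RSet (reg dl) (RCst c)
  | Rr al i => Seq (cN dl i) (RSet (reg dl) (RGet (cell al (nreg dl))))
  | Ra a b => Seq (cR dl a) (Seq (cR dl.+1 b)
                (RSet (reg dl) (RAdd (rreg dl) (rreg dl.+1))))
  | Rs a b => Seq (cR dl a) (Seq (cR dl.+1 b)
                (RSet (reg dl) (RSub (rreg dl) (rreg dl.+1))))
  | Rm a b => Seq (cR dl a) (Seq (cR dl.+1 b)
                (RSet (reg dl) (RMul (rreg dl) (rreg dl.+1))))
  | Rd a b => Seq (cR dl a) (Seq (cR dl.+1 b)
                (RSet (reg dl) (RDiv (rreg dl) (rreg dl.+1))))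
  | Rsum l b f => Seq (cN dl b) (Seq (RSet (reg dl) (RCst 0))
                (Seq (NSet (reg l) (NCst 0))
                (While (BNle (NSuc (nreg l)) (nreg dl))
                   (Seq (cR l.+1 f)
                   (Seq (RSet (reg dl) (RAdd (rreg dl) (rreg l.+1)))
                        (NSet (reg l) (NSuc (nreg l))))))))
  | Rif a b f g => Seq (cR dl a) (Seq (cR dl.+1 b)
                (If (BRle (rreg dl) (rreg dl.+1)) (cR dl f) (cR dl g)))
  | Rifn a b f g => Seq (cN dl a) (Seq (cN dl.+1 b)
                (If (BNle (nreg dl) (nreg dl.+1)) (cR dl f) (cR dl g)))
  end.

(* Scoping: the registers in [vs] are the loop variables in scope, all of them
   below the register [dl] from which scratch space starts. *)
Fixpoint wfN (vs : seq nat) (e : ne) : bool :=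
  match e with
  | Nc _ => true
  | Nt l => l \in vs
  | Nr al i => (al < 7)%N && wfN vs i
  | Na a b | Ns a b | Nm a b | Nd a b | No a b => wfN vs a && wfN vs b
  end.

Fixpoint wfR (dl : nat) (vs : seq nat) (e : re) : bool :=
  match e with
  | Rc _ => true
  | Rr al i => (al < 7)%N && wfN vs i
  | Ra a b | Rs a b | Rm a b | Rd a b => wfR dl vs a && wfR dl.+1 vs b
  | Rsum l b f => [&& (dl < l)%N, wfN vs b & wfR l.+1 (l :: vs) f]
  | Rif a b f g => [&& wfR dl vs a, wfR dl.+1 vs b, wfR dl vs f & wfR dl vs g]
  | Rifn a b f g => [&& wfN vs a, wfN vs b, wfR dl vs f & wfR dl vs g]
  end.

(* Evaluation takes time at most [X ^ hN e], resp. [X ^ hR e], when [X] bounds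
   all intermediate naturals; see [cN_ok] and [cR_ok]. *)
Fixpoint hN (e : ne) : nat :=
  match e with
  | Nc _ | Nt _ => 1
  | Nr _ i => (hN i).+1
  | Na a b | Ns a b | Nm a b | Nd a b | No a b => (maxn (hN a) (hN b) + 8)%N
  end.

Fixpoint hR (e : re) : nat :=
  match e with
  | Rc _ => 1
  | Rr _ i => (hN i).+1
  | Ra a b | Rs a b | Rm a b | Rd a b => (maxn (hR a) (hR b) + 2)%N
  | Rsum _ b f => (maxn (hN b) (hR f) + 8)%N
  | Rif a b f g => (maxn (maxn (hR a) (hR b)) (maxn (hR f) (hR g)) + 3)%N
  | Rifn a b f g => (maxn (maxn (hN a) (hN b)) (maxn (hR f) (hR g)) + 3)%N
  end.

Definition below (dl : nat) (vs : seq nat) : bool := all (fun l => l < dl)%N vs.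

(** * Abstract memories and their representation *)

Section Memory.
Variable R : realType.
Implicit Types (s : state R).

Record hst := Hst { hn : nat -> nat -> nat; hr : nat -> nat -> R }.

Definition setN (h : hst) al i v :=
  Hst (fun al' i' => if (al' == al) && (i' == i) then v else hn h al' i') (hr h).
Definition setR (h : hst) al i v :=
  Hst (hn h) (fun al' i' => if (al' == al) && (i' == i) then v else hr h al' i').

Fixpoint dN (h : hst) (eta : nat -> nat) (e : ne) : nat :=
  match e with
  | Nc c => c
  | Nt l => eta l
  | Nr al i => hn h al (dN h eta i)
  | Na a b => (dN h eta a + dN h eta b)%N
  | Ns a b => (dN h eta a - dN h eta b)%N
  | Nm a b => (dN h eta a * dN h eta b)%N
  | Nd a b => (dN h eta a %/ dN h eta b)%N
  | No a b => (dN h eta a %% dN h eta b)%N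
  end.

Fixpoint dR (h : hst) (eta : nat -> nat) (e : re) : R :=
  match e with
  | Rc c => c%:R
  | Rr al i => hr h al (dN h eta i)
  | Ra a b => dR h eta a + dR h eta b
  | Rs a b => dR h eta a - dR h eta b
  | Rm a b => dR h eta a * dR h eta b
  | Rd a b => dR h eta a / dR h eta b
  | Rsum l b f => \sum_(i < dN h eta b) dR h (upd eta l i) f
  | Rif a b f g => if dR h eta a <= dR h eta b then dR h eta f else dR h eta g
  | Rifn a b f g =>
      if (dN h eta a <= dN h eta b)%N then dR h eta f else dR h eta g
  end.

Definition keep dl s s' : Prop :=
  (forall a, (a %% 8 != 7) || (a %/ 8 < dl) -> nmem s' a = nmem s a)%N /\
  (forall a, (a %% 8 != 7) || (a %/ 8 < dl) -> rmem s' a = rmem s a)%N.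

Definition rep (vs : seq nat) (eta : nat -> nat) (h : hst) s : Prop :=
  [/\ forall al i, (al < 7)%N -> nmem s (8 * i + al)%N = hn h al i,
      forall al i, (al < 7)%N -> rmem s (8 * i + al)%N = hr h al i &
      forall l, l \in vs -> nmem s (8 * l + 7)%N = eta l].

Lemma keep_trans dl dl' s1 s2 s3 : (dl <= dl')%N ->
  keep dl s1 s2 -> keep dl' s2 s3 -> keep dl s1 s3.
Proof.
move=> le [n1 r1] [n2 r2]; split=> a H.
  rewrite n2 ?n1//; case/orP: H => [->//|H]; by rewrite (leq_trans H le) orbT.
rewrite r2 ?r1//; case/orP: H => [->//|H]; by rewrite (leq_trans H le) orbT.
Qed.

Lemma keep_nset dl l s v : (dl <= l)%N -> keep dl s (nset s (8 * l + 7) v).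
Proof.
move=> le; split=> a //= H; rewrite /upd.
case: eqP => // E; exfalso; move: H le; rewrite E; lia.
Qed.

Lemma keep_rset dl l s v : (dl <= l)%N -> keep dl s (rset s (8 * l + 7) v).
Proof.
move=> le; split=> a //= H; rewrite /upd.
case: eqP => // E; exfalso; move: H le; rewrite E; lia.
Qed.

Lemma rep_keep dl vs eta h s s' : below dl vs ->
  rep vs eta h s -> keep dl s s' -> rep vs eta h s'.
Proof.
move=> bl [hn1 hr1 hv] [n1 r1]; split=> [al i H|al i H|l H].
- by rewrite n1 ?hn1//; apply/orP; left; lia.
- by rewrite r1 ?hr1//; apply/orP; left; lia.
- rewrite n1 ?hv//; apply/orP; right; move/allP: bl => /(_ _ H); lia.
Qed.

Lemma keep_nreg dl s s' l : (l < dl)%N -> keep dl s s' ->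
  nmem s' (8 * l + 7)%N = nmem s (8 * l + 7)%N.
Proof. by move=> H [n1 _]; apply: n1; apply/orP; right; lia. Qed.

Lemma keep_rreg dl s s' l : (l < dl)%N -> keep dl s s' ->
  rmem s' (8 * l + 7)%N = rmem s (8 * l + 7)%N.
Proof. by move=> H [_ r1]; apply: r1; apply/orP; right; lia. Qed.

Lemma neval_cell s al i : neval s (cell al i) = (8 * neval s i + al)%N.
Proof. by rewrite /=; lia. Qed.

Lemma upd_same (T : Type) (f : nat -> T) a v : upd f a v a = v.
Proof. by rewrite /upd eqxx. Qed.

Lemma upd_diff (T : Type) (f : nat -> T) a b v : b != a -> upd f a v b = f b.
Proof. by rewrite /upd => /negbTE ->. Qed.

Lemma below_S dl vs : below dl vs -> below dl.+1 vs.
Proof. by apply: sub_all => l /= H; rewrite ltnS ltnW. Qed.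

Lemma below_cons dl l vs : (dl < l)%N -> below dl vs -> below l.+1 (l :: vs).
Proof.
move=> H bl; rewrite /below /= ltnSn /=; move: bl; apply: sub_all => x /=; lia.
Qed.


Lemma nreg_nset l l' s v : nmem (nset s (8 * l + 7) v) (8 * l' + 7)%N =
  if l' == l then v else nmem s (8 * l' + 7)%N.
Proof.
rewrite /= /upd; have -> : ((8 * l' + 7 == 8 * l + 7) = (l' == l))%N by lia.
by [].
Qed.

Lemma rreg_rset l l' s v : rmem (rset s (8 * l + 7) v) (8 * l' + 7)%N =
  if l' == l then v else rmem s (8 * l' + 7)%N.
Proof.
rewrite /= /upd; have -> : ((8 * l' + 7 == 8 * l + 7) = (l' == l))%N by lia.
by [].
Qed.

Lemma nreg_rset l l' s v : nmem (rset s l v) l' = nmem s l'. Proof. by []. Qed.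
Lemma rreg_nset l l' s v : rmem (nset s l v) l' = rmem s l'. Proof. by []. Qed.

Lemma neval_reg s l : neval s (reg l) = (8 * l + 7)%N. Proof. by []. Qed.
Lemma neval_nreg s l : neval s (nreg l) = nmem s (8 * l + 7)%N. Proof. by []. Qed.
Lemma reval_rreg s l : reval s (rreg l) = rmem s (8 * l + 7)%N. Proof. by []. Qed.

Lemma neval_add s a b : neval s (NAdd a b) = (neval s a + neval s b)%N.
Proof. by []. Qed.
Lemma neval_sub s a b : neval s (NSub a b) = (neval s a - neval s b)%N.
Proof. by []. Qed.
Lemma neval_cst s c : neval s (NCst c) = c. Proof. by []. Qed.
Lemma neval_suc s a : neval s (NSuc a) = (neval s a).+1. Proof. exact: addn1. Qed.
Definition nevE := (neval_add, neval_sub, neval_suc, neval_nreg, neval_reg, neval_cst).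

Lemma hN_gt0 e : (0 < hN e)%N. Proof. by case: e => //= *; lia. Qed.

Lemma hR_gt0 e : (0 < hR e)%N. Proof. by case: e => //= *; lia. Qed.

Lemma rep_cons dl vs eta h s l i : below dl vs -> (dl < l)%N -> rep vs eta h s ->
  nmem s (8 * l + 7)%N = i -> rep (l :: vs) (upd eta l i) h s.
Proof.
move=> bl dll [h1 h2 h3] vl; split=> // x; rewrite inE => /predU1P[->|xv].
  by rewrite upd_same.
rewrite upd_diff ?h3//; move/allP: bl => /(_ _ xv); lia.
Qed.

Lemma rep_nset vs eta (h : hst) s al i v : (al < 7)%N -> rep vs eta h s ->
  rep vs eta (setN h al i v) (nset s (8 * i + al) v).
Proof.
move=> al7 [h1 h2 h3]; split=> [al' i' H|//|l H] /=; rewrite /upd.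
  have -> : ((8 * i' + al' == 8 * i + al) = (al' == al) && (i' == i))%N by lia.
  by rewrite h1.
have -> : ((8 * l + 7 == 8 * i + al) = false)%N by lia.
by rewrite h3.
Qed.

Lemma rep_rset vs eta (h : hst) s al i v : (al < 7)%N -> rep vs eta h s ->
  rep vs eta (setR h al i v) (rset s (8 * i + al) v).
Proof.
move=> al7 [h1 h2 h3]; split=> [//|al' i' H|l H] /=; rewrite ?h3// /upd.
have -> : ((8 * i' + al' == 8 * i + al) = (al' == al) && (i' == i))%N by lia.
by rewrite h2.
Qed.

Lemma nreg_nset_cell l s al i v : (al < 7)%N ->
  nmem (nset s (8 * i + al) v) (8 * l + 7)%N = nmem s (8 * l + 7)%N.
Proof.
by move=> al7 /=; rewrite /upd; have -> : ((8 * l + 7 == 8 * i + al) = false)%N by lia.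
Qed.

End Memory.

Ltac eqlia := repeat match goal with
  |- context [(?a == ?b :> nat)] =>
    first [ rewrite (_ : (a == b) = false); last (by lia)
          | rewrite (_ : (a == b) = true); last (by lia) ] end.
Ltac regs := rewrite ?(nreg_nset, rreg_rset, nreg_rset, rreg_nset); eqlia.

(** * Correctness and cost of compiled expressions *)

Section Compile.
Variable R : realType.
Local Notation hst := (hst R).
Variable X : nat.
Hypothesis X_ge : (100 <= X)%N.
Implicit Types (s : state R).

(** Bounds the rounds of the loops to which products, quotients and remainders compile. A zero
    divisor would make the subtraction loop run forever. *)
Fixpoint okN (h : hst) (eta : nat -> nat) (e : ne) : Prop :=
  match e with
  | Nc _ | Nt _ => True
  | Nr _ i => okN h eta i
  | Na a b | Ns a b => okN h eta a /\ okN h eta b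
  | Nm a b => [/\ okN h eta a, okN h eta b & (dN h eta a <= X)%N]
  | Nd a b | No a b =>
      [/\ okN h eta a, okN h eta b, (dN h eta a <= X)%N & (0 < dN h eta b)%N]
  end.

Fixpoint okR (h : hst) (eta : nat -> nat) (e : re) : Prop :=
  match e with
  | Rc _ => True
  | Rr _ i => okN h eta i
  | Ra a b | Rs a b | Rm a b | Rd a b => okR h eta a /\ okR h eta b
  | Rsum l b f => [/\ okN h eta b, (dN h eta b <= X)%N &
      forall i, (i < dN h eta b)%N -> okR h (upd eta l i) f]
  | Rif a b f g => [/\ okR h eta a, okR h eta b, okR h eta f & okR h eta g]
  | Rifn a b f g => [/\ okN h eta a, okN h eta b, okR h eta f & okR h eta g]
  end.

(** The tosses are returned intact because the program flips no coin. Time is measured by an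
    exponent of [X]: sequencing raises it by one, a loop of at most [X] rounds by two, and constants
    are absorbed since [X >= 100]. *)
Definition runs (c : cmd) s (e : nat) (P : state R -> Prop) : Prop :=
  forall r, exists s' t, [/\ exec c s r s' r t, (t <= X ^ e)%N & P s'].

Lemma X_gt0 : (0 < X)%N. Proof. exact: leq_trans X_ge. Qed.

Lemma runs_mono c s e e' (P P' : state R -> Prop) :
  (e <= e')%N -> (forall s', P s' -> P' s') -> runs c s e P -> runs c s e' P'.
Proof.
move=> le_e PP' H r; have [s' [t [E T Ps]]] := H r.
exists s', t; split=> //; last exact: PP'.
by rewrite (leq_trans T)// leq_pexp2l ?X_gt0.
Qed.

Lemma runs_seq c1 c2 s e e1 e2 (P : state R -> Prop) :
  (e1 < e)%N -> (e2 < e)%N ->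
  runs c1 s e1 (fun s1 => runs c2 s1 e2 P) -> runs (Seq c1 c2) s e P.
Proof.
case: e => // e; rewrite !ltnS => le1 le2 H r.
have [s1 [t1 [E1 T1 H1]]] := H r; have [s2 [t2 [E2 T2 Ps]]] := H1 r.
exists s2, (t1 + t2)%N; split=> //; first exact: exec_seq E1 E2.
have {}T1 : (t1 <= X ^ e)%N by rewrite (leq_trans T1)// leq_pexp2l ?X_gt0.
have {}T2 : (t2 <= X ^ e)%N by rewrite (leq_trans T2)// leq_pexp2l ?X_gt0.
rewrite expnS (leq_trans (leq_add T1 T2))// addnn -mul2n leq_mul2r.
by rewrite (leq_trans _ X_ge) ?orbT.
Qed.

Lemma runs_nset a e s h (P : state R -> Prop) :
  (0 < h)%N -> (ncost a + ncost e < 100)%N ->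
  P (nset s (neval s a) (neval s e)) -> runs (NSet a e) s h P.
Proof.
move=> h0 c H r; exists (nset s (neval s a) (neval s e)), (ncost a + ncost e).+1%N.
split=> //; first exact: exec_nset.
rewrite (leq_trans c)// (leq_trans X_ge)// -{1}(expn1 X) leq_pexp2l ?X_gt0//.
Qed.

Lemma runs_rset a e s h (P : state R -> Prop) :
  (0 < h)%N -> (ncost a + rcost e < 100)%N ->
  P (rset s (neval s a) (reval s e)) -> runs (RSet a e) s h P.
Proof.
move=> h0 c H r; exists (rset s (neval s a) (reval s e)), (ncost a + rcost e).+1%N.
split=> //; first exact: exec_rset.
rewrite (leq_trans c)// (leq_trans X_ge)// -{1}(expn1 X) leq_pexp2l ?X_gt0//.
Qed.

Lemma runs_skip s h (P : state R -> Prop) : P s -> runs Skip s h P.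
Proof.
by move=> H r; exists s, 1%N; split=> //; [exact: exec_skip|rewrite expn_gt0 X_gt0].
Qed.

Lemma runs_if b c1 c2 s e h (P : state R -> Prop) :
  (0 < e)%N -> (e < h)%N -> (bcost b < 99)%N ->
  runs (if beval s b then c1 else c2) s e P -> runs (If b c1 c2) s h P.
Proof.
move=> e0 eh cb H r; have [s' [t [E T Ps]]] := H r.
exists s', (bcost b + t).+1%N; split=> //; first exact: exec_if.
have h1 : (100 <= X ^ e)%N.
  by rewrite (leq_trans X_ge)// -{1}(expn1 X) leq_pexp2l ?X_gt0.
have : (X ^ e.+1 <= X ^ h)%N by rewrite leq_pexp2l ?X_gt0.
apply: leq_trans; rewrite expnS.
have : (2 * X ^ e <= X * X ^ e)%N by rewrite leq_mul2r (leq_trans _ X_ge) ?orbT.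
apply: leq_trans; move: h1 T cb; lia.
Qed.

(** [I m] is the invariant with [m] rounds still to go, so [m] also serves as the variant. *)
Lemma runs_while b c s e h m (I : nat -> state R -> Prop) (P : state R -> Prop) :
  (0 < e)%N -> (e.+1 < h)%N -> (bcost b < 99)%N -> (m <= X)%N -> I m s ->
  (forall m' s', I m'.+1 s' -> beval s' b /\ runs c s' e (I m')) ->
  (forall s', I 0%N s' -> ~~ beval s' b /\ P s') ->
  runs (While b c) s h P.
Proof.
move=> e0 eh cb mX Is step fin.
have h1 : (100 <= X ^ e)%N.
  by rewrite (leq_trans X_ge)// -{1}(expn1 X) leq_pexp2l ?X_gt0.
suff H : forall m s, I m s -> forall r, exists s' t,
    [/\ exec (While b c) s r s' r t, (t <= (2 * m + 1) * X ^ e)%N & P s'].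
  move=> r; have [s' [t [E T Ps]]] := H _ _ Is r.
  exists s', t; split=> //.
  have : (X ^ e.+2 <= X ^ h)%N by rewrite leq_pexp2l ?X_gt0.
  apply: leq_trans; rewrite (leq_trans T)// !expnS mulnA leq_mul2r.
  by apply/orP; right; move: mX X_ge; nia.
elim=> [|m' IH] s1 I1 r.
  have [nb Ps] := fin _ I1; exists s1, (bcost b).+1; split=> //.
    exact: exec_while_end.
  by move: cb h1; lia.
have [bs run1] := step _ _ I1.
have [s2 [t2 [E2 T2 I2]]] := run1 r.
have [s3 [t3 [E3 T3 Ps]]] := IH _ I2 r.
exists s3, (bcost b + t2 + t3).+1%N; split=> //.
  exact: exec_while_loop bs E2 E3.
by move: cb h1 T2 T3; lia.
Qed.

Section BinN.
Variables (a b : ne) (dl : nat) (vs : seq nat) (eta : nat -> nat) (h : hst).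
Hypotheses (bl : below dl vs) (wa : wfN vs a) (wb : wfN vs b).
Hypotheses (oa : okN h eta a) (ob : okN h eta b).

(** The real memory is left alone altogether: [pIn] evaluates its loop bound while the input still
    occupies cells that later serve as real registers. *)
Definition cN_spec e := forall dl vs eta h s, below dl vs -> wfN vs e ->
  okN h eta e -> rep vs eta h s ->
  runs (cN dl e) s (hN e) (fun s' => [/\ keep dl s s', rmem s' = rmem s &
    nmem s' (8 * dl + 7)%N = dN h eta e]).

Lemma cN_bin c s g P : cN_spec a -> cN_spec b -> rep vs eta h s ->
  (maxn (hN a) (hN b) + 2 <= g)%N ->
  (forall s', keep dl s s' -> rmem s' = rmem s ->
     nmem s' (8 * dl + 7)%N = dN h eta a ->
     nmem s' (8 * dl.+1 + 7)%N = dN h eta b -> runs c s' (g - 2) P) ->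
  runs (Seq (cN dl a) (Seq (cN dl.+1 b) c)) s g P.
Proof.
move=> Sa Sb rp hg Hc.
apply: (@runs_seq _ _ _ _ (hN a) (g - 1)); [by move: hg; lia..|].
apply: runs_mono (Sa _ _ _ _ _ bl wa oa rp) => // s1 [k1 r1 v1].
apply: (@runs_seq _ _ _ _ (hN b) (g - 2)); [by move: hg; lia..|].
have rp1 := rep_keep bl rp k1.
apply: runs_mono (Sb _ _ _ _ _ (below_S bl) wb ob rp1) => // s2 [k2 r2 v2].
apply: Hc => //; first exact: (keep_trans (leqnSn dl) k1 k2).
- by rewrite r2.
- by rewrite (keep_nreg (ltnSn dl) k2).
Qed.
End BinN.

Lemma div_step v b m r : (0 < b)%N -> r = (m.+1 * b + v %% b)%N ->
  (m.+1 <= v %/ b)%N -> [/\ (b <= r)%N & (r - b = m * b + v %% b)%N].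
Proof. by move=> b0 -> _; rewrite mulSn; split; [rewrite -addnA leq_addr|lia]. Qed.

Lemma cN_ok e : cN_spec e.
Proof.
elim: e => [c|l|al i IH|a IHa b IHb|a IHa b IHb|a IHa b IHb|a IHa b IHb|a IHa b IHb]
  dl vs eta h s bl /=.
- move=> _ _ rp; apply: runs_nset => //; split=> //.
    exact: keep_nset.
  by rewrite neval_reg; regs.
- move=> lv _ rp; apply: runs_nset => //; split=> //.
    exact: keep_nset.
  by rewrite neval_reg; regs; case: rp => _ _; apply.
- move=> /andP[al7 wi] oi rp.
  apply: (@runs_seq _ _ _ _ (hN i) (hN i)) => //.
  apply: runs_mono (IH _ _ _ _ _ bl wi oi rp) => // s1 [k1 r1 v1].
  apply: runs_nset; [exact: hN_gt0|by []|].
  rewrite neval_reg; split=> //.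
    exact: keep_trans (leqnn _) k1 (keep_nset _ _ (leqnn _)).
  have [hn1 _ _] := rep_keep bl rp k1.
  by regs; rewrite [neval _ _]/= -hn1// -v1; congr (nmem s1 _); lia.
- move=> /andP[wa wb] [oa ob] rp.
  apply: (cN_bin (vs := vs) (eta := eta) (h := h)) => //; first by lia.
  move=> s1 k1 r1 va vb; apply: runs_nset => //; first by lia.
  rewrite neval_reg; split=> //.
    exact: keep_trans (leqnn _) k1 (keep_nset _ _ (leqnn _)).
  by regs; rewrite /= va vb.
- move=> /andP[wa wb] [oa ob] rp.
  apply: (cN_bin (vs := vs) (eta := eta) (h := h)) => //; first by lia.
  move=> s1 k1 r1 va vb; apply: runs_nset => //; first by lia.
  rewrite neval_reg; split=> //.
    exact: keep_trans (leqnn _) k1 (keep_nset _ _ (leqnn _)).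
  by regs; rewrite /= va vb.
- move=> /andP[wa wb] [oa ob aX] rp.
  apply: (cN_bin (vs := vs) (eta := eta) (h := h)) => //; first by lia.
  move=> s1 k1 r1 va vb.
  apply: (@runs_seq _ _ _ _ 1 5); [by lia..|].
  apply: runs_nset => //; rewrite neval_reg.
  apply: (@runs_seq _ _ _ _ 4 1); [by lia..|].
  pose I m (s' : state R) := [/\ keep dl s s', rmem s' = rmem s,
     nmem s' (8 * dl + 7)%N = m /\ (m <= dN h eta a)%N,
     nmem s' (8 * dl.+1 + 7)%N = dN h eta b &
     nmem s' (8 * dl.+2 + 7)%N = ((dN h eta a - m) * dN h eta b)%N].
  apply: (@runs_while _ _ _ 2 4 (dN h eta a) I) => //.
  + split=> //.
    * exact: keep_trans (leqnn _) k1 (keep_nset _ _ (leqW (leqnSn _))).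
    * by regs.
    * by regs.
    * by regs; rewrite /= subnn.
  + move=> m s2 [k2 r2 [vm lm] v1 v2]; split; first by rewrite /= vm.
    apply: (@runs_seq _ _ _ _ 1 1) => //.
    apply: runs_nset => //; apply: runs_nset => //; rewrite !neval_reg; split=> //.
    * apply: keep_trans (leqnn _) _ (keep_nset _ _ (leqnn _)).
      exact: keep_trans (leqnn _) k2 (keep_nset _ _ (leqW (leqnSn _))).
    * by split; [regs; rewrite !nevE; regs; rewrite vm subn1|lia].
    * by regs.
    * by regs; rewrite /= v1 v2; nia.
  + move=> s2 [k2 r2 [vm lm] v1 v2]; split; first by rewrite /= vm.
    apply: runs_nset => //; rewrite neval_reg; split=> //.
    * exact: keep_trans (leqnn _) k2 (keep_nset _ _ (leqnn _)).
    * by regs; rewrite neval_nreg v2 subn0.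
- move=> /andP[wa wb] [oa ob aX b0] rp.
  apply: (cN_bin (vs := vs) (eta := eta) (h := h)) => //; first by lia.
  move=> s1 k1 r1 va vb.
  apply: (@runs_seq _ _ _ _ 1 5); [by lia..|].
  apply: runs_nset => //; rewrite neval_reg.
  apply: (@runs_seq _ _ _ _ 4 1); [by lia..|].
  set A := dN h eta a in va aX *; set B := dN h eta b in vb b0 *.
  (* With [m] rounds to go, register [dl] holds m B plus the remainder: the loop stops on the
     remainder, the quotient having been counted in register [dl + 2]. *)
  pose I m (s' : state R) := [/\ keep dl s s', rmem s' = rmem s,
     nmem s' (8 * dl + 7)%N = (m * B + A %% B)%N /\ (m <= A %/ B)%N,
     nmem s' (8 * dl.+1 + 7)%N = B &
     nmem s' (8 * dl.+2 + 7)%N = (A %/ B - m)%N].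
  apply: (@runs_while _ _ _ 2 4 (A %/ B)%N I) => //.
  + by rewrite (leq_trans (leq_div _ _)).
  + split=> //.
    * exact: keep_trans (leqnn _) k1 (keep_nset _ _ (leqW (leqnSn _))).
    * by regs; rewrite -divn_eq.
    * by regs.
    * by regs; rewrite /= subnn.
  + move=> m s2 [k2 r2 [vm lm] v1 v2].
    have [lb rb] := div_step b0 vm lm.
    split; first by rewrite /= v1.
    apply: (@runs_seq _ _ _ _ 1 1) => //.
    apply: runs_nset => //; apply: runs_nset => //; rewrite !neval_reg; split=> //.
    * apply: keep_trans (leqnn _) _ (keep_nset _ _ (leqnn _)).
      exact: keep_trans (leqnn _) k2 (keep_nset _ _ (leqW (leqnSn _))).
    * by split; [regs; rewrite !nevE; regs; rewrite v1 rb|lia].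
    * by regs.
    * by regs; rewrite /= v2; lia.
  + move=> s2 [k2 r2 [vm lm] v1 v2]; split.
      by rewrite /= v1 vm mul0n add0n -ltnNge ltn_mod.
    apply: runs_nset => //; rewrite neval_reg; split=> //.
    * exact: keep_trans (leqnn _) k2 (keep_nset _ _ (leqnn _)).
    * by regs; rewrite neval_nreg v2 subn0.
- move=> /andP[wa wb] [oa ob aX b0] rp.
  apply: (cN_bin (vs := vs) (eta := eta) (h := h)) => //; first by lia.
  move=> s1 k1 r1 va vb.
  apply: (@runs_seq _ _ _ _ 1 5); [by lia..|].
  apply: runs_nset => //; rewrite neval_reg.
  set A := dN h eta a in va aX *; set B := dN h eta b in vb b0 *.
  pose I m (s' : state R) := [/\ keep dl s s', rmem s' = rmem s,
     nmem s' (8 * dl + 7)%N = (m * B + A %% B)%N /\ (m <= A %/ B)%N &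
     nmem s' (8 * dl.+1 + 7)%N = B].
  apply: (@runs_while _ _ _ 2 5 (A %/ B)%N I) => //.
  + by rewrite (leq_trans (leq_div _ _)).
  + split=> //.
    * exact: keep_trans (leqnn _) k1 (keep_nset _ _ (leqW (leqnSn _))).
    * by regs; rewrite -divn_eq.
    * by regs.
  + move=> m s2 [k2 r2 [vm lm] v1].
    have [lb rb] := div_step b0 vm lm.
    split; first by rewrite /= v1.
    apply: (@runs_seq _ _ _ _ 1 1) => //.
    apply: runs_nset => //; apply: runs_nset => //; rewrite !neval_reg; split=> //.
    * apply: keep_trans (leqnn _) _ (keep_nset _ _ (leqnn _)).
      exact: keep_trans (leqnn _) k2 (keep_nset _ _ (leqW (leqnSn _))).
    * by split; [regs; rewrite !nevE; regs; rewrite v1 rb|lia].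
    * by regs.
  + move=> s2 [k2 r2 [vm lm] v1]; split.
      by rewrite /= v1 vm mul0n add0n -ltnNge ltn_mod.
    by split=> //; rewrite vm.
Qed.

Definition cR_spec e := forall dl vs eta h s, below dl vs -> wfR dl vs e ->
  okR h eta e -> rep vs eta h s ->
  runs (cR dl e) s (hR e) (fun s' => keep dl s s' /\
    rmem s' (8 * dl + 7)%N = dR h eta e).

Lemma cR_bin a b dl vs eta h c s g P : cR_spec a -> cR_spec b -> below dl vs ->
  wfR dl vs a -> wfR dl.+1 vs b -> okR h eta a -> okR h eta b -> rep vs eta h s ->
  (maxn (hR a) (hR b) + 2 <= g)%N ->
  (forall s', keep dl s s' ->
     rmem s' (8 * dl + 7)%N = dR h eta a ->
     rmem s' (8 * dl.+1 + 7)%N = dR h eta b -> runs c s' (g - 2) P) ->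
  runs (Seq (cR dl a) (Seq (cR dl.+1 b) c)) s g P.
Proof.
move=> Sa Sb bl wa wb oa ob rp hg Hc.
apply: (@runs_seq _ _ _ _ (hR a) (g - 1)); [by move: hg; lia..|].
apply: runs_mono (Sa _ _ _ _ _ bl wa oa rp) => // s1 [k1 v1].
apply: (@runs_seq _ _ _ _ (hR b) (g - 2)); [by move: hg; lia..|].
have rp1 := rep_keep bl rp k1.
apply: runs_mono (Sb _ _ _ _ _ (below_S bl) wb ob rp1) => // s2 [k2 v2].
apply: Hc => //; first exact: (keep_trans (leqnSn dl) k1 k2).
by rewrite (keep_rreg (ltnSn dl) k2).
Qed.

Lemma cR_ok e : cR_spec e.
Proof.
elim: e => [c|al i|a IHa b IHb|a IHa b IHb|a IHa b IHb|a IHa b IHb|l b f IH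
           |a IHa b IHb f IHf g IHg|a b f IHf g IHg] dl vs eta h s bl /=.
- move=> _ _ rp; apply: runs_rset => //; split; first exact: keep_rset.
  by rewrite neval_reg; regs.
- move=> /andP[al7 wi] oi rp.
  apply: (@runs_seq _ _ _ _ (hN i) (hN i)) => //.
  apply: runs_mono (cN_ok bl wi oi rp) => // s1 [k1 r1 v1].
  apply: runs_rset; [exact: hN_gt0|by []|].
  rewrite neval_reg; split.
    exact: keep_trans (leqnn _) k1 (keep_rset _ _ (leqnn _)).
  have [_ hr1 _] := rep_keep bl rp k1.
  by regs; rewrite [reval _ _]/= -hr1// -v1; congr (rmem s1 _); lia.
- move=> /andP[wa wb] [oa ob] rp.
  apply: (cR_bin (vs := vs) (eta := eta) (h := h)) => // s1 k1 va vb.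
  apply: runs_rset => //.
    by have := hR_gt0 a; lia.
  rewrite neval_reg; split.
    exact: keep_trans (leqnn _) k1 (keep_rset _ _ (leqnn _)).
  by regs; rewrite /= va vb.
- move=> /andP[wa wb] [oa ob] rp.
  apply: (cR_bin (vs := vs) (eta := eta) (h := h)) => // s1 k1 va vb.
  apply: runs_rset => //.
    by have := hR_gt0 a; lia.
  rewrite neval_reg; split.
    exact: keep_trans (leqnn _) k1 (keep_rset _ _ (leqnn _)).
  by regs; rewrite /= va vb.
- move=> /andP[wa wb] [oa ob] rp.
  apply: (cR_bin (vs := vs) (eta := eta) (h := h)) => // s1 k1 va vb.
  apply: runs_rset => //.
    by have := hR_gt0 a; lia.
  rewrite neval_reg; split.
    exact: keep_trans (leqnn _) k1 (keep_rset _ _ (leqnn _)).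
  by regs; rewrite /= va vb.
- move=> /andP[wa wb] [oa ob] rp.
  apply: (cR_bin (vs := vs) (eta := eta) (h := h)) => // s1 k1 va vb.
  apply: runs_rset => //.
    by have := hR_gt0 a; lia.
  rewrite neval_reg; split.
    exact: keep_trans (leqnn _) k1 (keep_rset _ _ (leqnn _)).
  by regs; rewrite /= va vb.
- move=> /and3P[dll wb wf] [ob BX of_] rp.
  set B := dN h eta b in BX of_ *.
  set g := (maxn (hN b) (hR f)).
  apply: (@runs_seq _ _ _ _ (hN b) (g + 7)); [by rewrite /g; lia..|].
  apply: runs_mono (cN_ok bl wb ob rp) => // s1 [k1 r1 v1].
  apply: (@runs_seq _ _ _ _ 1 (g + 6)); [by lia..|].
  apply: runs_rset => //; rewrite neval_reg.
  apply: (@runs_seq _ _ _ _ 1 (g + 5)); [by lia..|].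
  apply: runs_nset => //; rewrite neval_reg.
  pose I m (s' : state R) := [/\ keep dl s s',
     nmem s' (8 * dl + 7)%N = B,
     nmem s' (8 * l + 7)%N = (B - m)%N, (m <= B)%N &
     rmem s' (8 * dl + 7)%N = \sum_(i < B - m) dR h (upd eta l i) f].
  apply: (@runs_while _ _ _ (g + 3) (g + 5) B I) => //; [by lia..| | |].
  + split=> //.
    * apply: keep_trans (leqnn _) _ (keep_nset _ _ (ltnW dll)).
      exact: keep_trans (leqnn _) k1 (keep_rset _ _ (leqnn _)).
    * by regs.
    * by regs; rewrite subnn.
    * by regs; rewrite subnn big_ord0.
  + move=> m s2 [k2 vB vl lm vr].
    split; first by rewrite /= vB vl; lia.
    have rp2 := rep_keep bl rp k2.
    have rp3 := rep_cons bl dll rp2 vl.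
    apply: (@runs_seq _ _ _ _ (hR f) (g + 2)); [by rewrite /g; lia..|].
    have iB : (B - m.+1 < B)%N by lia.
    apply: runs_mono (IH _ _ _ _ _ (below_cons dll bl) wf (of_ _ iB) rp3) => //.
    move=> s3 [k3 v3].
    apply: (@runs_seq _ _ _ _ 1 1); [by lia..|].
    apply: runs_rset => //; apply: runs_nset => //; rewrite !neval_reg; split=> //.
    * apply: keep_trans (leqnn _) _ (keep_nset _ _ (ltnW dll)).
      apply: keep_trans (leqnn _) _ (keep_rset _ _ (leqnn _)).
      exact: (keep_trans (leqW (ltnW dll)) k2 k3).
    * by regs; rewrite (keep_nreg (leqW dll) k3).
    * by regs; rewrite !nevE; regs; rewrite (keep_nreg (ltnSn l) k3) vl; lia.
    * by lia.
    * regs; rewrite [reval _ _]/= v3 (keep_rreg (leqW dll) k3) vr.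
      have -> : (B - m = (B - m.+1).+1)%N by lia.
      by rewrite big_ord_recr.
  + move=> s2 [k2 vB vl lm vr]; split; last by rewrite subn0 in vr.
    by rewrite /= vB vl; lia.
- move=> /and4P[wa wb wf wg] [oa ob of_ og] rp.
  apply: (cR_bin (vs := vs) (eta := eta) (h := h)) => //; first by lia.
  move=> s1 k1 va vb; have rp1 := rep_keep bl rp k1.
  apply: (@runs_if _ _ _ _ (maxn (hR f) (hR g))) => //.
    by have := hR_gt0 f; lia.
    by lia.
  rewrite [beval _ _]/= va vb.
  case: ifP => _.
    apply: runs_mono (IHf _ _ _ _ _ bl wf of_ rp1); first by lia.
    by move=> s2 [k2 v2]; split=> //; exact: keep_trans (leqnn _) k1 k2.
  apply: runs_mono (IHg _ _ _ _ _ bl wg og rp1); first by lia.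
  by move=> s2 [k2 v2]; split=> //; exact: keep_trans (leqnn _) k1 k2.
- move=> /and4P[wa wb wf wg] [oa ob of_ og] rp.
  apply: (cN_bin (vs := vs) (eta := eta) (h := h)) => //;
    [exact: cN_ok|exact: cN_ok|by lia|].
  move=> s1 k1 r1 va vb; have rp1 := rep_keep bl rp k1.
  apply: (@runs_if _ _ _ _ (maxn (hR f) (hR g))) => //.
    by have := hR_gt0 f; lia.
    by lia.
  rewrite [beval _ _]/= va vb.
  case: ifP => _.
    apply: runs_mono (IHf _ _ _ _ _ bl wf of_ rp1); first by lia.
    by move=> s2 [k2 v2]; split=> //; exact: keep_trans (leqnn _) k1 k2.
  apply: runs_mono (IHg _ _ _ _ _ bl wg og rp1); first by lia.
  by move=> s2 [k2 v2]; split=> //; exact: keep_trans (leqnn _) k1 k2.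
Qed.

(* Triples for commands: [wp dl vs eta g c P h] says that from memory [h], with
   loop variables [vs] holding [eta], [c] ends within time [X ^ g] in a memory
   satisfying [P], the registers below [dl] being untouched. *)
Definition wp dl vs eta g c (P : hst -> Prop) (h : hst) : Prop :=
  forall s, rep vs eta h s -> runs c s g (fun s' =>
    (forall l, (l < dl)%N -> nmem s' (8 * l + 7)%N = nmem s (8 * l + 7)%N) /\
    exists2 h', rep vs eta h' s' & P h').

End Compile.

(** * Commands and their triples *)

Definition sN dl al i v :=
  Seq (cN dl i) (Seq (cN dl.+1 v) (NSet (cell al (nreg dl)) (nreg dl.+1))).
Definition sR dl al i v :=
  Seq (cN dl i) (Seq (cR dl.+1 v) (RSet (cell al (nreg dl)) (rreg dl.+1))).
Definition sFor dl l b c :=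
  Seq (cN dl b) (Seq (NSet (reg l) (NCst 0))
    (While (BNle (NSuc (nreg l)) (nreg dl)) (Seq c (NSet (reg l) (NSuc (nreg l)))))).
Definition sIfN dl a b c1 c2 :=
  Seq (cN dl a) (Seq (cN dl.+1 b) (If (BNle (nreg dl) (nreg dl.+1)) c1 c2)).
Definition sIfR dl a b c1 c2 :=
  Seq (cR dl a) (Seq (cR dl.+1 b) (If (BRle (rreg dl) (rreg dl.+1)) c1 c2)).
(** Counts upwards in a real and a natural register at once. The machine has no cast, so this is how
    a natural number is obtained from a real one. *)
Definition sCeil dl al i x :=
  Seq (cR dl x) (Seq (RSet (reg dl.+1) (RCst 0)) (Seq (NSet (reg dl) (NCst 0))
  (Seq (While (BNot (BRle (rreg dl) (rreg dl.+1)))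
     (Seq (RSet (reg dl.+1) (RAdd (rreg dl.+1) (RCst 1)))
          (NSet (reg dl) (NSuc (nreg dl)))))
  (Seq (cN dl.+1 i) (NSet (cell al (nreg dl.+1)) (nreg dl)))))).

Section Triples.
Variable R : realType.
Variable X : nat.
Hypothesis X_ge : (100 <= X)%N.
Implicit Types (s : state R) (h : hst R).
Local Notation wp := (wp X).

Lemma wp_mono dl vs eta g g' c (P P' : hst R -> Prop) h :
  (g <= g')%N -> (forall h', P h' -> P' h') ->
  wp dl vs eta g c P h -> wp dl vs eta g' c P' h.
Proof.
move=> gg PP H s rp; apply: runs_mono (H s rp) => // s' [k [h' rp' Ph']].
by split=> //; exists h' => //; apply: PP.
Qed.

Lemma wp_skip dl vs eta g (P : hst R -> Prop) h : P h -> wp dl vs eta g Skip P h.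
Proof. by move=> Ph s rp; apply: runs_skip => //; split=> //; exists h. Qed.

Lemma wp_seq dl vs eta g g1 g2 c1 c2 (P : hst R -> Prop) h :
  (g1 < g)%N -> (g2 < g)%N ->
  wp dl vs eta g1 c1 (wp dl vs eta g2 c2 P) h -> wp dl vs eta g (Seq c1 c2) P h.
Proof.
move=> g1g g2g H s rp; apply: (runs_seq X_ge g1g g2g).
apply: runs_mono (H s rp) => // s1 [k1 [h1 rp1 H1]].
apply: runs_mono (H1 s1 rp1) => // s2 [k2 [h2 rp2 Ph2]].
by split; [move=> l ll; rewrite k2 ?k1|exists h2].
Qed.

Lemma wp_setN dl vs eta g al i v (P : hst R -> Prop) h :
  [&& below dl vs, (al < 7)%N, wfN vs i & wfN vs v] ->
  (maxn (hN i) (hN v) + 3 <= g)%N -> okN X h eta i -> okN X h eta v ->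
  P (setN h al (dN h eta i) (dN h eta v)) -> wp dl vs eta g (sN dl al i v) P h.
Proof.
move=> /and4P[bl al7 wi wv] hg oi ov Ph s rp.
apply: (cN_bin X_ge (vs := vs) (eta := eta) (h := h)) => //;
  [exact: cN_ok|exact: cN_ok|by move: hg; lia|].
move=> s1 k1 r1 v1 v2; apply: runs_nset => //; first by move: hg; lia.
rewrite neval_cell !neval_nreg v1 v2; split.
  by move=> l ll; rewrite nreg_nset_cell// (keep_nreg ll k1).
exists (setN h al (dN h eta i) (dN h eta v)) => //.
exact: rep_nset (rep_keep bl rp k1).
Qed.

Lemma wp_setR dl vs eta g al i v (P : hst R -> Prop) h :
  [&& below dl vs, (al < 7)%N, wfN vs i & wfR dl.+1 vs v] ->
  (maxn (hN i) (hR v) + 3 <= g)%N -> okN X h eta i -> okR X h eta v ->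
  P (setR h al (dN h eta i) (dR h eta v)) -> wp dl vs eta g (sR dl al i v) P h.
Proof.
move=> /and4P[bl al7 wi wv] hg oi ov Ph s rp.
apply: (@runs_seq _ _ X_ge _ _ _ _ (hN i) (g - 1)); [by move: hg; lia..|].
apply: runs_mono (cN_ok X_ge bl wi oi rp) => // s1 [k1 r1 v1].
apply: (@runs_seq _ _ X_ge _ _ _ _ (hR v) (g - 2)); [by move: hg; lia..|].
have rp1 := rep_keep bl rp k1.
apply: runs_mono (cR_ok X_ge (below_S bl) wv ov rp1) => // s2 [k2 v2].
apply: runs_rset => //; first by move: hg; lia.
rewrite neval_cell !neval_nreg reval_rreg v2 (keep_nreg (ltnSn dl) k2) v1; split.
  move=> l ll /=; rewrite (keep_nreg (leqW ll) k2).
  by rewrite (keep_nreg ll k1).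
exists (setR h al (dN h eta i) (dR h eta v)) => //.
exact: rep_rset (rep_keep (below_S bl) rp1 k2).
Qed.

(** The triple of the body protects the registers below [l + 1], among them the counter [l] and the
    bound kept in [dl]. *)
Lemma wp_for dl vs eta g g' l b c (I : nat -> hst R -> Prop) (P : hst R -> Prop) h :
  [&& below dl vs, (dl < l)%N & wfN vs b] -> (maxn (hN b) g' + 7 <= g)%N ->
  okN X h eta b -> (dN h eta b <= X)%N -> I 0%N h ->
  (forall i h', (i < dN h eta b)%N -> I i h' ->
     wp l.+1 (l :: vs) (upd eta l i) g' c (I i.+1) h') ->
  (forall h', I (dN h eta b) h' -> P h') ->
  wp dl vs eta g (sFor dl l b c) P h.
Proof.
move=> /and3P[bl dll wb] hg ob BX I0 step fin s rp.
set B := dN h eta b in BX step fin *.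
have hb := hN_gt0 b.
apply: (@runs_seq _ _ X_ge _ _ _ _ (hN b) (g - 1)); [by move: hg; lia..|].
apply: runs_mono (cN_ok X_ge bl wb ob rp) => // s1 [k1 r1 v1].
apply: (@runs_seq _ _ X_ge _ _ _ _ 1 (g - 2)); [by move: hg; lia..|].
apply: runs_nset => //; rewrite neval_reg.
pose J m (s' : state R) := [/\
   forall x, (x < dl)%N -> nmem s' (8 * x + 7)%N = nmem s (8 * x + 7)%N,
   nmem s' (8 * dl + 7)%N = B,
   nmem s' (8 * l + 7)%N = (B - m)%N, (m <= B)%N &
   exists2 h', rep vs eta h' s' & I (B - m)%N h'].
apply: (@runs_while _ _ X_ge _ _ _ (maxn (hN b) g' + 2) _ B J) => //;
  [by move: hg; lia..| | |].
- split=> //.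
  + move=> x xl; rewrite nreg_nset; have -> : (x == l) = false by lia.
    by rewrite (keep_nreg xl k1).
  + by rewrite nreg_nset v1; have -> : (dl == l) = false by lia.
  + by rewrite nreg_nset eqxx subnn.
  + exists h; last by rewrite subnn.
    exact: rep_keep (rep_keep bl rp k1) (keep_nset _ _ (ltnW dll)).
- move=> m s2 [kx vB vl lm [h2 rp2 I2]].
  split; first by rewrite /= vB vl; lia.
  have iB : (B - m.+1 < B)%N by lia.
  apply: (@runs_seq _ _ X_ge _ _ _ _ g' 1); [by move: hg; lia..|].
  have H := step _ _ iB I2.
  apply: runs_mono (H s2 (rep_cons bl dll rp2 vl)) => // s3 [k3 [h3 [a1 a2 a3] I3]].
  apply: runs_nset => //; rewrite neval_reg; split.
  + move=> x xl; rewrite nreg_nset; have -> : (x == l) = false by lia.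
    by rewrite k3 ?kx//; lia.
  + rewrite nreg_nset; have -> : (dl == l) = false by lia.
    by rewrite k3 ?vB//; lia.
  + by rewrite nreg_nset eqxx !nevE k3 ?vl//; lia.
  + by lia.
  + have -> : (B - m = (B - m.+1).+1)%N by lia.
    exists h3 => //; apply: (rep_keep bl); last exact: keep_nset (ltnW dll).
    split=> // x xv; rewrite a3 ?inE ?xv ?orbT// upd_diff//.
    by move/allP: bl => /(_ _ xv); lia.
- move=> s2 [kx vB vl lm [h2 rp2 I2]]; rewrite subn0 in I2 vl.
  split; first by rewrite /= vB vl; lia.
  by split=> //; exists h2 => //; apply: fin.
Qed.

Lemma wp_ifN dl vs eta g g' a b c1 c2 (P : hst R -> Prop) h :
  [&& below dl vs, wfN vs a & wfN vs b] ->
  (maxn (maxn (hN a) (hN b)) g' + 4 <= g)%N -> okN X h eta a -> okN X h eta b ->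
  wp dl vs eta g' (if (dN h eta a <= dN h eta b)%N then c1 else c2) P h ->
  wp dl vs eta g (sIfN dl a b c1 c2) P h.
Proof.
move=> /and3P[bl wa wb] hg oa ob H s rp; have ha := hN_gt0 a.
apply: (cN_bin X_ge (vs := vs) (eta := eta) (h := h)) => //;
  [exact: cN_ok|exact: cN_ok|by move: hg; lia|].
move=> s1 k1 r1 va vb; have rp1 := rep_keep bl rp k1.
apply: (@runs_if _ _ X_ge _ _ _ _ (g - 3)) => //; [by move: hg; lia..|].
rewrite [beval _ _]/= va vb.
apply: runs_mono (H s1 rp1); [by []|by move: hg; lia|].
by move=> s2 [k2 H2]; split=> // l ll; rewrite k2// (keep_nreg ll k1).
Qed.

Lemma wp_ifR dl vs eta g g' a b c1 c2 (P : hst R -> Prop) h :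
  [&& below dl vs, wfR dl vs a & wfR dl.+1 vs b] ->
  (maxn (maxn (hR a) (hR b)) g' + 4 <= g)%N -> okR X h eta a -> okR X h eta b ->
  wp dl vs eta g' (if dR h eta a <= dR h eta b then c1 else c2) P h ->
  wp dl vs eta g (sIfR dl a b c1 c2) P h.
Proof.
move=> /and3P[bl wa wb] hg oa ob H s rp; have ha := hR_gt0 a.
apply: (cR_bin X_ge (vs := vs) (eta := eta) (h := h)) => //;
  [exact: cR_ok|exact: cR_ok|by move: hg; lia|].
move=> s1 k1 va vb; have rp1 := rep_keep bl rp k1.
apply: (@runs_if _ _ X_ge _ _ _ _ (g - 3)) => //; [by move: hg; lia..|].
rewrite [beval _ _]/= va vb.
apply: runs_mono (H s1 rp1); [by []|by move: hg; lia|].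
by move=> s2 [k2 H2]; split=> // l ll; rewrite k2// (keep_nreg ll k1).
Qed.

Lemma wp_ceil dl vs eta g al i x (P : hst R -> Prop) h M :
  [&& below dl vs, (al < 7)%N, wfN vs i & wfR dl vs x] ->
  (maxn (hN i) (hR x) + 10 <= g)%N -> okN X h eta i -> okR X h eta x ->
  0 <= dR h eta x -> dR h eta x <= M%:R -> (M <= X)%N ->
  (forall c : nat, (c <= M)%N -> dR h eta x <= c%:R -> c%:R < dR h eta x + 1 ->
     P (setN h al (dN h eta i) c)) ->
  wp dl vs eta g (sCeil dl al i x) P h.
Proof.
move=> /and4P[bl al7 wi wx] hg oi ox x0 xM MX HP s rp.
set v := dR h eta x in x0 xM HP *.
have hi := hN_gt0 i; have hx := hR_gt0 x.
have exc : exists c : nat, v <= c%:R by exists M.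
pose c := ex_minn exc.
have [vc cmin] : v <= c%:R /\ forall m : nat, v <= m%:R -> (c <= m)%N.
  by rewrite /c; case: ex_minnP.
have cM : (c <= M)%N by exact: cmin.
have c1 : c%:R < v + 1.
  case E: c vc => [|c'] vc; first by rewrite ltr_wpDl.
  rewrite -natr1 ltrD2r ltNge; apply/negP => /cmin.
  by rewrite E ltnn.
apply: (@runs_seq _ _ X_ge _ _ _ _ (hR x) (g - 1)); [by move: hg; lia..|].
apply: runs_mono (cR_ok X_ge bl wx ox rp) => // s1 [k1 v1].
apply: (@runs_seq _ _ X_ge _ _ _ _ 1 (g - 2)); [by move: hg; lia..|].
apply: runs_rset => //; rewrite neval_reg.
apply: (@runs_seq _ _ X_ge _ _ _ _ 1 (g - 3)); [by move: hg; lia..|].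
apply: runs_nset => //; rewrite neval_reg.
apply: (@runs_seq _ _ X_ge _ _ _ _ 4 (g - 4)); [by move: hg; lia..|].
pose J m (s' : state R) := [/\ keep dl s s',
   rmem s' (8 * dl + 7)%N = v,
   rmem s' (8 * dl.+1 + 7)%N = (c - m)%N%:R,
   nmem s' (8 * dl + 7)%N = (c - m)%N & (m <= c)%N].
apply: (@runs_while _ _ X_ge _ _ _ 2 _ c J) => //.
- exact: leq_trans MX.
- split=> //.
  + apply: keep_trans (leqnn _) _ (keep_nset _ _ (leqnn _)).
    exact: keep_trans (leqnn _) k1 (keep_rset _ _ (leqnSn _)).
  + by rewrite rreg_nset rreg_rset v1; have -> : (dl == dl.+1) = false by lia.
  + by rewrite rreg_nset rreg_rset eqxx subnn.
  + by rewrite nreg_nset eqxx subnn.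
- move=> m s2 [k2 vv vr vn lm]; split.
    rewrite /= vv vr; apply/negP => /cmin; lia.
  apply: (@runs_seq _ _ X_ge _ _ _ _ 1 1) => //.
  apply: runs_rset => //; apply: runs_nset => //; rewrite !neval_reg; split=> //.
  + apply: keep_trans (leqnn _) _ (keep_nset _ _ (leqnn _)).
    exact: keep_trans (leqnn _) k2 (keep_rset _ _ (leqnSn _)).
  + by rewrite rreg_nset rreg_rset vv; have -> : (dl == dl.+1) = false by lia.
  + rewrite rreg_nset rreg_rset eqxx [reval _ _]/= vr.
    have -> : (c - m = (c - m.+1).+1)%N by lia.
    by rewrite natr1.
  + by rewrite nreg_nset eqxx !nevE nreg_rset vn; lia.
  + by lia.
- move=> s2 [k2 vv vr vn _]; rewrite subn0 in vr vn.
  split; first by rewrite /= vv vr vc.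
  have rp2 := rep_keep bl rp k2.
  apply: (@runs_seq _ _ X_ge _ _ _ _ (hN i) 1); [by move: hg; lia..|].
  apply: runs_mono (cN_ok X_ge (below_S bl) wi oi rp2) => // s3 [k3 r3 v3].
  apply: runs_nset => //; rewrite neval_cell !neval_nreg v3.
  rewrite (keep_nreg (ltnSn dl) k3) vn; split.
    move=> l ll; rewrite nreg_nset_cell// (keep_nreg (leqW ll) k3).
    by rewrite (keep_nreg ll k2).
  exists (setN h al (dN h eta i) c); last exact: HP.
  exact: rep_nset (rep_keep (below_S bl) rp2 k3).
Qed.

End Triples.

(** * The program *)

(** Natural cells 0 and 1 of the input are entry 0 of arrays 0 and 1, so [n] and [k] are in place
    from the start. *)
Definition n_ := Nr 0 (Nc 0).
Definition k_ := Nr 1 (Nc 0).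
Definition Q_ := Nr 0 (Nc 1).
Definition s_ := Nr 0 (Nc 4).
Definition L_ := Nr 0 (Nc 5).
Definition h_ := Rr 0 (Nc 2).
Definition natE l e := Rsum l e (Rc 1).
Definition sqE e := Rm e e.
Definition GE l a x := natE l (No (Nd a (Nr 4 x)) Q_).
Definition D2E l a b := Rsum l k_ (sqE (Rs (GE (l + 5) a (Nt l)) (GE (l + 5) b (Nt l)))).
Definition rrE l a b := Rsum l (Nm k_ Q_)
  (Rif (sqE (natE (l + 5) (Na (Nt l) (Nc 1)))) (D2E (l + 5) a b) (Rc 1) (Rc 0)).
Definition dE i j := Rr 1 (Na (Nc 1) (Na (Nm i n_) j)).
Definition wE i j := Rr 1 (Na (Nc 1) (Na (Nm n_ n_) (Na (Nm i n_) j))).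
(** Both [d i j] and [d j i] enter because [d] need not be symmetric. *)
Definition cE l i j a b := Rm (wE i j)
  (Rs (Rm (Rm h_ h_) (D2E l a b)) (Rm (Rm (Ra (dE i j) (dE j i)) h_) (rrE l a b))).
Definition costE l al := Rsum l n_ (Rsum (l + 5) n_
  (cE (l + 15) (Nt l) (Nt (l + 5)) (Nr al (Nt l)) (Nr al (Nt (l + 5))))).

(* The sampled index and label number [t] encoded by the advice [N]. *)
Definition JE N t := No (Nd N (Nr 5 t)) n_.
Definition YE N t := No (Nd (Nd N (Nr 5 s_)) (Nr 6 t)) L_.
Definition ctrE l N i x :=
  Rd (Rsum l s_ (Rm (wE i (JE N (Nt l))) (GE (l + 10) (YE N (Nt l)) x)))
     (Rsum l s_ (wE i (JE N (Nt l)))).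
(** This is 100 [beta ^ 2] for the symmetrised distances in units of the mesh: the sum of two
    entries is twice their mean, whence 25 = 100 / 4. *)
Definition rhoE l i := Rm (Rc 25) (sqE (Rd
  (Rsum l n_ (Rm (wE i (Nt l)) (Ra (dE i (Nt l)) (dE (Nt l) i))))
  (Rm h_ (Rsum l n_ (wE i (Nt l)))))).
Definition distE l a := Rsum l k_ (sqE (Rs (GE (l + 5) a (Nt l)) (Rr 3 (Nt l)))).
Definition estE l N i a := Ra
  (Rsum l i (cE (l + 10) i (Nt l) a (Nr 2 (Nt l))))
  (Rm (Rd (natE l n_) (natE l s_))
      (Rsum l s_ (Rifn (Na i (Nc 1)) (JE N (Nt l))
                       (cE (l + 10) i (JE N (Nt l)) a (YE N (Nt l))) (Rc 0)))).

(** * Values of the expressions of the program *)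

Section Sem.
Variable R : realType.
Variable X : nat.
Variables (n k Q : nat) (inp : nat -> R) (hh : R).
Implicit Types (h : hst R) (eta : nat -> nat).

Definition cfg h : Prop := [/\ hn h 0 0 = n, hn h 1 0 = k, hn h 0 1 = Q,
  hr h 0 2 = hh & [/\ (forall c, hr h 1 c = inp c) &
  (forall l, (l <= k)%N -> hn h 4 l = Q ^ l)%N]].

Definition ddn i j : R := inp (1 + (i * n + j))%N.
Definition wwn i j : R := inp (1 + (n * n + (i * n + j)))%N.
Definition D2n a b : R := \sum_(l < k) ((dig Q a l)%:R - (dig Q b l)%:R) ^+ 2.
Definition rrn a b : R := flr k Q (D2n a b).
Definition cn i j a b : R :=
  wwn i j * (hh * hh * D2n a b - (ddn i j + ddn j i) * hh * rrn a b).
Definition costn (x : nat -> nat) : R := \sum_(i < n) \sum_(j < n) cn i j (x i) (x j).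

Hypothesis Q0 : (0 < Q)%N.
Hypothesis nX : (n <= X)%N.
Hypothesis kX : (k <= X)%N.
Hypothesis QX : (Q <= X)%N.
Hypothesis kQX : (k * Q <= X)%N.

Definition ltN (L : nat) (e : ne) := wfN (iota 0 L) e.

Lemma dN_upd h eta L l v e : ltN L e -> (L <= l)%N -> dN h (upd eta l v) e = dN h eta e.
Proof.
rewrite /ltN => + Ll; elim: e => //=.
- by move=> x; rewrite mem_iota add0n /= => xL; rewrite upd_diff//; lia.
- by move=> al i IH /andP[_ /IH ->].
- by move=> a IHa b IHb /andP[/IHa -> /IHb ->].
- by move=> a IHa b IHb /andP[/IHa -> /IHb ->].
- by move=> a IHa b IHb /andP[/IHa -> /IHb ->].
- by move=> a IHa b IHb /andP[/IHa -> /IHb ->].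
- by move=> a IHa b IHb /andP[/IHa -> /IHb ->].
Qed.

Lemma okN_upd h eta L l v e : ltN L e -> (L <= l)%N ->
  okN X h eta e -> okN X h (upd eta l v) e.
Proof.
move=> + Ll; elim: e => //=; rewrite /ltN /=.
- by move=> al i IH /andP[_ /IH H] /H.
- by move=> a IHa b IHb /andP[/IHa Ha /IHb Hb] [/Ha ? /Hb ?].
- by move=> a IHa b IHb /andP[/IHa Ha /IHb Hb] [/Ha ? /Hb ?].
- move=> a IHa b IHb /andP[La Lb] [oa ob H].
  by split; [exact: IHa|exact: IHb|rewrite (dN_upd _ _ _ La Ll)].
- move=> a IHa b IHb /andP[La Lb] [oa ob H H'].
  by split; [exact: IHa|exact: IHb|rewrite (dN_upd _ _ _ La Ll)|rewrite (dN_upd _ _ _ Lb Ll)].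
- move=> a IHa b IHb /andP[La Lb] [oa ob H H'].
  by split; [exact: IHa|exact: IHb|rewrite (dN_upd _ _ _ La Ll)|rewrite (dN_upd _ _ _ Lb Ll)].
Qed.

Lemma dR_Rsum h eta l b f :
  dR h eta (Rsum l b f) = \sum_(i < dN h eta b) dR h (upd eta l i) f.
Proof. by []. Qed.
Lemma dR_Rm h eta a b : dR h eta (Rm a b) = dR h eta a * dR h eta b.
Proof. by []. Qed.
Lemma dR_Rs h eta a b : dR h eta (Rs a b) = dR h eta a - dR h eta b.
Proof. by []. Qed.
Lemma dR_Ra h eta a b : dR h eta (Ra a b) = dR h eta a + dR h eta b.
Proof. by []. Qed.
Lemma dR_Rd h eta a b : dR h eta (Rd a b) = dR h eta a / dR h eta b.
Proof. by []. Qed.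
Lemma dR_Rif h eta a b f g : dR h eta (Rif a b f g) =
  if dR h eta a <= dR h eta b then dR h eta f else dR h eta g.
Proof. by []. Qed.
Lemma dR_Rifn h eta a b f g : dR h eta (Rifn a b f g) =
  if (dN h eta a <= dN h eta b)%N then dR h eta f else dR h eta g.
Proof. by []. Qed.

Lemma natE_sem h eta l e : dR h eta (natE l e) = (dN h eta e)%:R.
Proof. by rewrite /= sumr_const card_ord. Qed.

Lemma natE_ok h eta l e : okN X h eta e -> (dN h eta e <= X)%N -> okR X h eta (natE l e).
Proof. by []. Qed.

Section WithCfg.
Variable h : hst R.
Hypothesis C : cfg h.
Let Cn : hn h 0 0 = n. Proof. by case: C. Qed.
Let Ck : hn h 1 0 = k. Proof. by case: C. Qed.
Let CQ : hn h 0 1 = Q. Proof. by case: C. Qed.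
Let Ch : hr h 0 2 = hh. Proof. by case: C. Qed.
Let Ci c : hr h 1 c = inp c. Proof. by case: C => _ _ _ _ []. Qed.
Let CQp l : (l <= k)%N -> hn h 4 l = (Q ^ l)%N.
Proof. by case: C => _ _ _ _ [_]; apply. Qed.

Lemma GE_sem eta l a x : (dN h eta x <= k)%N ->
  dR h eta (GE l a x) = (dig Q (dN h eta a) (dN h eta x))%:R.
Proof. by move=> xk; rewrite natE_sem /= CQp// CQ. Qed.

Lemma GE_ok eta l a x : (dN h eta x <= k)%N -> okN X h eta a -> okN X h eta x ->
  (dN h eta a <= X)%N -> okR X h eta (GE l a x).
Proof.
move=> xk oa ox aX; rewrite /= CQp// CQ; split=> //; last first.
  by rewrite (leq_trans _ QX)// ltnW// ltn_mod.
by split=> //; [split=> //; rewrite expn_gt0 Q0|rewrite (leq_trans (leq_div _ _))].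
Qed.

Lemma D2E_sem eta l a b : ltN l a -> ltN l b ->
  dR h eta (D2E l a b) = D2n (dN h eta a) (dN h eta b).
Proof.
move=> la lb; rewrite /D2E dR_Rsum [dN h eta k_]/= Ck; apply: eq_bigr => i _.
have e x : dN h (upd eta l x) (Nt l) = x by exact: upd_same.
rewrite /sqE dR_Rm dR_Rs !GE_sem ?e ?(ltnW (ltn_ord i))//.
by rewrite (dN_upd _ _ _ la)// (dN_upd _ _ _ lb)// expr2.
Qed.

Lemma D2E_ok eta l a b : ltN l a -> ltN l b -> okN X h eta a -> okN X h eta b ->
  (dN h eta a <= X)%N -> (dN h eta b <= X)%N -> okR X h eta (D2E l a b).
Proof.
move=> la lb oa ob aX bX; split=> //=; rewrite Ck// => i ik.
have G c : ltN l c -> okN X h eta c -> (dN h eta c <= X)%N ->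
    okR X h (upd eta l i) (GE (l + 5) c (Nt l)).
  move=> lc oc cX; apply: GE_ok => //=; rewrite ?upd_same ?(ltnW ik)//.
    exact: (okN_upd _ lc).
  by rewrite (dN_upd _ _ _ lc).
by split; split; apply: G.
Qed.

Lemma ltN_le l l' e : (l <= l')%N -> ltN l e -> ltN l' e.
Proof.
move=> ll; rewrite /ltN; elim: e => //=.
- by move=> x; rewrite !mem_iota !add0n /=; lia.
- by move=> al i IH /andP[-> /IH].
- by move=> a IHa b IHb /andP[/IHa -> /IHb ->].
- by move=> a IHa b IHb /andP[/IHa -> /IHb ->].
- by move=> a IHa b IHb /andP[/IHa -> /IHb ->].
- by move=> a IHa b IHb /andP[/IHa -> /IHb ->].
- by move=> a IHa b IHb /andP[/IHa -> /IHb ->].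
Qed.

Lemma rrE_sem eta l a b : ltN l a -> ltN l b ->
  dR h eta (rrE l a b) = rrn (dN h eta a) (dN h eta b).
Proof.
move=> la lb; have l5 : (l <= l + 5)%N by exact: leq_addr.
rewrite /rrE dR_Rsum [dN h eta _]/= Ck CQ; apply: eq_bigr => i _.
rewrite dR_Rif D2E_sem ?(ltN_le l5)// /sqE dR_Rm natE_sem.
rewrite (dN_upd _ _ _ la)// (dN_upd _ _ _ lb)//.
by rewrite [dN _ _ (Na _ _)]/= upd_same addn1 -expr2.
Qed.

Lemma rrE_ok eta l a b : ltN l a -> ltN l b -> okN X h eta a -> okN X h eta b ->
  (dN h eta a <= X)%N -> (dN h eta b <= X)%N -> okR X h eta (rrE l a b).
Proof.
move=> la lb oa ob aX bX; have l5 : (l <= l + 5)%N by exact: leq_addr.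
split; [by split=> //=; rewrite Ck|by rewrite /= Ck CQ|].
rewrite [dN _ _ _]/= Ck CQ => i ik; split=> //; last first.
  apply: D2E_ok; [exact: ltN_le la|exact: ltN_le lb| | | |].
  - exact: (okN_upd _ la).
  - exact: (okN_upd _ lb).
  - by rewrite (dN_upd _ _ _ la).
  - by rewrite (dN_upd _ _ _ lb).
have : (i + 1 <= X)%N by rewrite addn1 (leq_trans ik).
by move=> iX; split; split=> //=; rewrite upd_same.
Qed.

Lemma dE_sem eta i j : dR h eta (dE i j) = ddn (dN h eta i) (dN h eta j).
Proof. by rewrite /= Ci Cn. Qed.

Lemma wE_sem eta i j : dR h eta (wE i j) = wwn (dN h eta i) (dN h eta j).
Proof. by rewrite /= Ci Cn. Qed.

Lemma dE_ok eta i j : okN X h eta i -> okN X h eta j -> (dN h eta i <= X)%N ->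
  okR X h eta (dE i j).
Proof. by move=> oi oj iX; split=> //; split. Qed.

Lemma wE_ok eta i j : okN X h eta i -> okN X h eta j -> (dN h eta i <= X)%N ->
  okR X h eta (wE i j).
Proof. by move=> oi oj iX; split=> //; split=> /=; rewrite ?Cn. Qed.

Lemma cE_sem eta l i j a b : ltN l a -> ltN l b ->
  dR h eta (cE l i j a b) = cn (dN h eta i) (dN h eta j) (dN h eta a) (dN h eta b).
Proof.
move=> la lb; rewrite /cE dR_Rm dR_Rs !(dR_Rm, dR_Ra) D2E_sem// rrE_sem// wE_sem !dE_sem.
by rewrite [dR _ _ h_]/= Ch.
Qed.

Lemma cE_ok eta l i j a b : ltN l a -> ltN l b -> okN X h eta a -> okN X h eta b ->
  (dN h eta a <= X)%N -> (dN h eta b <= X)%N ->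
  okN X h eta i -> okN X h eta j -> (dN h eta i <= X)%N -> (dN h eta j <= X)%N ->
  okR X h eta (cE l i j a b).
Proof.
move=> la lb oa ob aX bX oi oj iX jX.
split; first exact: wE_ok.
split; split; [by []|exact: D2E_ok| |exact: rrE_ok].
by split=> //; split; apply: dE_ok.
Qed.

Lemma costE_sem eta l al : (al < 7)%N ->
  dR h eta (costE l al) = costn (hn h al).
Proof.
move=> al7; rewrite /costE dR_Rsum [dN h eta n_]/= Cn; apply: eq_bigr => i _.
rewrite dR_Rsum [dN h _ n_]/= Cn; apply: eq_bigr => j _.
have e1 : upd (upd eta l i) (l + 5) j l = i by rewrite upd_diff ?upd_same//; lia.
rewrite cE_sem /= ?e1 ?upd_same//;
  by rewrite /ltN /= al7 /= mem_iota; lia.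
Qed.

Lemma costE_ok eta l al : (al < 7)%N -> (forall i, (i < n)%N -> (hn h al i <= X)%N) ->
  okR X h eta (costE l al).
Proof.
move=> al7 Hx; split; [by []|by rewrite /= Cn|].
rewrite [dN _ _ n_]/= Cn => i iN; split; [by []|by rewrite /= Cn|].
rewrite [dN _ _ n_]/= Cn => j jn.
have e1 : upd (upd eta l i) (l + 5) j l = i by rewrite upd_diff ?upd_same//; lia.
apply: cE_ok => //=; rewrite ?e1 ?upd_same ?Hx//;
  try by rewrite /ltN /= al7 /= mem_iota; lia.
- exact: leq_trans (ltnW iN) nX.
- exact: leq_trans (ltnW jn) nX.
Qed.

Variables (s L P : nat).
Hypothesis sX : (s <= X)%N.
Hypothesis LX : (L <= X)%N.
Hypothesis n0 : (0 < n)%N.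
Hypothesis L0 : (0 < L)%N.
Hypothesis Cs : hn h 0 4 = s.
Hypothesis CL : hn h 0 5 = L.

Definition Jn N t : nat := ((N %/ n ^ t) %% n)%N.
Definition Yn N t : nat := ((N %/ n ^ s %/ L ^ t) %% L)%N.
Definition ctrn N i x : R := (\sum_(t < s) wwn i (Jn N t) * (dig Q (Yn N t) x)%:R)
  / (\sum_(t < s) wwn i (Jn N t)).
Definition rhon i : R := 25 * ((\sum_(j < n) wwn i j * (ddn i j + ddn j i))
  / (hh * \sum_(j < n) wwn i j)) ^+ 2.
Definition distn (c : nat -> R) a : R := \sum_(x < k) ((dig Q a x)%:R - c x) ^+ 2.
Definition estn N (x : nat -> nat) i a : R := \sum_(j < i) cn i j a (x j) +
  n%:R / s%:R * \sum_(t < s)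
    (if (i + 1 <= Jn N t)%N then cn i (Jn N t) a (Yn N t) else 0).

Lemma Jn_lt N t : (Jn N t < n)%N. Proof. by rewrite ltn_mod. Qed.
Lemma Yn_lt N t : (Yn N t < L)%N. Proof. by rewrite ltn_mod. Qed.

Section Tables.
Hypothesis Cnp : forall t, (t <= s)%N -> hn h 5 t = (n ^ t)%N.
Hypothesis CLp : forall t, (t <= s)%N -> hn h 6 t = (L ^ t)%N.

Lemma JE_sem eta N t : (dN h eta t <= s)%N ->
  dN h eta (JE N t) = Jn (dN h eta N) (dN h eta t).
Proof. by move=> ts; rewrite /= Cn Cnp. Qed.

Lemma YE_sem eta N t : (dN h eta t <= s)%N ->
  dN h eta (YE N t) = Yn (dN h eta N) (dN h eta t).
Proof. by move=> ts; rewrite /= CL Cs Cnp// CLp. Qed.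

Lemma JE_ok eta N t : okN X h eta N -> okN X h eta t -> (dN h eta t <= s)%N ->
  (dN h eta N <= X)%N -> okN X h eta (JE N t).
Proof.
move=> oN ot ts NX; rewrite /= Cnp// Cn; split=> //; last by rewrite (leq_trans (leq_div _ _)).
by split=> //; rewrite expn_gt0 n0.
Qed.

Lemma YE_ok eta N t : okN X h eta N -> okN X h eta t -> (dN h eta t <= s)%N ->
  (dN h eta N <= X)%N -> okN X h eta (YE N t).
Proof.
move=> oN ot ts NX; rewrite /= CL Cs Cnp// CLp//; split=> //; last first.
  by rewrite (leq_trans (leq_div _ _))// (leq_trans (leq_div _ _)).
split=> //; last by rewrite expn_gt0 L0.
  by split=> //; rewrite expn_gt0 n0.
by rewrite (leq_trans (leq_div _ _)).
Qed.

Lemma YE_lt l N t : ltN l N -> ltN l t -> ltN l (YE N t).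
Proof. by rewrite /ltN /= => -> ->. Qed.

Lemma Nt_lt l l' : (l < l')%N -> ltN l' (Nt l).
Proof. by rewrite /ltN /= mem_iota; lia. Qed.

Section Var.
Variables (eta : nat -> nat) (l : nat) (N i a : ne).
Hypotheses (lN : ltN l N) (li : ltN l i) (la : ltN l a).
Hypotheses (oN : okN X h eta N) (oi : okN X h eta i) (oa : okN X h eta a).
Hypotheses (NX : (dN h eta N <= X)%N) (iX : (dN h eta i <= n)%N) (aX : (dN h eta a <= X)%N).

Let updN e v : ltN l e -> dN h (upd eta l v) e = dN h eta e.
Proof. by move=> le; rewrite (dN_upd _ _ _ le). Qed.
Let updok e v : ltN l e -> okN X h eta e -> okN X h (upd eta l v) e.
Proof. by move=> le; apply: (okN_upd _ le). Qed.
Let iX' : (dN h eta i <= X)%N. Proof. exact: leq_trans nX. Qed.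

Let JS t : (t < s)%N -> dN h (upd eta l t) (JE N (Nt l)) = Jn (dN h eta N) t.
Proof. by move=> ts; rewrite JE_sem /= upd_same ?(ltnW ts)// updN. Qed.
Let YS t : (t < s)%N -> dN h (upd eta l t) (YE N (Nt l)) = Yn (dN h eta N) t.
Proof. by move=> ts; rewrite YE_sem /= upd_same ?(ltnW ts)// updN. Qed.
Let JO t : (t < s)%N -> okN X h (upd eta l t) (JE N (Nt l)).
Proof.
by move=> ts; apply: JE_ok; rewrite //= ?upd_same ?(ltnW ts) ?updN//; apply: updok.
Qed.
Let YO t : (t < s)%N -> okN X h (upd eta l t) (YE N (Nt l)).
Proof.
by move=> ts; apply: YE_ok; rewrite //= ?upd_same ?(ltnW ts) ?updN//; apply: updok.
Qed.

Lemma ctrE_sem x : ltN l x -> (dN h eta x <= k)%N ->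
  dR h eta (ctrE l N i x) = ctrn (dN h eta N) (dN h eta i) (dN h eta x).
Proof.
move=> lx xk; rewrite /ctrE dR_Rd !dR_Rsum [dN h eta s_]/= Cs; congr (_ / _); apply: eq_bigr => t _.
  rewrite dR_Rm wE_sem GE_sem; last by rewrite (updN _ lx).
  by rewrite YS// JS// (updN _ li) (updN _ lx).
by rewrite wE_sem JS// (updN _ li).
Qed.

Lemma ctrE_ok x : ltN l x -> okN X h eta x -> (dN h eta x <= k)%N ->
  okR X h eta (ctrE l N i x).
Proof.
move=> lx ox xk.
have W t : (t < s)%N -> okR X h (upd eta l t) (wE i (JE N (Nt l))).
  move=> ts; apply: wE_ok; [exact: updok|exact: JO|by rewrite (updN _ li)].
split; (split; [by []|by rewrite /= Cs|]); rewrite [dN _ _ s_]/= Cs => t ts;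
  last exact: W.
split; first exact: W.
apply: GE_ok; [by rewrite (updN _ lx)|exact: YO|exact: updok|].
by rewrite YS// (leq_trans (ltnW (Yn_lt _ _))).
Qed.

Lemma rhoE_sem : dR h eta (rhoE l i) = rhon (dN h eta i).
Proof.
have e x : dN h (upd eta l x) (Nt l) = x by exact: upd_same.
rewrite /rhoE dR_Rm /sqE dR_Rm -expr2 dR_Rd dR_Rm !dR_Rsum [dN h eta n_]/= Cn.
rewrite [dR _ _ h_]/= Ch; congr (_ * (_ / (_ * _)) ^+ 2).
  by apply: eq_bigr => j _; rewrite dR_Rm dR_Ra wE_sem !dE_sem e (updN _ li).
by apply: eq_bigr => j _; rewrite wE_sem e (updN _ li).
Qed.

Lemma rhoE_ok : okR X h eta (rhoE l i).
Proof.
have W t : (t < n)%N -> okR X h (upd eta l t) (wE i (Nt l)).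
  by move=> ts; apply: wE_ok; [exact: updok|by []|rewrite (updN _ li)].
have D1 t : (t < n)%N -> okR X h (upd eta l t) (dE i (Nt l)).
  by move=> ts; apply: dE_ok; [exact: updok|by []|rewrite (updN _ li)].
have D2 t : (t < n)%N -> okR X h (upd eta l t) (dE (Nt l) i).
  move=> ts; apply: dE_ok => //=; first exact: updok.
  by rewrite upd_same (leq_trans (ltnW ts)).
suff H : okR X h eta (Rd
  (Rsum l n_ (Rm (wE i (Nt l)) (Ra (dE i (Nt l)) (dE (Nt l) i))))
  (Rm h_ (Rsum l n_ (wE i (Nt l))))) by split.
split; [|split; first by []]; (split; [by []|by rewrite /= Cn|]);
  rewrite [dN _ _ n_]/= Cn => t tn.
  by split; [exact: W|split; [exact: D1|exact: D2]].
exact: W.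
Qed.

Lemma distE_sem : dR h eta (distE l a) = distn (hr h 3) (dN h eta a).
Proof.
rewrite /distE dR_Rsum [dN h eta k_]/= Ck; apply: eq_bigr => x _.
have e y : dN h (upd eta l y) (Nt l) = y by exact: upd_same.
rewrite /sqE dR_Rm dR_Rs GE_sem ?e ?(ltnW (ltn_ord x))//.
by rewrite [dR _ _ (Rr _ _)]/= upd_same (updN _ la) expr2.
Qed.

Lemma distE_ok : okR X h eta (distE l a).
Proof.
split; [by []|by rewrite /= Ck|]; rewrite [dN _ _ k_]/= Ck => x xk.
have G : okR X h (upd eta l x) (GE (l + 5) a (Nt l)).
  by apply: GE_ok => //=; rewrite ?upd_same ?(ltnW xk) ?updN//; exact: updok.
by split; split.
Qed.

Let ltN10 e : ltN l e -> ltN (l + 10) e.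
Proof. by apply: ltN_le; exact: leq_addr. Qed.
Let lt10 : (l < l + 10)%N. Proof. by lia. Qed.

Lemma estE_sem : dR h eta (estE l N i a) =
  estn (dN h eta N) (hn h 2) (dN h eta i) (dN h eta a).
Proof.
rewrite /estE dR_Ra dR_Rm dR_Rd !natE_sem; congr (_ + _ * _).
- rewrite dR_Rsum; apply: eq_bigr => j _; rewrite cE_sem.
  + by rewrite (updN _ li) (updN _ la) /= upd_same.
  + exact: ltN10.
  + exact: (Nt_lt lt10).
- by rewrite /= Cs Cn.
rewrite dR_Rsum [dN h eta s_]/= Cs; apply: eq_bigr => t _; rewrite dR_Rifn JS//.
rewrite [dN _ _ (Na _ _)]/= (updN _ li); case: ifP => // _.
rewrite cE_sem; first by rewrite YS// JS// (updN _ li) (updN _ la).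
  exact: ltN10.
by apply: YE_lt; [exact: ltN10|exact: Nt_lt].
Qed.

Lemma estE_ok : (forall j, (j < dN h eta i)%N -> (hn h 2 j <= X)%N) ->
  okR X h eta (estE l N i a).
Proof.
move=> Hx; split.
  split=> // j ji; apply: cE_ok; rewrite ?(updN _ li) ?(updN _ la) //; try exact: updok.
  - exact: ltN10.
  - exact: (Nt_lt lt10).
  - by rewrite /= upd_same; exact: Hx.
  - by rewrite /= upd_same; exact: leq_trans (ltnW ji) iX'.
split; first by split; split=> //=; rewrite ?Cn ?Cs.
split; [by []|by rewrite /= Cs|]; rewrite [dN _ _ s_]/= Cs => t ts; split=> //.
- by split=> //; exact: updok.
- exact: JO.
- apply: cE_ok; rewrite ?(updN _ li) ?(updN _ la) ?YS ?JS//; try exact: updok.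
  + exact: ltN10.
  + by apply: YE_lt; [exact: ltN10|exact: Nt_lt].
  + exact: YO.
  + exact: leq_trans (ltnW (Yn_lt _ _)) LX.
  + exact: JO.
  + exact: leq_trans (ltnW (Jn_lt _ _)) nX.
Qed.

End Var.
End Tables.
End WithCfg.
End Sem.

Definition K0_ := Nr 0 (Nc 3).
Definition P_ := Nr 0 (Nc 6).
Definition b_ := Nr 0 (Nc 11).
Definition rho_ := Rr 0 (Nc 9).
Definition upd11 := sN 8 0 (Nc 11) (Nt 7).
(** [b_] holds the best label so far, where a feasible label beats an infeasible one and the
    estimate decides between feasible ones. *)
Definition pSearch := Seq (sN 5 0 (Nc 11) (Nc 0)) (sFor 5 7 L_
  (sIfR 8 (distE 12 (Nt 7)) rho_
    (sIfR 8 (distE 12 b_) rho_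
      (sIfR 8 (estE 12 (Nt 1) (Nt 4) b_) (estE 12 (Nt 1) (Nt 4) (Nt 7)) Skip upd11)
      upd11)
    Skip)).
Definition pCtr := sFor 5 7 k_ (sR 8 3 (Nt 7) (ctrE 12 (Nt 1) (Nt 4) (Nt 7))).
Definition pRow := Seq pCtr (Seq (sR 5 0 (Nc 9) (rhoE 12 (Nt 4)))
  (Seq pSearch (sN 5 2 (Nt 4) b_))).
Definition pGreedy := sFor 2 4 n_ pRow.
Definition pBrute := sFor 2 4 n_ (sN 5 2 (Nt 4) (No (Nd (Nt 1) (Nr 6 (Nt 4))) L_)).
Definition pKeep := sIfR 2 (costE 10 3) (costE 10 2) Skip
  (sFor 2 4 n_ (sN 5 3 (Nt 4) (Nr 2 (Nt 4)))).
Definition pBody := Seq (sIfN 2 n_ K0_ pBrute pGreedy) pKeep.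
Definition pMain := sFor 0 1 P_ pBody.
Definition pOut := sFor 0 1 n_ (sFor 2 4 k_
  (sR 5 4 (Na (Nm (Nt 1) k_) (Nt 4)) (Rm h_ (GE 10 (Nr 3 (Nt 1)) (Nt 4))))).

Lemma setN_setN (R : realType) (h : hst R) al i v v' :
  setN (setN h al i v) al i v' = setN h al i v'.
Proof.
rewrite /setN /=; congr Hst; apply/funext => a; apply/funext => j.
by case: ((a == al) && (j == i)).
Qed.

Lemma estn_ext (R : realType) {n k Q} {inp : nat -> R} {hh s L} N x x' i a :
  (forall j, (j < i)%N -> x j = x' j) ->
  estn n k Q inp hh s L N x i a = estn n k Q inp hh s L N x' i a.
Proof.
by move=> H; rewrite /estn; congr (_ + _); apply: eq_bigr => j _; rewrite H.
Qed.

(** * The search over all guesses *)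

Section Main.
Variable R : realType.
Variable X : nat.
Hypothesis X_ge : (100 <= X)%N.
Variables (n k Q : nat) (inp : nat -> R) (hh : R) (s L P K0 : nat).
Implicit Types (h : hst R).
Local Notation cfg := (cfg n k Q inp hh).
Local Notation cn := (cn n k Q inp hh).
Local Notation costn := (costn n k Q inp hh).
Local Notation estn := (estn n k Q inp hh s L).
Local Notation ctrn := (ctrn n Q inp s L).
Local Notation rhon := (rhon n inp hh).
Local Notation distn := (@distn R k Q).

Hypothesis Q0 : (0 < Q)%N.
Hypothesis n0 : (0 < n)%N.
Hypothesis L0 : (0 < L)%N.
Hypothesis nX : (n <= X)%N.
Hypothesis kX : (k <= X)%N.
Hypothesis QX : (Q <= X)%N.
Hypothesis kQX : (k * Q <= X)%N.
Hypothesis LX : (L <= X)%N.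
Hypothesis PX : (P <= X)%N.

Definition brute := (n <= K0)%N.
Hypothesis sX : ~~ brute -> (s <= X)%N.

Definition cfg2 h : Prop := [/\ cfg h, hn h 0 3 = K0 /\ hn h 0 4 = s, hn h 0 5 = L /\ hn h 0 6 = P,
  (brute -> forall t, (t <= n)%N -> hn h 6 t = L ^ t)%N &
  (~~ brute -> forall t, (t <= s)%N -> hn h 5 t = n ^ t /\ hn h 6 t = L ^ t)%N].

Definition better N (c : nat -> R) rho (x : nat -> nat) i b a : Prop :=
  distn c a <= rho -> distn c b <= rho /\ estn N x i b <= estn N x i a.

Definition candS N (x : nat -> nat) : Prop := forall i, (i < n)%N ->
  (x i < L)%N /\ forall a, (a < L)%N -> better N (ctrn N i) (rhon i) x i (x i) a.

Definition cand N (x : nat -> nat) : Prop :=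
  if brute then forall i, (i < n)%N -> x i = ((N %/ L ^ i) %% L)%N else candS N x.

Lemma distn_ext c c' a : (forall x, (x < k)%N -> c x = c' x) -> distn c a = distn c' a.
Proof. by move=> H; apply: eq_bigr => x _; rewrite H. Qed.

Lemma better_ext N c c' rho x x' i b a : (forall y, (y < k)%N -> c y = c' y) ->
  (forall j, (j < i)%N -> x j = x' j) ->
  better N c rho x i b a -> better N c' rho x' i b a.
Proof.
move=> Hc Hx; rewrite /better -!(distn_ext _ Hc) => H /H[h1 h2].
by rewrite -!(estn_ext _ _ Hx).
Qed.

Section Sample.
Hypothesis nb : ~~ brute.
Variables (N i : nat) (eta : nat -> nat).
Hypothesis NX : (N <= X)%N.
Hypothesis iN : (i < n)%N.
Hypothesis eta1 : eta 1%N = N.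
Hypothesis eta4 : eta 4%N = i.

Lemma search_spec h : cfg2 h -> (forall j, (j < i)%N -> (hn h 2 j < L)%N) ->
  wp X 5 [:: 4; 1]%N eta 190 pSearch (fun h' => exists b, [/\ h' = setN h 0 11 b, (b < L)%N &
    forall a, (a < L)%N -> better N (hr h 3) (hr h 0 9%N) (hn h 2) i b a]) h.
Proof.
move=> C Hx.
apply: (@wp_seq _ _ X_ge _ _ _ _ 10 189) => //.
apply: wp_setN => //.
pose I m h' := exists b, [/\ h' = setN h 0 11 b, (b < L)%N &
    forall a, (a < m)%N -> better N (hr h 3) (hr h 0 9%N) (hn h 2) i b a].
have [C1 [_ Cs] [CL CP] _ Ct] := C.
have Cnp t : (t <= s)%N -> hn h 5 t = (n ^ t)%N by move=> /(Ct nb)[].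
have CLp t : (t <= s)%N -> hn h 6 t = (L ^ t)%N by move=> /(Ct nb)[].
apply: (@wp_for _ _ X_ge _ _ _ _ 180 _ _ _ I) => //.
- by rewrite /= CL.
- by exists 0%N.
- rewrite [dN _ _ L_]/= CL => m h' mL [b [-> bL Hb]].
  set h1 := setN h 0 11 b.
  set et := upd eta 7 m.
  have C1' : cfg h1 by exact: C1.
  have e1 : et 1%N = N by rewrite -eta1.
  have e4 : et 4%N = i by rewrite -eta4.
  have e7 : et 7%N = m by [].
  have eb : dN h1 et b_ = b by [].
  have mX : (m <= X)%N by exact: leq_trans (ltnW mL) LX.
  have bX : (b <= X)%N by exact: leq_trans (ltnW bL) LX.
  have Hx1 j : (j < dN h1 et (Nt 4))%N -> (hn h1 2 j <= X)%N.
    by rewrite /= e4 => /Hx H; exact: leq_trans (ltnW H) LX.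
  have iX : (dN h1 et (Nt 4) <= n)%N by rewrite /= e4 ltnW.
  have sd7 : dR h1 et (distE 12 (Nt 7)) = distn (hr h 3) m.
    by rewrite (distE_sem Q0 nX kX QX kQX C1').
  have sdb : dR h1 et (distE 12 b_) = distn (hr h 3) b.
    by rewrite (distE_sem Q0 nX kX QX kQX C1').
  have NX1 : (dN h1 et (Nt 1) <= X)%N by rewrite /= e1.
  have se7 : dR h1 et (estE 12 (Nt 1) (Nt 4) (Nt 7)) = estn N (hn h 2) i m.
    by rewrite (estE_sem Q0 nX kX QX kQX C1' (sX nb) LX n0 L0 Cs CL Cnp CLp)//= e1 e4.
  have seb : dR h1 et (estE 12 (Nt 1) (Nt 4) b_) = estn N (hn h 2) i b.
    by rewrite (estE_sem Q0 nX kX QX kQX C1' (sX nb) LX n0 L0 Cs CL Cnp CLp)//= e1 e4.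
  have odb : okR X h1 et (distE 12 b_) by apply: (distE_ok Q0 nX kX QX kQX C1').
  have od7 : okR X h1 et (distE 12 (Nt 7)) by apply: (distE_ok Q0 nX kX QX kQX C1').
  have oe7 : okR X h1 et (estE 12 (Nt 1) (Nt 4) (Nt 7)).
    by apply: (estE_ok Q0 nX kX QX kQX C1' (sX nb) LX n0 L0 Cs CL Cnp CLp).
  have oeb : okR X h1 et (estE 12 (Nt 1) (Nt 4) b_).
    by apply: (estE_ok Q0 nX kX QX kQX C1' (sX nb) LX n0 L0 Cs CL Cnp CLp).
  have upd : (forall a, (a < m.+1)%N -> better N (hr h 3) (hr h 0 9%N) (hn h 2) i m a) ->
      wp X 8 [:: 7; 4; 1]%N et 10 upd11 (I m.+1) h1.
    move=> Hm; apply: wp_setN => //=.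
    by exists m; split=> //; rewrite /h1 setN_setN.
  have keep : (forall a, (a < m.+1)%N -> better N (hr h 3) (hr h 0 9%N) (hn h 2) i b a) ->
      I m.+1 h1.
    by move=> Hm; exists b; split.
  apply: (@wp_ifR _ _ X_ge _ _ _ _ 176) => //.
  rewrite sd7 [dR _ _ rho_]/=.
  case: ifP => fm; last first.
    apply: wp_skip => //; apply: keep => a; rewrite ltnS leq_eqVlt => /predU1P[->|/Hb//].
    by rewrite /better fm.
  apply: (@wp_ifR _ _ X_ge _ _ _ _ 172) => //.
  rewrite sdb [dR _ _ rho_]/=.
  (* If the best label so far is infeasible, the invariant says that no earlier label is feasible,
     so a feasible [m] takes over. *)
  case: ifP => fb; last first.
    apply: (wp_mono X_ge (g := 10) (P := I m.+1)) => //; apply: upd => a.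
    rewrite ltnS leq_eqVlt => /predU1P[->|am fa]; first by [].
    by have [] := Hb _ am fa; rewrite fb.
  apply: (@wp_ifR _ _ X_ge _ _ _ _ 168) => //.
  rewrite seb se7; case: ifP => eb7.
    apply: wp_skip => //; apply: keep => a; rewrite ltnS leq_eqVlt => /predU1P[->|/Hb//].
    by move=> _; split.
  apply: (wp_mono X_ge (g := 10) (P := I m.+1)) => //; apply: upd => a.
  rewrite ltnS leq_eqVlt => /predU1P[->|am fa]; first by [].
  have [_ ea] := Hb _ am fa; split=> //; apply: le_trans ea.
  by rewrite ltW// ltNge eb7.
- by rewrite [dN _ _ L_]/= CL.
Qed.

Lemma row_spec h : cfg2 h -> (forall j, (j < i)%N -> (hn h 2 j < L)%N) ->
  wp X 5 [:: 4; 1]%N eta 196 pRow (fun h' => [/\ cfg2 h', hn h' 3 = hn h 3 &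
    exists b, [/\ forall j, hn h' 2 j = if j == i then b else hn h 2 j, (b < L)%N &
    forall a, (a < L)%N -> better N (ctrn N i) (rhon i) (hn h 2) i b a]]) h.
Proof.
move=> C Hx.
apply: (@wp_seq _ _ X_ge _ _ _ _ 194 195) => //.
pose I m h' := [/\ cfg2 h', hn h' = hn h &
   forall x, (x < m)%N -> hr h' 3 x = ctrn N i x].
have [C1 [_ Cs] [CL CP] _ Ct] := C.
have Ck : hn h 1 0 = k by case: C1.
apply: (@wp_for _ _ X_ge _ _ _ _ 180 _ _ _ I) => //.
- by rewrite /= Ck.
- rewrite [dN _ _ k_]/= Ck => m h1 mk [C1' E1 H1].
  have [C2 [_ Cs1] [CL1 _] _ Ct1] := C1'.
  have Cnp t : (t <= s)%N -> hn h1 5 t = (n ^ t)%N by move=> /(Ct1 nb)[].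
  have CLp t : (t <= s)%N -> hn h1 6 t = (L ^ t)%N by move=> /(Ct1 nb)[].
  set et := upd eta 7 m.
  have e1 : et 1%N = N by rewrite -eta1.
  have e4 : et 4%N = i by rewrite -eta4.
  apply: wp_setR => //.
    apply: (ctrE_ok Q0 nX kX QX kQX C2 (sX nb) LX n0 L0 Cs1 CL1 Cnp CLp) => //=.
    + by rewrite e1.
    + by rewrite e4 ltnW.
    + by rewrite ltnW.
  rewrite (ctrE_sem Q0 nX kX QX kQX C2 Cs1 CL1 Cnp CLp)//=; last by rewrite ltnW.
  rewrite e1 e4 /et upd_same; split=> //.
  move=> x; rewrite ltnS leq_eqVlt => /predU1P[->|xm] /=; first by rewrite eqxx.
  by rewrite ltn_eqF// H1.
rewrite [dN _ _ k_]/= Ck => h1 [C1' E1 H1].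
have [C2 _ _ _ _] := C1'.
apply: (@wp_seq _ _ X_ge _ _ _ _ 150 194) => //.
have iXn : (dN h1 eta (Nt 4) <= n)%N by rewrite /= eta4 ltnW.
apply: wp_setR => //.
  by apply: (rhoE_ok Q0 nX kX QX kQX C2).
rewrite (rhoE_sem Q0 nX kX QX kQX C2)//= eta4.
set h2 := setR h1 0 9 (rhon i).
apply: (@wp_seq _ _ X_ge _ _ _ _ 190 193) => //.
have C2' : cfg2 h2 by exact: C1'.
apply: (wp_mono X_ge (leqnn _) _ (search_spec C2' _)); last first.
  by move=> j ji; rewrite /= E1; exact: Hx.
move=> h3 [b [-> bL Hb]].
apply: wp_setN => //; rewrite [dN _ _ b_]/= [dN _ _ _]/= eta4.
split; [exact: C1'|by rewrite /= -E1|].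
exists b; split=> // [j|a aL]; first by rewrite /= E1.
by have := Hb a aL; rewrite /= E1; apply: better_ext => // y yk.
Qed.

End Sample.

(** What is established for an index survives the later rounds: its estimate reads only the labels
    before it, and the sampled mean depends on the guess alone. *)
Lemma greedy_spec h N eta : ~~ brute -> (N <= X)%N -> eta 1%N = N -> cfg2 h ->
  wp X 2 [:: 1]%N eta 204 pGreedy (fun h' => [/\ cfg2 h', hn h' 3 = hn h 3 &
    candS N (hn h' 2)]) h.
Proof.
move=> nb NX e1 C.
pose I m h' := [/\ cfg2 h', hn h' 3 = hn h 3 &
  forall i, (i < m)%N -> (i < n)%N -> (hn h' 2 i < L)%N /\
    forall a, (a < L)%N -> better N (ctrn N i) (rhon i) (hn h' 2) i (hn h' 2 i) a].
have Cn : hn h 0 0 = n by case: C => [[]].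
apply: (@wp_for _ _ X_ge _ _ _ _ 197 _ _ _ I) => //.
- by rewrite /= Cn.
- rewrite [dN _ _ n_]/= Cn => i h1 iN [C1 E1 H1].
  apply: (wp_mono X_ge (g := 196) _ _ (row_spec nb (N := N) NX iN _ _ C1 _)) => //.
  + move=> h2 [C2 E2 [b [Hj bL Hb]]]; split=> //; first by rewrite E2.
    move=> i'; rewrite ltnS leq_eqVlt => /predU1P[->|im] i'N.
      rewrite Hj eqxx; split=> // a aL; have := Hb a aL.
      by apply: better_ext => // j ji; rewrite Hj ltn_eqF.
    rewrite Hj ltn_eqF//; have [h3 h4] := H1 _ im i'N; split=> // a aL.
    have := h4 a aL; apply: better_ext => // j ji.
    by rewrite Hj ltn_eqF// (ltn_trans ji).
  + by move=> j ji; case: (H1 j ji (ltn_trans ji iN)).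
- rewrite [dN _ _ n_]/= Cn => h1 [C1 E1 H1]; split=> // i iN.
  exact: H1.
Qed.

Lemma brute_spec h N eta : brute -> (N <= X)%N -> eta 1%N = N -> cfg2 h ->
  wp X 2 [:: 1]%N eta 204 pBrute (fun h' => [/\ cfg2 h', hn h' 3 = hn h 3 &
    forall i, (i < n)%N -> hn h' 2 i = ((N %/ L ^ i) %% L)%N]) h.
Proof.
move=> br NX e1 C.
pose I m h' := [/\ cfg2 h', hn h' 3 = hn h 3 &
  forall i, (i < m)%N -> hn h' 2 i = ((N %/ L ^ i) %% L)%N].
have Cn : hn h 0 0 = n by case: C => [[]].
apply: (@wp_for _ _ X_ge _ _ _ _ 100 _ _ _ I) => //.
- by rewrite /= Cn.
- rewrite [dN _ _ n_]/= Cn => i h1 iN [C1 E1 H1].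
  have [C2 _ [CL _] Ct _] := C1.
  have e : upd eta 4 i 1%N = N by rewrite -e1.
  have Li : hn h1 6 i = (L ^ i)%N by exact: Ct (ltnW iN).
  apply: wp_setN => //=.
    rewrite e CL /upd /= Li; split=> //; first by split=> //; rewrite expn_gt0 L0.
    by rewrite (leq_trans (leq_div _ _)).
  split=> // j /=; rewrite ltnS e CL /upd /= Li.
  by rewrite leq_eqVlt => /predU1P[->|ji]; [rewrite eqxx|rewrite ltn_eqF// H1].
- by rewrite [dN _ _ n_]/= Cn => h1 [].
Qed.

Lemma cand_lt N x i : cand N x -> (i < n)%N -> (x i < L)%N.
Proof.
rewrite /cand; case: ifP => _ H iN; first by rewrite H// ltn_mod.
by case: (H i iN).
Qed.

Lemma keep_spec h N eta : cfg2 h -> cand N (hn h 2) ->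
  (forall i, (i < n)%N -> (hn h 3 i < L)%N) ->
  wp X 2 [:: 1]%N eta 200 pKeep (fun h' => [/\ cfg2 h',
    forall i, (i < n)%N -> (hn h' 3 i < L)%N,
    costn (hn h' 3) <= costn (hn h 3) & costn (hn h' 3) <= costn (hn h 2)]) h.
Proof.
move=> C Hc Hb; have [C1 _ _ _ _] := C; have Cn : hn h 0 0 = n by case: C1.
apply: (@wp_ifR _ _ X_ge _ _ _ _ 100) => //.
- apply: (costE_ok Q0 nX kX QX kQX C1) => // i iN.
  exact: leq_trans (ltnW (Hb i iN)) LX.
- apply: (costE_ok Q0 nX kX QX kQX C1) => // i iN.
  exact: leq_trans (ltnW (cand_lt Hc iN)) LX.
rewrite !(costE_sem Q0 nX kX QX kQX C1)//; case: ifP => H; first by apply: wp_skip => //; split.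
pose I m h' := [/\ cfg2 h', hn h' 2 = hn h 2 &
   forall i, (i < m)%N -> hn h' 3 i = hn h 2 i].
apply: (@wp_for _ _ X_ge _ _ _ _ 20 _ _ _ I) => //.
- by rewrite /= Cn.
- rewrite [dN _ _ n_]/= Cn => i h1 iN [C1' E1 H1].
  apply: wp_setN => //=; split=> // j; rewrite ltnS /= /upd /=.
  by rewrite leq_eqVlt => /predU1P[->|ji]; rewrite ?eqxx ?ltn_eqF// ?E1// H1.
- rewrite [dN _ _ n_]/= Cn => h1 [C1' E1 H1].
  have e : costn (hn h1 3) = costn (hn h 2).
    by apply: eq_bigr => i _; apply: eq_bigr => j _; rewrite !H1.
  split=> //; first by move=> i iN; rewrite H1//; exact: cand_lt Hc iN.
    by rewrite e ltW// ltNge H.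
  by rewrite e.
Qed.

(** Several labellings may be greedy for the same guess. The one computed is not specified further,
    hence the existential; the analysis holds for each of them. *)
Lemma main_spec h eta : cfg2 h -> (forall i, (i < n)%N -> (hn h 3 i < L)%N) ->
  wp X 0 [::] eta 220 pMain (fun h' => [/\ cfg2 h', forall i, (i < n)%N -> (hn h' 3 i < L)%N &
    forall N, (N < P)%N -> exists2 x, cand N x & costn (hn h' 3) <= costn x]) h.
Proof.
move=> C Hb.
pose I m h' := [/\ cfg2 h', forall i, (i < n)%N -> (hn h' 3 i < L)%N &
    forall N, (N < m)%N -> exists2 x, cand N x & costn (hn h' 3) <= costn x].
have CP : hn h 0 6 = P by case: C => _ _ [].
apply: (@wp_for _ _ X_ge _ _ _ _ 212 _ _ _ I) => //.
- by rewrite /= CP.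
- rewrite [dN _ _ P_]/= CP => N h1 NP [C1 B1 H1].
  have NX : (N <= X)%N by exact: leq_trans (ltnW NP) PX.
  have e1 : upd eta 1 N 1%N = N by [].
  apply: (@wp_seq _ _ X_ge _ _ _ _ 209 210) => //.
  have Cn : hn h1 0 0 = n by case: C1 => [[]].
  have CK : hn h1 0 3 = K0 by case: C1 => _ [].
  apply: (@wp_ifN _ _ X_ge _ _ _ _ 205) => //; rewrite [dN _ _ n_]/= [dN _ _ K0_]/= Cn CK.
  have K h2 : cfg2 h2 -> hn h2 3 = hn h1 3 -> cand N (hn h2 2) ->
      wp X 2 [:: 1]%N (upd eta 1 N) 210 pKeep (I N.+1) h2.
    move=> C2 E2 Hc; have B2 i : (i < n)%N -> (hn h2 3 i < L)%N by rewrite E2; exact: B1.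
    have KS := @keep_spec h2 N (upd eta 1 N) C2 Hc B2.
    apply: (wp_mono X_ge (g := 200) _ _ KS) => // h3 [C3 B3 c1 c2].
    split=> // N'; rewrite ltnS leq_eqVlt => /predU1P[->|NN].
      by exists (hn h2 2).
    by have [x cx lx] := H1 _ NN; exists x => //; apply: le_trans lx; rewrite -E2.
  rewrite -/brute; case: ifPn => br.
    apply: (wp_mono X_ge (g := 204) _ _ (brute_spec br NX e1 C1)) => // h2 [C2 E2 H2].
    by apply: K => //; rewrite /cand br.
  apply: (wp_mono X_ge (g := 204) _ _ (greedy_spec br NX e1 C1)) => // h2 [C2 E2 H2].
  by apply: K => //; rewrite /cand (negbTE br).
- by rewrite [dN _ _ P_]/= CP.
Qed.

Lemma out_spec h eta : (0 < k)%N -> cfg2 h -> (forall i, (i < n)%N -> (hn h 3 i < L)%N) ->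
  wp X 0 [::] eta 140 pOut (fun h' => hn h' = hn h /\
    forall i l, (i < n)%N -> (l < k)%N ->
      hr h' 4 (i * k + l)%N = hh * (dig Q (hn h 3 i) l)%:R) h.
Proof.
move=> k0 C Hb; have [C1 _ _ _ _] := C.
have Cn : hn h 0 0 = n by case: C1.
have Ck : hn h 1 0 = k by case: C1.
pose J i l h' := [/\ cfg2 h', hn h' = hn h &
   forall i' l', (i' < n)%N -> (l' < k)%N -> (i' * k + l' < i * k + l)%N ->
      hr h' 4 (i' * k + l')%N = hh * (dig Q (hn h 3 i') l')%:R].
apply: (@wp_for _ _ X_ge _ _ _ _ 130 _ _ _ (fun i => J i 0%N)) => //.
- by rewrite /= Cn.
- rewrite [dN _ _ n_]/= Cn => i h1 iN J1.
  have Ck1 : hn h1 1 0 = k by case: J1 => [[[]]].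
  apply: (@wp_for _ _ X_ge _ _ _ _ 100 _ _ _ (J i)) => //.
  + by rewrite /= Ck1.
  + rewrite [dN _ _ k_]/= Ck1 => l h2 lk [C2 E2 H2].
    have [C2' _ _ _ _] := C2.
    have hbX : (hn h2 3 i <= X)%N by rewrite E2; exact: leq_trans (ltnW (Hb i iN)) LX.
    have lk' : (l <= k)%N by exact: ltnW.
    apply: wp_setR => //.
    * by split=> //; split=> //=; rewrite /upd /= (leq_trans (ltnW iN)).
    * by split=> //; apply: (GE_ok Q0 QX C2').
    * rewrite dR_Rm (GE_sem C2')// [dR _ _ h_]/= [dN _ _ _]/= [dN _ _ _]/= [dN _ _ (Nt 4)]/=.
      have Ck2 : hn h2 1 0 = k by case: C2'.
      have Ch2 : hr h2 0 2 = hh by case: C2'.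
      rewrite /upd /= Ck2 Ch2; split=> // i' l' i'N l'k; rewrite addnS ltnS leq_eqVlt /=.
      case: eqP => [e _|_ /= lt]; last exact: H2.
      have ei : i' = i by have := e; nia.
      have el : l' = l by have := e; rewrite ei; lia.
      by rewrite ei el E2.
  + rewrite [dN _ _ k_]/= Ck1 => h2 [C2 E2 H2]; split=> // i' l' a b c; apply: H2 => //.
    by move: c; rewrite mulSn; lia.
- rewrite [dN _ _ n_]/= Cn => h1 [C2 E2 H2]; split=> // i l iN lk; apply: H2 => //.
  by nia.
Qed.

End Main.

Definition dmin_ := Rr 0 (Nc 0).
Definition dmax_ := Rr 0 (Nc 1).
Definition eps_ := Rr 1 (Nc 0).
Definition q_ := Nr 0 (Nc 2).
Definition pw_ := Nr 0 (Nc 7).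
Definition dij_ := dE (Nt 1) (Nt 4).
Definition pMin := sIfR 5 dmin_ dij_ Skip (sR 5 0 (Nc 0) dij_).
Definition pMax := sIfR 5 dij_ dmax_ Skip (sR 5 0 (Nc 1) dij_).
Definition pMM := sFor 0 1 n_ (sFor 2 4 n_ (sIfN 5 (Nt 1) (Nt 4)
  (sIfN 5 (Nt 4) (Nt 1) Skip (Seq pMin pMax)) (Seq pMin pMax))).
Definition hE := Rd (Rm eps_ dmin_) (Rm (Rc 32) (natE 10 k_)).
Definition QE := Rd (Rm (Rm (Rc 600) (sqE (natE 10 k_))) dmax_) (Rm dmin_ (sqE eps_)).
(** 3 * 10^10: the square of the ratio 10^5 of [eps] to [eta], times the 3 in [Gam = 3 q k]. *)
Definition c1E := Rm (Rc 3) (Rm (Rc 100) (Rm (Rc 100) (Rm (Rc 100) (Rm (Rc 100) (Rc 100))))).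
(** [delta] is not part of the input. By regularity, it is recovered as the sum of row 0 of [w]
    divided by [n]. *)
Definition KE := Rd (Rm c1E (Rm (natE 20 k_)
  (sqE (Rd (natE 20 n_) (Rsum 20 n_ (wE (Nc 0) (Nt 20))))))) (sqE eps_).
Definition pLog := Seq (sN 0 0 (Nc 2) (Nc 0)) (Seq (sN 0 0 (Nc 7) (Nc 1))
  (sFor 0 1 Q_ (sIfN 2 Q_ pw_ Skip
    (Seq (sN 2 0 (Nc 7) (Na pw_ pw_)) (sN 2 0 (Nc 2) (Na q_ (Nc 1))))))).
Definition pPow al b m := Seq (sN 0 al (Nc 0) (Nc 1))
  (sFor 0 1 m (sN 2 al (Na (Nt 1) (Nc 1)) (Nm (Nr al (Nt 1)) b))).
Definition pTab := sIfN 0 n_ K0_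
  (Seq (pPow 6 L_ n_) (sN 0 0 (Nc 6) (Nr 6 n_)))
  (Seq (pPow 5 n_ s_) (Seq (pPow 6 L_ s_) (sN 0 0 (Nc 6) (Nm (Nr 5 s_) (Nr 6 s_))))).
Definition pSetup :=
  Seq (sR 0 0 (Nc 0) (Rr 1 (Nc 2))) (Seq (sR 0 0 (Nc 1) (Rr 1 (Nc 2)))
  (Seq pMM (Seq (sR 0 0 (Nc 2) hE) (Seq (sCeil 0 0 (Nc 1) QE) (Seq pLog
  (Seq (sCeil 0 0 (Nc 3) KE) (Seq (sN 0 0 (Nc 4) (Nm q_ K0_))
  (Seq (pPow 4 Q_ k_) (Seq (sN 0 0 (Nc 5) (Nr 4 k_)) pTab))))))))).

(** * Extremal distances, sizes and tables of powers *)

Section Setup.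
Variable R : realType.
Variable X : nat.
Hypothesis X_ge : (100 <= X)%N.
Variables (n k Q q K0 : nat) (inp : nat -> R) (dmin dmax : R).
Implicit Types (h : hst R).
Let eps := inp 0%N.
Let c1 : R := 3 * (100 * (100 * (100 * (100 * 100)))).
Let hh := eps * dmin / (32 * k%:R).
Let L := (Q ^ k)%N.
Let s := (q * K0)%N.
Let br := (n <= K0)%N.
Let P := (if br then L ^ n else n ^ s * L ^ s)%N.
Let xQ : R := 600 * k%:R ^+ 2 * dmax / (dmin * eps ^+ 2).
Let xK : R := c1 * (k%:R * (n%:R / \sum_(j < n) wwn n inp 0%N j) ^+ 2) / eps ^+ 2.
Hypothesis n2 : (1 < n)%N.
Hypothesis Q0 : (0 < Q)%N.
Hypothesis qE : q = up_log 2 Q.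
Hypothesis xQ0 : 0 <= xQ.
Hypothesis HQ : xQ <= Q%:R < xQ + 1.
Hypothesis xK0 : 0 <= xK.
Hypothesis HK : xK <= K0%:R < xK + 1.
Hypothesis dd_off : forall i j, (i < n)%N -> (j < n)%N -> i != j ->
  dmin <= ddn n inp i j <= dmax.
Hypothesis dmin_at : exists i j, [/\ (i < n)%N, (j < n)%N, i != j & ddn n inp i j = dmin].
Hypothesis dmax_at : exists i j, [/\ (i < n)%N, (j < n)%N, i != j & ddn n inp i j = dmax].
Hypothesis nX : (n <= X)%N.
Hypothesis kX : (k <= X)%N.
Hypothesis QX : (Q <= X)%N.
Hypothesis qX : (q <= X)%N.
Hypothesis KX : (K0 <= X)%N.
Hypothesis LX : (L <= X)%N.
Hypothesis sX : ~~ br -> (s <= X)%N.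
Hypothesis PX : (P <= X)%N.

Lemma nat_ceil_uniq (x : R) (a b : nat) : x <= a%:R < x + 1 -> x <= b%:R < x + 1 -> a = b.
Proof.
move=> /andP[a1 a2] /andP[b1 b2].
have : a%:R < b%:R + 1 :> R by lra.
have : b%:R < a%:R + 1 :> R by lra.
by rewrite !natr1 !ltr_nat; clear; lia.
Qed.

Definition base h : Prop := [/\ hn h 0 0 = n, hn h 1 0 = k, hr h 1 = inp &
  forall i, hn h 3 i = 0%N].

Definition att (m : R) := exists i j, [/\ (i < n)%N, (j < n)%N, i != j & ddn n inp i j = m].

(** The two cells always hold off-diagonal entries, hence lie between [dmin] and [dmax]. Once they
    bound every off-diagonal pair, equality follows by antisymmetry. *)
Lemma mm_spec h eta : base h -> att (hr h 0 0%N) -> att (hr h 0 1%N) ->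
  wp X 0 [::] eta 80 pMM (fun h' => [/\ base h', hr h' 0 0%N = dmin & hr h' 0 1%N = dmax]) h.
Proof.
move=> B A0 A1.
pose J i j h' := [/\ base h', att (hr h' 0 0%N), att (hr h' 0 1%N) &
  forall i' j', (i' < n)%N -> (j' < n)%N -> (i' * n + j' < i * n + j)%N -> i' != j' ->
    hr h' 0 0%N <= ddn n inp i' j' <= hr h' 0 1%N].
have Cn : hn h 0 0 = n by case: B.
apply: (@wp_for _ _ X_ge _ _ _ _ 70 _ _ _ (fun i => J i 0%N)) => //.
- by rewrite /= Cn.
- rewrite [dN _ _ n_]/= Cn => i h1 iN J1.
  have Cn1 : hn h1 0 0 = n by case: J1 => [[]].
  apply: (@wp_for _ _ X_ge _ _ _ _ 60 _ _ _ (J i)) => //.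
  + by rewrite /= Cn1.
  + rewrite [dN _ _ n_]/= Cn1 => j h2 jn [B2 A2 A2' H2].
    set et := upd (upd eta 1 i) 4 j.
    have e1 : et 1%N = i by []. have e4 : et 4%N = j by [].
    have split_lt i' j' : (i' < n)%N -> (j' < n)%N -> (i' * n + j' < i * n + j.+1)%N ->
        (i' * n + j' < i * n + j)%N \/ (i' = i /\ j' = j).
      move=> i'n j'n; rewrite addnS ltnS leq_eqVlt => /orP[/eqP e|->]; last by left.
      right; have ei : i' = i by have := e; nia.
      by split=> //; have := e; rewrite ei; lia.
    have U : i != j -> wp X 5 [:: 4; 1]%N et 50 (Seq pMin pMax) (J i j.+1) h2.
      move=> ij.
      have dsem h' : base h' -> dR h' et dij_ = ddn n inp i j.
        by case=> c1' c2 c3 _; rewrite /= c3 c1'.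
      have dok h' : base h' -> okR X h' et dij_.
        by case=> c1' c2 c3 _; split=> //; split=> //=; split=> //; rewrite e1 (leq_trans (ltnW iN)).
      have dat : att (ddn n inp i j) by exists i, j.
      apply: (@wp_seq _ _ X_ge _ _ _ _ 48 49) => //.
      pose J' h' := [/\ base h', att (hr h' 0 0%N), att (hr h' 0 1%N) &
         hr h' 0 0%N <= ddn n inp i j /\
         (forall i' j', (i' < n)%N -> (j' < n)%N -> (i' * n + j' < i * n + j)%N -> i' != j' ->
           hr h' 0 0%N <= ddn n inp i' j' <= hr h' 0 1%N)].
      have K h3 : J' h3 -> wp X 5 [:: 4; 1]%N et 49 pMax (J i j.+1) h3.
        move=> [B3 A3 A3' [H3 H3']].
        apply: (@wp_ifR _ _ X_ge _ _ _ _ 40) => //; first exact: dok.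
        rewrite dsem// [dR _ _ dmax_]/=; case: ifP => mx.
          apply: wp_skip => //; split=> // i' j' i'n j'n lt ne.
          have [lt'|[-> ->]] := split_lt _ _ i'n j'n lt; first exact: H3'.
          by rewrite H3 mx.
        apply: wp_setR => //; first exact: dok.
        rewrite dsem//; split=> //= i' j' i'n j'n lt ne.
        have [lt'|[-> ->]] := split_lt _ _ i'n j'n lt; last by rewrite H3 lexx.
        have /andP[-> h4] := H3' _ _ i'n j'n lt' ne; apply: (le_trans h4).
        by rewrite ltW// ltNge mx.
      apply: (@wp_ifR _ _ X_ge _ _ _ _ 40) => //; first exact: dok.
      rewrite dsem// [dR _ _ dmin_]/=; case: ifP => mn.
        by apply: wp_skip => //; apply: K; split.
      apply: wp_setR => //; first exact: dok.
      rewrite dsem//; apply: K; split=> //=; split=> //= i' j' i'n j'n lt ne.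
      have /andP[h4 ->] := H2 _ _ i'n j'n lt ne; rewrite andbT; apply: le_trans h4.
      by rewrite ltW// ltNge mn.
    apply: (@wp_ifN _ _ X_ge _ _ _ _ 55) => //=; rewrite -/et.
    case: ifP => ij; last first.
      by apply: (wp_mono X_ge (g := 50) (P := J i j.+1)) => //; apply: U; move: ij; rewrite e1 e4; lia.
    apply: (@wp_ifN _ _ X_ge _ _ _ _ 51) => //=; rewrite -/et.
    case: ifP => ji; last first.
      by apply: (wp_mono X_ge (g := 50) (P := J i j.+1)) => //; apply: U; move: ji; rewrite e1 e4; lia.
    apply: wp_skip => //; split=> // i' j' i'n j'n lt ne.
    have [lt'|[ei ej]] := split_lt _ _ i'n j'n lt; first exact: H2.
    by move: ij ji ne; rewrite e1 e4 ei ej; lia.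
  + rewrite [dN _ _ n_]/= Cn1 => h2 [B2 A2 A2' H2]; split=> // i' j' a b c; apply: H2 => //.
    by move: c; rewrite mulSn; lia.
- rewrite [dN _ _ n_]/= Cn => h1 [B1 [i [j [iN jn ij e1]]] [i' [j' [i'n j'n ij' e2]]] H1].
  have lt a b : (a < n)%N -> (b < n)%N -> (a * n + b < n * n + 0)%N by nia.
  split=> //.
    have [a [b [an bn ab e]]] := dmin_at.
    have /andP[h1' _] := H1 _ _ an bn (lt _ _ an bn) ab.
    have /andP[h2 _] := dd_off iN jn ij.
    by apply/eqP; rewrite eq_le -{1}e h1' -e1 h2.
  have [a [b [an bn ab e]]] := dmax_at.
  have /andP[_ h1'] := H1 _ _ an bn (lt _ _ an bn) ab.
  have /andP[_ h2] := dd_off i'n j'n ij'.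
  by apply/eqP; rewrite eq_le -{2}e h1' -e2 h2.
Qed.

(** The exponent stops growing once its power of 2 reaches [Q], and [Q] rounds are enough because Q
    < 2^Q. *)
Lemma log_spec h eta : hn h 0 1 = Q ->
  wp X 0 [::] eta 60 pLog (fun h' => exists p, h' = setN (setN h 0 2 q) 0 7 p) h.
Proof.
move=> CQ.
apply: (@wp_seq _ _ X_ge _ _ _ _ 10 59) => //; apply: wp_setN => //.
apply: (@wp_seq _ _ X_ge _ _ _ _ 10 58) => //; apply: wp_setN => //.
rewrite [dN _ _ _]/= [dN _ _ _]/= [dN _ _ _]/= [dN _ _ _]/=.
pose I v h' := exists q', [/\ h' = setN (setN h 0 2 q') 0 7 (2 ^ q'), (q' <= up_log 2 Q)%N &
  (Q <= 2 ^ q')%N \/ q' = v].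
apply: (@wp_for _ _ X_ge _ _ _ _ 40 _ _ _ I) => //.
- by rewrite /= CQ.
- by exists 0%N; split=> //; right.
- rewrite [dN _ _ Q_]/= CQ => v h1 vQ [q' [-> q'l H]].
  apply: (@wp_ifN _ _ X_ge _ _ _ _ 30) => //.
  rewrite [dN _ _ Q_]/= CQ [dN _ _ pw_]/=; case: ifP => le.
    by apply: wp_skip => //; exists q'; split=> //; left.
  apply: (@wp_seq _ _ X_ge _ _ _ _ 20 20) => //; apply: wp_setN => //.
  apply: wp_setN => //=; exists q'.+1; split.
  + rewrite /setN /=; congr Hst; apply/funext => a; apply/funext => j /=.
    rewrite addn1 expnS mul2n addnn.
    case: eqP => //= _; case: eqP => [->//|_]; case: eqP => //.
  + rewrite ltnNge; apply/negP => h1'; move/negbT: le; rewrite -ltnNge => le.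
    have := up_logP Q (isT : (1 < 2)%N).
    have : (2 ^ up_log 2 Q <= 2 ^ q')%N by rewrite leq_exp2l.
    by move: le; lia.
  + by case: H => [H|->]; [rewrite H in le|right].
- rewrite [dN _ _ Q_]/= CQ => h1 [q' [-> q'l H]].
  have : (Q <= 2 ^ q')%N by case: H => // ->; rewrite ltnW// ltn_expl.
  move=> H'; have : (up_log 2 Q <= q')%N by exact: up_log_min.
  move=> H''; have -> : q' = q by rewrite qE; apply/eqP; rewrite eqn_leq q'l.
  by exists (2 ^ q)%N.
Qed.

Lemma pow_spec h eta al b m bv mv : (al < 7)%N ->
  (exists be c, b = Nr be (Nc c) /\ [&& be != al & (be < 7)%N]) ->
  (exists be c, m = Nr be (Nc c) /\ [&& be != al & (be < 7)%N]) ->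
  dN h eta b = bv -> dN h eta m = mv -> (mv <= X)%N ->
  (forall v, (v <= mv)%N -> (bv ^ v <= X)%N) ->
  wp X 0 [::] eta 60 (pPow al b m) (fun h' => [/\ hr h' = hr h,
    forall al', al' != al -> hn h' al' = hn h al' &
    forall v, (v <= mv)%N -> hn h' al v = (bv ^ v)%N]) h.
Proof.
move=> al7 [be [c [-> /andP[bal b7]]]] [be' [c' [-> /andP[bal' b7']]]] Eb Em mX pX.
apply: (@wp_seq _ _ X_ge _ _ _ _ 10 59) => //; apply: wp_setN => //; first by rewrite /= al7.
rewrite [dN _ _ _]/= [dN _ _ _]/=; set h1 := setN h al 0 1.
pose I v h' := [/\ hr h' = hr h, forall al', al' != al -> hn h' al' = hn h al' &
    forall v', (v' <= v)%N -> hn h' al v' = (bv ^ v')%N].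
have E1 : dN h1 eta (Nr be' (Nc c')) = mv by rewrite /= (negbTE bal') /= -Em.
apply: (@wp_for _ _ X_ge _ _ _ _ 40 _ _ _ I) => //.
- by rewrite /= b7'.
- by rewrite E1.
- split=> // [al' ne|v']; first by apply/funext => j /=; rewrite (negbTE ne).
  by rewrite leqn0 => /eqP ->; rewrite /= !eqxx.
- rewrite E1 => v h2 vm [r2 f2 H2].
  have Eb2 : hn h2 be c = bv by rewrite f2.
  apply: wp_setN => //.
  + by rewrite /= al7 b7.
  + by split=> //=; rewrite upd_same H2// pX// ltnW.
  + rewrite /= upd_same addn1 Eb2 H2//; split=> //.
    * move=> al' ne /=; apply/funext => j; rewrite (negbTE ne) /=.
      by rewrite f2.
    * move=> v' /=; rewrite leq_eqVlt eqxx => /orP[/eqP ->|v'v] /=.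
        by rewrite eqxx expnSr.
      by rewrite ltn_eqF// H2.
- by rewrite E1 => h2 [r2 f2 H2]; split.
Qed.

Lemma tab_spec h eta : base h -> cfg n k Q inp hh h -> hn h 0 3 = K0 -> hn h 0 4 = s ->
  hn h 0 5 = L ->
  wp X 0 [::] eta 80 pTab (fun h' => cfg2 n k Q inp hh s L P K0 h' /\
    forall i, hn h' 3 i = 0%N) h.
Proof.
move=> B C CK Cs CL; have [Cn Ck Cr C3] := B; have [_ _ CQ Ch [Ci CQp]] := C.
have L0 : (0 < L)%N by rewrite expn_gt0 Q0.
have nn0 : (0 < n)%N by exact: ltnW.
apply: (@wp_ifN _ _ X_ge _ _ _ _ 70) => //; rewrite [dN _ _ n_]/= [dN _ _ K0_]/= Cn CK.
rewrite -/br; case: ifPn => Hb.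
  apply: (@wp_seq _ _ X_ge _ _ _ _ 60 69) => //.
  have PE : P = (L ^ n)%N by rewrite /P Hb.
  apply: (wp_mono X_ge (leqnn _) _ (@pow_spec h eta 6 L_ n_ L n _ _ _ _ _ _ _)) => //.
  - move=> h1 [r1 f1 H1]; apply: wp_setN => //.
    rewrite [dN _ _ _]/= [dN _ _ _]/= (f1 0%N)// Cn H1//.
    split; last by move=> i; rewrite /= (f1 3%N).
    split=> //.
    + split; rewrite /= ?(f1 0%N) ?(f1 1%N) ?r1//.
      by split=> //; rewrite (f1 4%N).
    + by rewrite /= (f1 0%N).
    + by rewrite /= (f1 0%N) ?PE.
    + by rewrite /brute -/br (negbTE (_ : ~~ ~~ br)) ?negbK.
  - by exists 0%N, 5%N.
  - by exists 0%N, 0%N.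
  - by move=> v vn; rewrite (leq_trans _ PX)// PE leq_pexp2l.
apply: (@wp_seq _ _ X_ge _ _ _ _ 60 69) => //.
have PE : P = (n ^ s * L ^ s)%N by rewrite /P (negbTE Hb).
apply: (wp_mono X_ge (leqnn _) _ (@pow_spec h eta 5 n_ s_ n s _ _ _ _ _ _ _)) => //.
- move=> h1 [r1 f1 H1].
  apply: (@wp_seq _ _ X_ge _ _ _ _ 60 68) => //.
  apply: (wp_mono X_ge (leqnn _) _ (@pow_spec h1 eta 6 L_ s_ L s _ _ _ _ _ _ _)) => //.
  + move=> h2 [r2 f2 H2].
    have z : hn h2 0 4 = s by rewrite f2// f1.
    have z5 t : (t <= s)%N -> hn h2 5 t = (n ^ t)%N by move=> ts; rewrite f2// H1.
    apply: wp_setN => //.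
      split=> //=; rewrite z z5//.
      by rewrite (leq_trans _ PX)// PE leq_pmulr// expn_gt0 L0.
    rewrite [dN _ _ _]/= [dN _ _ _]/= z z5// H2//.
    split; last by move=> i; rewrite /= (f2 3%N)// (f1 3%N).
    split=> //.
    * split; rewrite /= ?(f2 0%N) ?(f2 1%N)// ?(f1 0%N) ?(f1 1%N)// ?r2 ?r1//.
      by split=> //; rewrite (f2 4%N)// (f1 4%N).
    * by rewrite /= !(f2 0%N)// !(f1 0%N).
    * by rewrite /= !(f2 0%N)// !(f1 0%N)// PE.
    * by rewrite /brute -/br (negbTE Hb).
    * by move=> _ t ts /=; rewrite z5// H2.
  + by exists 0%N, 5%N.
  + by exists 0%N, 4%N.
  + by rewrite /= (f1 0%N).
  + by rewrite /= (f1 0%N).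
  + exact: sX.
  + move=> v vs; rewrite (leq_trans _ PX)// PE (leq_trans (leq_pexp2l L0 vs))//.
    by rewrite leq_pmull// expn_gt0 nn0.
- by exists 0%N, 0%N.
- by exists 0%N, 4%N.
- exact: sX.
- move=> v vs; rewrite (leq_trans _ PX)// PE (leq_trans (leq_pexp2l nn0 vs))//.
  by rewrite leq_pmulr// expn_gt0 L0.
Qed.

Lemma setup_spec h eta : base h ->
  wp X 0 [::] eta 100 pSetup (fun h' => cfg2 n k Q inp hh s L P K0 h' /\
    forall i, hn h' 3 i = 0%N) h.
Proof.
move=> B; have [Cn Ck Cr C3] := B.
(* Input cell 2 is [d 0 1], which is off the diagonal since [1 < n]: a legitimate first value for
   both the minimum and the maximum. *)
have at01 : att (inp 2%N).
  exists 0%N, 1%N; split=> //; first exact: ltnW.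
apply: (@wp_seq _ _ X_ge _ _ _ _ 10 99) => //; apply: wp_setR => //.
apply: (@wp_seq _ _ X_ge _ _ _ _ 10 98) => //; apply: wp_setR => //.
rewrite [dR _ _ _]/= [dR _ _ _]/= [dN _ _ _]/= [dN _ _ _]/= Cr.
apply: (@wp_seq _ _ X_ge _ _ _ _ 80 97) => //.
apply: (wp_mono X_ge (leqnn _) _ (@mm_spec _ eta _ _ _)) => //=.
move=> h1 [B1 m0 m1]; have [Cn1 Ck1 Cr1 C31] := B1.
have kok h' : hn h' 1 0 = k -> okR X h' eta (natE 10 k_).
  by move=> E; apply: natE_ok => //=; rewrite E.
apply: (@wp_seq _ _ X_ge _ _ _ _ 40 96) => //; apply: wp_setR => //.
  by split=> //; split=> //; exact: kok.
have -> : dR h1 eta hE = hh.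
  by rewrite /hE dR_Rd !dR_Rm natE_sem /= Cr1 m0 Ck1.
apply: (@wp_seq _ _ X_ge _ _ _ _ 60 95) => //.
set h2 := setR h1 0 _ _.
have xQE : dR h2 eta QE = xQ.
  rewrite /QE /sqE dR_Rd !dR_Rm natE_sem /= Cr1 m0 m1 Ck1 /xQ; ring.
apply: (@wp_ceil _ _ X_ge _ _ _ _ _ _ _ _ _ Q) => //; rewrite ?xQE//.
  by split=> //; split=> //; split=> //; split; exact: kok.
  by case/andP: HQ.
move=> Q' _ q1 q2.
have -> : Q' = Q by apply: (nat_ceil_uniq (x := xQ)) => //; rewrite q1.
set h3 := setN h2 0 _ _.
apply: (@wp_seq _ _ X_ge _ _ _ _ 60 94) => //.
apply: (wp_mono X_ge (leqnn _) _ (@log_spec h3 eta _)) => // h4 [pv ->].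
set h5 := setN (setN h3 0 2 q) 0 7 pv.
apply: (@wp_seq _ _ X_ge _ _ _ _ 90 93) => //.
have xKE : dR h5 eta KE = xK.
  have -> : dR h5 eta KE = c1 * (k%:R * ((n%:R / \sum_(j < n) wwn n inp 0%N j) *
      (n%:R / \sum_(j < n) wwn n inp 0%N j))) / (eps * eps).
    rewrite /KE /sqE dR_Rd !dR_Rm dR_Rd !natE_sem dR_Rsum.
    rewrite [dN _ _ n_]/= [dN _ _ k_]/= Cn1 Ck1 [dR _ _ eps_]/= Cr1 /=.
    have -> : \sum_(i < n) hr h1 1 (1 + (hn h1 0 0 * hn h1 0 0 + (0 * hn h1 0 0 +
        upd eta 20 i 20)))%N = \sum_(j < n) wwn n inp 0%N j.
      by apply: eq_bigr => j _; rewrite Cr1 Cn1.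
    by [].
  by rewrite -!expr2.
apply: (@wp_ceil _ _ X_ge _ _ _ _ _ _ _ _ _ K0) => //; rewrite ?xKE//.
  have o20 : okR X h5 eta (natE 20 k_) by apply: natE_ok => //=; rewrite Ck1.
  have o20n : okR X h5 eta (natE 20 n_) by apply: natE_ok => //=; rewrite Cn1.
  have osum : okR X h5 eta (Rsum 20 n_ (wE (Nc 0) (Nt 20))).
    split=> //=; rewrite Cn1// => i iN; split=> //; split; split=> //.
  by split=> //; split.
  by case/andP: HK.
move=> K' _ q1' q2'.
have -> : K' = K0 by apply: (nat_ceil_uniq (x := xK)) => //; rewrite q1'.
apply: (@wp_seq _ _ X_ge _ _ _ _ 20 92) => //; apply: wp_setN => //.
rewrite [dN _ _ (Nm _ _)]/= -/s [dN _ _ _]/= [dN _ _ _]/=.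
set h6 := setN _ _ _ _.
apply: (@wp_seq _ _ X_ge _ _ _ _ 60 91) => //.
apply: (wp_mono X_ge (leqnn _) _ (@pow_spec h6 eta 4 Q_ k_ Q k _ _ _ _ _ _ _)) => //.
- move=> h7 [r7 f7 H7].
  apply: (@wp_seq _ _ X_ge _ _ _ _ 20 90) => //; apply: wp_setN => //.
  rewrite [dN _ _ (Nr _ _)]/= [dN _ _ _]/= (f7 1%N)//.
  have -> : hn h6 1 0 = k by [].
  rewrite H7// -/L.
  set h8 := setN _ _ _ _.
  have g0 i : i != 5%N -> hn h8 0 i = hn h6 0 i.
    by move=> i5; rewrite /= (negbTE i5) (f7 0%N).
  apply: (wp_mono X_ge (g := 80) _ _ (@tab_spec h8 eta _ _ _ _ _)) => //.
  + split.
    * by rewrite g0//= Cn1.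
    * by rewrite /= (f7 1%N).
    * by rewrite /= r7.
    * by move=> i; rewrite /= (f7 3%N)//= C31.
  + split.
    * by rewrite g0//= Cn1.
    * by rewrite /= (f7 1%N).
    * by rewrite g0.
    * by rewrite /= r7.
    * by split=> [c|l lk]; [rewrite /= r7 /= Cr1|rewrite /= H7].
  + by rewrite g0.
  + by rewrite g0.
- by exists 0%N, 1%N.
- by exists 1%N, 0%N.
- move=> v vk; rewrite (leq_trans _ LX)// leq_pexp2l//.
Qed.

End Setup.

(* Spread the input out to the cells of index 1 modulo 8; going downwards, no
   cell is overwritten before it is read. *)
Definition pIn := Seq (cN 0 (Na (Nm (Na n_ n_) n_) (Nc 1)))
  (While (BNle (NCst 1) (nreg 0)) (Seq (NSet (reg 0) (NSub (nreg 0) (NCst 1)))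
     (RSet (cell 1 (nreg 0)) (RGet (nreg 0))))).
(** Going upwards, the cell written lies below every source cell still to be read. *)
Definition pMove := Seq (cN 0 (Nm n_ k_)) (Seq (NSet (reg 1) (NCst 0))
  (While (BNle (NSuc (nreg 1)) (nreg 0)) (Seq (RSet (nreg 1) (RGet (cell 4 (nreg 1))))
     (NSet (reg 1) (NSuc (nreg 1)))))).
Definition pAll := Seq pIn (Seq pSetup (Seq pMain (Seq pOut pMove))).

(** * Input, output and the whole program *)

Section Whole.
Variable R : realType.
Variable X : nat.
Hypothesis X_ge : (100 <= X)%N.
Implicit Types (s : state R).

Definition view s : hst R :=
  Hst (fun al i => nmem s (8 * i + al)%N) (fun al i => rmem s (8 * i + al)%N).

Lemma rep_view s eta : rep [::] eta (view s) s.
Proof. by split. Qed.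

Lemma in_spec s n : nmem s 0 = n -> (2 * n <= X)%N -> ((n + n) * n + 1 <= X)%N ->
  runs X pIn s 40 (fun s' =>
    (forall a, (a %% 8 != 7)%N -> nmem s' a = nmem s a) /\
    (forall c, (c < (n + n) * n + 1)%N -> rmem s' (8 * c + 1)%N = rmem s c)).
Proof.
move=> s0 n2X TX; set T := ((n + n) * n + 1)%N in TX *.
apply: (@runs_seq _ _ X_ge _ _ _ _ 35 35) => //.
have o : okN X (view s) (fun=> 0%N) (Na (Nm (Na n_ n_) n_) (Nc 1)).
  by split=> //; split=> //=; rewrite s0 addnn -mul2n.
apply: runs_mono (cN_ok X_ge (dl := 0) (vs := [::]) _ _ o (rep_view s _)) => // s1 [k1 r1 v1].
have {}v1 : nmem s1 7 = T by rewrite v1 /= s0.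
pose I m (s' : state R) := [/\ nmem s' 7 = m, (m <= T)%N,
  forall a, (a %% 8 != 7)%N -> nmem s' a = nmem s a,
  forall c, (m <= c < T)%N -> rmem s' (8 * c + 1)%N = rmem s c &
  forall c, (c < m)%N -> rmem s' c = rmem s c].
apply: (@runs_while _ _ X_ge _ _ _ 2 35 T I) => //.
- split=> //.
  + by move=> a a7; case: k1 => n1 _; rewrite n1// a7.
  + by move=> c; case: leqP => //= h /leq_trans/(_ h); rewrite ltnn.
  + by move=> c _; rewrite r1.
- move=> m s2 [v2 mT H1 H2 H3]; split; first by rewrite /= v2.
  apply: (@runs_seq _ _ X_ge _ _ _ _ 1 1) => //.
  apply: runs_nset => //; apply: runs_rset => //.
  have ev : neval s2 (NSub (nreg 0) (NCst 1)) = m by rewrite /= v2 subn1.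
  rewrite ev neval_cell; set s3 := nset _ _ _.
  have e : neval s3 (nreg 0) = m by rewrite /s3 /= upd_same.
  have er : reval s3 (RGet (nreg 0)) = rmem s2 m by rewrite -[in RHS]e.
  rewrite e er; split.
  + by rewrite /s3 /= upd_same.
  + by lia.
  + by move=> a a7 /=; rewrite upd_diff ?H1//; apply/eqP => ea; rewrite ea in a7.
  + move=> c cT /=; rewrite /upd; case: eqP => [ec|ne].
      have -> : c = m by lia.
      by rewrite H3.
    by apply: H2; lia.
  + move=> c cm /=; rewrite upd_diff; last by lia.
    by apply: H3; lia.
- move=> s2 [v2 _ H1 H2 H3]; split; first by rewrite /= v2.
  by split=> // c cT; apply: H2.
Qed.

Lemma move_spec s n k h eta : rep [::] eta h s -> hn h 0 0 = n -> hn h 1 0 = k ->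
  (n <= X)%N -> (n * k <= X)%N ->
  runs X pMove s 40 (fun s' => forall o, (o < n * k)%N -> rmem s' o = hr h 4 o).
Proof.
move=> rp Cn Ck nX nkX.
apply: (@runs_seq _ _ X_ge _ _ _ _ 35 36) => //.
have o : okN X h eta (Nm n_ k_) by split=> //=; rewrite Cn.
apply: runs_mono (cN_ok X_ge (dl := 0) (vs := [::]) _ _ o rp) => // s1 [k1 r1 v1].
apply: (@runs_seq _ _ X_ge _ _ _ _ 1 35) => //; apply: runs_nset => //.
rewrite [dN _ _ _]/= Cn Ck in v1.
have v1' : nmem s1 7 = (n * k)%N by [].
have [_ hr1 _] := rep_keep (isT : below 0 [::]) rp k1.
pose I m (s' : state R) := [/\ nmem s' 7 = (n * k)%N, nmem s' 15 = (n * k - m)%N, (m <= n * k)%N,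
  forall c, (n * k - m <= c)%N -> rmem s' (8 * c + 4)%N = hr h 4 c &
  forall c, (c < n * k - m)%N -> rmem s' c = hr h 4 c].
apply: (@runs_while _ _ X_ge _ _ _ 2 35 (n * k)%N I) => //.
- split; rewrite ?subnn//.
  + by move=> c _; rewrite -hr1.
- move=> m s2 [v2 v3 mT H2 H3]; split; first by rewrite /= v2 v3; lia.
  apply: (@runs_seq _ _ X_ge _ _ _ _ 1 1) => //.
  apply: runs_rset => //; apply: runs_nset => //.
  have e15 : neval s2 (nreg 1) = (n * k - m.+1)%N by rewrite -v3.
  have ec : reval s2 (RGet (cell 4 (nreg 1))) = hr h 4 (n * k - m.+1)%N.
    rewrite -H2// -e15 -neval_cell//.
  rewrite e15 ec; split.
  + by rewrite /= upd_diff.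
  + by rewrite nevE /= upd_same v3; lia.
  + by lia.
  + move=> c cc /=; rewrite upd_diff; last by lia.
    by apply: H2; lia.
  + move=> c cc /=; rewrite /upd; case: eqP => [->//|ne].
    by apply: H3; lia.
- move=> s2 [v2 v3 _ H2 H3]; split; first by rewrite /= v2 v3; lia.
  by move=> c cn; apply: H3; rewrite subn0.
Qed.

Variables (n k Q q K0 : nat) (eps dmin dmax : R).
Let c1 : R := 3 * (100 * (100 * (100 * (100 * 100)))).
Let hh := eps * dmin / (32 * k%:R).
Let L := (Q ^ k)%N.
Let s := (q * K0)%N.
Let br := (n <= K0)%N.
Let P := (if br then L ^ n else n ^ s * L ^ s)%N.

Definition setup_ok (inp : nat -> R) : Prop := [/\ inp 0%N = eps,
  0 <= 600 * k%:R ^+ 2 * dmax / (dmin * eps ^+ 2),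
  600 * k%:R ^+ 2 * dmax / (dmin * eps ^+ 2) <= Q%:R
    < 600 * k%:R ^+ 2 * dmax / (dmin * eps ^+ 2) + 1 &
  [/\ 0 <= c1 * (k%:R * (n%:R / \sum_(j < n) wwn n inp 0%N j) ^+ 2) / eps ^+ 2,
      c1 * (k%:R * (n%:R / \sum_(j < n) wwn n inp 0%N j) ^+ 2) / eps ^+ 2 <= K0%:R
      < c1 * (k%:R * (n%:R / \sum_(j < n) wwn n inp 0%N j) ^+ 2) / eps ^+ 2 + 1,
      forall i j, (i < n)%N -> (j < n)%N -> i != j -> dmin <= ddn n inp i j <= dmax,
      exists i j, [/\ (i < n)%N, (j < n)%N, i != j & ddn n inp i j = dmin] &
      exists i j, [/\ (i < n)%N, (j < n)%N, i != j & ddn n inp i j = dmax]]].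

Hypothesis n2 : (1 < n)%N.
Hypothesis k0 : (0 < k)%N.
Hypothesis Q0 : (0 < Q)%N.
Hypothesis qE : q = up_log 2 Q.
Hypothesis TX : ((n + n) * n + 1 <= X)%N.
Hypothesis nkX : (n * k <= X)%N.
Hypothesis kQX : (k * Q <= X)%N.
Hypothesis qX : (q <= X)%N.
Hypothesis KX : (K0 <= X)%N.
Hypothesis LX : (L <= X)%N.
Hypothesis sX : ~~ br -> (s <= X)%N.
Hypothesis PX : (P <= X)%N.

(** [inp] is array 1 of the memory after [pIn]. Beyond the cells of [eps] and the two matrices its
    contents are leftovers, so only agreement on those cells is available. *)
Lemma prog_spec s0 : nmem s0 0 = n -> nmem s0 1 = k -> (forall a, (1 < a)%N -> nmem s0 a = 0%N) ->
  (forall inp, (forall c, (c < (n + n) * n + 1)%N -> inp c = rmem s0 c) -> setup_ok inp) ->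
  runs X pAll s0 240 (fun s' => exists inp (x : nat -> nat),
    [/\ forall c, (c < (n + n) * n + 1)%N -> inp c = rmem s0 c,
        forall i, (i < n)%N -> (x i < L)%N,
        forall N, (N < P)%N -> exists2 y, cand n k Q inp hh s L K0 N y &
          costn n k Q inp hh x <= costn n k Q inp hh y &
        forall i l, (i < n)%N -> (l < k)%N ->
          rmem s' (i * k + l)%N = hh * (dig Q (x i) l)%:R]).
Proof.
move=> E0 E1 E2 Hok.
have nX : (n <= X)%N by move: TX n2; nia.
have kX : (k <= X)%N by move: nkX n2; nia.
have QX : (Q <= X)%N by move: kQX k0; nia.
have n2X : (2 * n <= X)%N by move: TX n2; nia.
apply: (@runs_seq _ _ X_ge _ _ _ _ 40 239) => //.
apply: runs_mono (in_spec E0 n2X TX) => // s1 [H1 H2].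
pose h1 := view s1; pose inp := hr h1 1%N.
have Hinp c : (c < (n + n) * n + 1)%N -> inp c = rmem s0 c by exact: H2.
have [Ie xQ0 HQ [xK0 HK dd dmi dma]] := Hok _ Hinp.
have B : base n k inp h1.
  split=> //.
  - by rewrite /= H1.
  - by rewrite /= H1.
  - by move=> i; rewrite /= H1 ?E2//; clear; lia.
apply: (@runs_seq _ _ X_ge _ _ _ _ 100 238) => //.
have SU := @setup_spec R X X_ge n k Q q K0 inp dmin dmax n2 Q0 qE.
rewrite Ie in SU.
have {}SU := SU xQ0 HQ xK0 HK dd dmi dma nX kX QX qX KX LX sX PX h1 (fun=> 0%N) B.
apply: runs_mono (SU s1 (rep_view s1 _)) => // s2 [_ [h2 rp2 [C2 X2]]].
apply: (@runs_seq _ _ X_ge _ _ _ _ 220 237) => //.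
have L0 : (0 < L)%N by rewrite expn_gt0 Q0.
have X2' i : (i < n)%N -> (hn h2 3 i < L)%N by move=> _; rewrite X2.
have MA := main_spec X_ge Q0 (ltnW n2) L0 nX kX QX kQX LX PX sX C2 X2'.
apply: runs_mono (MA _ s2 rp2) => // s3 [_ [h3 rp3 [C3 X3 H3]]].
apply: (@runs_seq _ _ X_ge _ _ _ _ 140 236) => //.
have OU := out_spec X_ge Q0 (ltnW n2) L0 nX kX QX kQX LX PX sX k0 C3 X3.
apply: runs_mono (OU _ s3 rp3) => // s4 [_ [h4 rp4 [E4 H4]]].
have [[Cn Ck _ _ _] _ _ _ _] := C3.
apply: runs_mono (move_spec rp4 (n := n) (k := k) _ _ nX nkX) => //; rewrite ?E4//.
move=> s5 H5; exists inp, (hn h3 3); split=> // i l iN lk.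
by rewrite H5 ?H4//; clear -iN lk; nia.
Qed.

End Whole.

(** * Running time *)

Section TimeBound.
Variable R : realType.
Variables (n k Q q K0 : nat) (eps delta Delta : R).
Definition c1 : R := 3 * (100 * (100 * (100 * (100 * 100)))).
Let L := (Q ^ k)%N.
Let s := (q * K0)%N.
Let br := (n <= K0)%N.
Let P := (if br then L ^ n else n ^ s * L ^ s)%N.
(* Dominates every natural number and loop count of the program. *)
Definition Xb : nat := (100 * (n * n * k * Q * q * K0 * P))%N.
Hypothesis n2 : (1 < n)%N.
Hypothesis k0 : (0 < k)%N.
Hypothesis eps01 : 0 < eps < 1.
Hypothesis delta01 : 0 < delta < 1.
Hypothesis Delta1 : 1 <= Delta.
Hypothesis Q2 : (1 < Q)%N.
Hypothesis qE : q = up_log 2 Q.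
Hypothesis HQ : Q%:R < 600 * k%:R ^+ 2 * Delta / eps ^+ 2 + 1.
Hypothesis HK : c1 * k%:R / (eps ^+ 2 * delta ^+ 2) <= K0%:R
   < c1 * k%:R / (eps ^+ 2 * delta ^+ 2) + 1.

Let e0 : 0 < eps. Proof. by case/andP: eps01. Qed.
Let e1 : eps < 1. Proof. by case/andP: eps01. Qed.
Let d0 : 0 < delta. Proof. by case/andP: delta01. Qed.
Let d1 : delta < 1. Proof. by case/andP: delta01. Qed.
Let kR : 1 <= k%:R :> R. Proof. by rewrite ler1n. Qed.
Let nR : 2 <= n%:R :> R. Proof. by rewrite ler_nat. Qed.
Let c1_ge : 3 <= c1. Proof. by rewrite /c1; lra. Qed.

Let y := Delta * k%:R / (eps * delta).
Let ell := ln y.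
Let lam := ln (n%:R * Delta).
Let z := k%:R / (eps * delta).
Let z2 := k%:R / (eps ^+ 2 * delta ^+ 2).
(** Up to constants, the logarithm of the number of guesses is [lam * GG]. The summand 1 also covers
    [y] close to 1, where [ell] is close to 0. *)
Let GG := k%:R ^+ 2 * (1 + ell) / (eps ^+ 2 * delta ^+ 2).

Let ed0 : 0 < eps * delta. Proof. exact: mulr_gt0. Qed.
Let ed1 : eps * delta <= 1.
Proof. by rewrite -[leRHS]mulr1; apply: ler_pM; rewrite ltW// ?e0 ?d0 ?e1 ?d1. Qed.
Let ed2 : (eps * delta) ^+ 2 <= eps * delta.
Proof. by rewrite expr2 -[leRHS]mul1r ler_pM2r. Qed.

Let z1 : 1 <= z.
Proof. by rewrite /z ler_pdivlMr// mul1r; have := ed1; have := kR; lra. Qed.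
Let yz : y = Delta * z. Proof. by rewrite /y /z mulrA. Qed.
Let zy : z <= y.
Proof. by rewrite yz -[leLHS]mul1r ler_pM2r//; have := z1; lra. Qed.
Let y1 : 1 <= y. Proof. exact: le_trans z1 zy. Qed.
Let ell0 : 0 <= ell. Proof. by rewrite ln_ge0. Qed.

Let zz2 : z <= z2.
Proof.
rewrite /z /z2 -exprMn ler_pM2l; last by have := kR; lra.
by rewrite lef_pV2 ?posrE ?exprn_gt0// ed2.
Qed.
Let z2z : z2 <= z ^+ 2.
Proof.
rewrite /z2 /z -exprMn expr_div_n; apply: ler_pM.
- exact: ler0n.
- by rewrite invr_ge0 sqr_ge0.
- by rewrite expr2 -[leLHS]mul1r ler_wpM2r// ler0n.
- by [].
Qed.
Let z21 : 1 <= z2. Proof. exact: le_trans z1 zz2. Qed.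

Let GE_ : GG = z2 * k%:R * (1 + ell).
Proof. by rewrite /GG /z2; field; rewrite !gt_eqF. Qed.

Let G_ell : 1 + ell <= GG.
Proof.
rewrite GE_ -[leLHS]mul1r ler_wpM2r//; first by have := ell0; lra.
rewrite -[leLHS]mulr1; apply: ler_pM => //.
Qed.
Let G1 : 1 <= GG. Proof. by apply: le_trans G_ell; have := ell0; lra. Qed.

Let exp_half : expR (1 / 2) <= 2 :> R.
Proof.
rewrite -[1 / 2]opprK expRN invf_ple ?posrE ?expR_gt0//.
by apply: le_trans (expR_ge1Dx _); lra.
Qed.

Let ln2_ge : 1 <= 2 * ln 2 :> R.
Proof.
have : ln (expR (1 / 2)) <= ln 2 :> R by rewrite ler_ln ?posrE ?expR_gt0.
by rewrite expRK; lra.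
Qed.

Let ln_le (x : R) : 0 < x -> ln x <= x.
Proof.
move=> x0; have := @le_ln1Dx R (x - 1); have -> : 1 + (x - 1) = x by ring.
move=> H; have h : ln x <= x - 1 by apply: H; lra.
by lra.
Qed.

Let ln_mono (a b : R) : 0 < a -> a <= b -> ln a <= ln b.
Proof. by move=> a0 ab; rewrite ler_ln ?posrE//; lra. Qed.

Let nD0 : 0 < n%:R * Delta. Proof. by apply: mulr_gt0; [have := nR|have := Delta1]; lra. Qed.
Let nD : 2 <= n%:R * Delta.
Proof. by rewrite -[leLHS]mulr1; apply: ler_pM. Qed.
Let lam2 : 1 <= 2 * lam.
Proof. by have := @ln_mono 2 (n%:R * Delta) (ltr0Sn _ _) nD; have := ln2_ge; rewrite /lam; lra. Qed.
Let ln_n : ln n%:R <= lam.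
Proof.
have := nR => nR'; apply: ln_mono; first by lra.
by rewrite -[leLHS]mulr1; apply: ler_wpM2l; first lra.
Qed.
Let ln_n0 : 0 <= ln n%:R :> R. Proof. by apply: ln_ge0; have := nR; lra. Qed.

Let y0 : 0 < y. Proof. by have := y1; lra. Qed.
Let y2 : 1 <= y ^+ 2. Proof. exact: exprn_ege1. Qed.
Let lny2 : ln (y ^+ 2) = 2 * ell. Proof. by rewrite lnXn// -[LHS]mulr_natl. Qed.

Let ln_k : ln k%:R <= ell.
Proof.
apply: ln_mono; first by have := kR; lra.
apply: le_trans zy; rewrite /z -[leLHS]mulr1 ler_wpM2l ?ler0n//.
by rewrite invf_ge1.
Qed.

Let Qy : Q%:R <= 601 * y ^+ 2.
Proof.
have h1 : k%:R ^+ 2 * Delta / eps ^+ 2 <= y ^+ 2.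
  have -> : k%:R ^+ 2 * Delta / eps ^+ 2 = (k%:R / eps) ^+ 2 * (Delta * 1).
    by field; rewrite gt_eqF.
  have -> : y ^+ 2 = (k%:R / eps) ^+ 2 * (Delta * (Delta / delta ^+ 2)).
    by rewrite /y; field; rewrite !gt_eqF.
  rewrite ler_wpM2l ?sqr_ge0// ler_pM2l; last by have := Delta1; lra.
  rewrite ler_pdivlMr ?exprn_gt0// mul1r.
  have : delta ^+ 2 <= 1 by rewrite exprn_ile1// ltW.
  by have := Delta1; lra.
have := HQ; have := y2.
have -> : 600 * k%:R ^+ 2 * Delta / eps ^+ 2 = 600 * (k%:R ^+ 2 * Delta / eps ^+ 2) by ring.
lra.
Qed.

Let Q0 : 0 < Q%:R :> R. Proof. by rewrite ltr0n ltnW. Qed.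
Let lnQ : ln Q%:R <= 601 * (1 + ell).
Proof.
have h : ln Q%:R <= ln (601 * y ^+ 2) by apply: ln_mono.
apply: (le_trans h); rewrite lnM ?posrE//; last by have := y2; lra.
by rewrite lny2; have := @ln_le 601 (ltr0Sn _ _); have := ell0; lra.
Qed.
Let lnQ0 : 0 <= ln Q%:R :> R. Proof. by apply: ln_ge0; rewrite ler1n ltnW. Qed.

Let q0 : (0 < q)%N.
Proof.
rewrite lt0n; apply/eqP => H.
by have := up_logP Q (isT : (1 < 2)%N); rewrite -qE H expn0 leqNgt Q2.
Qed.

Let q_le : q%:R <= 1203 * (1 + ell).
Proof.
have /andP[h1 _] := up_log_bounds (isT : (1 < 2)%N) Q2; rewrite -qE in h1.
have : ln (2 ^+ q.-1) <= ln Q%:R :> R.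
  by apply: ln_mono; rewrite ?exprn_gt0// -natrX ler_nat ltnW.
rewrite lnXn// -[_ *+ _]mulr_natl => h2.
have h3 : q.-1%:R * (1 / 2) <= q.-1%:R * ln 2 :> R.
  by rewrite ler_wpM2l ?ler0n//; have := ln2_ge; lra.
have : q%:R = q.-1%:R + 1 :> R by rewrite natr1 prednK.
by have := lnQ; have := ell0; lra.
Qed.

Let K_ge : c1 * z2 <= K0%:R.
Proof. by case/andP: HK => h _; rewrite /z2 mulrA. Qed.
Let K_le : K0%:R <= (c1 + 1) * z2.
Proof.
case/andP: HK => _ h; have e : c1 * k%:R / (eps ^+ 2 * delta ^+ 2) = c1 * z2.
  by rewrite /z2 -mulrA.
by have := z21; lra.
Qed.
Let K_gt0 : 0 < K0%:R :> R.
Proof. by apply: lt_le_trans K_ge; apply: mulr_gt0; have := c1_ge; have := z21; lra. Qed.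
Let K0n : (0 < K0)%N. Proof. by rewrite -(ltr0n R). Qed.

Let lnK0 : ln K0%:R <= c1 + 1 + 2 * ell.
Proof.
have c0 : 0 < c1 + 1 by have := c1_ge; lra.
have h : ln K0%:R <= ln ((c1 + 1) * y ^+ 2).
  apply: ln_mono => //; apply: (le_trans K_le); rewrite ler_pM2l//.
  apply: (le_trans z2z); rewrite ler_sqr ?nnegrE//; have := z1; have := zy; lra.
apply: (le_trans h); rewrite lnM ?posrE//; last by have := y2; lra.
by rewrite lny2; have := ln_le c0; lra.
Qed.

Let L0 : (0 < L)%N. Proof. by rewrite expn_gt0 ltnW. Qed.
Let s0 : (0 < s)%N. Proof. by rewrite muln_gt0 q0. Qed.
Let P0 : (0 < P)%N.
Proof.
have pw a b : (0 < a -> 0 < a ^ b)%N by move=> a0; rewrite expn_gt0 a0.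
by rewrite /P; case: br; rewrite ?muln_gt0 !pw// ltnW.
Qed.

Let lnL : ln L%:R = k%:R * ln Q%:R :> R.
Proof. by rewrite /L natrX lnXn// -[LHS]mulr_natl. Qed.

Let t := lam * GG.
Let lam0 : 0 < lam. Proof. by have := lam2; lra. Qed.
Let t_lam : lam <= t. Proof. by rewrite /t -[leLHS]mulr1 ler_pM2l. Qed.
Let t_G : GG <= 2 * t.
Proof. by rewrite /t mulrA -[leLHS]mul1r ler_wpM2r// ?lam2//; have := G1; lra. Qed.

(** When all labellings are tried, n <= K0 = O(z2) gives n k ln Q = O(GG), and [lam] is bounded
    below. Otherwise z <= K0 < n, hence ell <= lam: then ln n + k ln Q = O(k lam), and the factor
    [s] = O((1 + ell) z2) completes [lam * GG]. *)
Let lnP : ln P%:R <= 1203 * 1804 * (c1 + 1) * t.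
Proof.
have c0 : 0 < c1 + 1 by have := c1_ge; lra.
have t0 : 0 < t by have := t_lam; have := lam0; lra.
rewrite /P; case: ifPn => hb.
  rewrite natrX lnXn ?ltr0n// -[leLHS]mulr_natl lnL.
  have h1 : n%:R <= (c1 + 1) * z2 by apply: le_trans K_le; rewrite ler_nat.
  have h2 : n%:R * (k%:R * ln Q%:R) <= (c1 + 1) * z2 * (k%:R * (601 * (1 + ell))).
    apply: ler_pM => //; first by apply: mulr_ge0.
    by apply: ler_wpM2l.
  apply: (le_trans h2).
  have -> : (c1 + 1) * z2 * (k%:R * (601 * (1 + ell))) = 601 * (c1 + 1) * GG.
    by rewrite GE_; ring.
  have : 601 * (c1 + 1) * GG <= 601 * (c1 + 1) * (2 * t).
    by rewrite ler_wpM2l//; apply: mulr_ge0 => //; lra.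
  have : 0 <= (c1 + 1) * t by apply: mulr_ge0; lra.
  lra.
have nK : K0%:R <= n%:R :> R by rewrite ler_nat ltnW// ltnNge.
have zn : z <= n%:R.
  apply: (le_trans zz2); apply: le_trans nK; apply: le_trans K_ge.
  by rewrite -[leLHS]mul1r ler_wpM2r//; have := z21; have := c1_ge; lra.
have ell_lam : ell <= lam.
  apply: ln_mono => //; rewrite yz mulrC ler_wpM2r//; by have := Delta1; lra.
have -> : ln (n ^ s * L ^ s)%:R = q%:R * K0%:R * (ln n%:R + k%:R * ln Q%:R) :> R.
  rewrite -lnL -natrM -/s -expnMn natrX natrM.
  have np : 0 < n%:R :> R by rewrite ltr0n ltnW.
  have Lp : 0 < L%:R :> R by rewrite ltr0n.
  by rewrite lnXn ?mulr_gt0// -[LHS]mulr_natl lnM.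
have h1 : q%:R * K0%:R <= 1203 * (1 + ell) * ((c1 + 1) * z2).
  by apply: ler_pM.
have h2 : ln n%:R + k%:R * ln Q%:R <= 1804 * (k%:R * lam).
  have a1 : k%:R * ln Q%:R <= k%:R * (601 * (3 * lam)).
    by rewrite ler_wpM2l//; have := lnQ; have := lam2; lra.
  have a2 : 1 * lam <= k%:R * lam by rewrite ler_wpM2r// ltW.
  have := ln_n; lra.
have h3 : q%:R * K0%:R * (ln n%:R + k%:R * ln Q%:R) <=
    1203 * (1 + ell) * ((c1 + 1) * z2) * (1804 * (k%:R * lam)).
  apply: ler_pM => //; first exact: mulr_ge0.
  by apply: addr_ge0 => //; apply: mulr_ge0.
apply: (le_trans h3).
have -> : 1203 * (1 + ell) * ((c1 + 1) * z2) * (1804 * (k%:R * lam)) =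
  1203 * 1804 * (c1 + 1) * t by rewrite /t GE_; ring.
by [].
Qed.

Definition cT : R := 2000 * 2000 * (c1 + 1).

Let lnX : ln Xb%:R <= cT * t.
Proof.
have np : 0 < n%:R :> R by rewrite ltr0n ltnW.
have kp : 0 < k%:R :> R by rewrite ltr0n.
have qp : 0 < q%:R :> R by rewrite ltr0n.
have Pp : 0 < P%:R :> R by rewrite ltr0n.
have t0 : 0 < t by have := t_lam; have := lam0; lra.
have ct : 0 <= c1 * t by apply: mulr_ge0; [have := c1_ge; lra|exact: ltW].
have lq : ln q%:R <= 1203 * (1 + ell) by apply: le_trans q_le; exact: ln_le.
have l100 : ln 100 <= 100 :> R by exact: ln_le.
rewrite /Xb !natrM !lnM ?posrE; do ?[by rewrite ?mulr_gt0 ?ltr0n// ?(ltnW n2) ?(ltnW Q2)].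
have := lnP; have := lnK0; have := lnQ; have := ln_k; have := ln_n.
have := t_lam; have := t_G; have := G_ell; have := lam2; have := ell0; have := c1_ge.
have : c1 + 1 <= 2 * (c1 + 1) * t.
  have : (c1 + 1) * 1 <= (c1 + 1) * (2 * t).
    by apply: ler_wpM2l; have := c1_ge; have := t_lam; have := lam2; lra.
  lra.
rewrite /cT; lra.
Qed.

Let gg := k%:R ^+ 2 * ln (Delta * k%:R / (eps * delta)) / (eps ^+ 2 * delta ^+ 11).

(** If ell >= 1/2 then 1 + ell <= 3 ell, and [delta ^ 2] may be weakened to [delta ^ 11]. Otherwise
    z <= y <= 2, so that GG = z^2 (1 + ell) is at most 8. *)
Let G_max : GG <= 8 * Num.max 1 gg.
Proof.
have m1 : 1 <= Num.max 1 gg by rewrite le_max lexx.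
have m2 : gg <= Num.max 1 gg by rewrite le_max lexx orbT.
have [h|h] := leP (1 / 2) ell.
  have h1 : GG <= 3 * gg.
    have e2 : 0 < eps ^+ 2 by rewrite exprn_gt0.
    have -> : 3 * gg = k%:R ^+ 2 * (3 * ell) / (eps ^+ 2 * delta ^+ 11).
      by rewrite /gg -/y -/ell; field; rewrite !gt_eqF.
    apply: ler_pM.
    - by apply: mulr_ge0; [exact: sqr_ge0|lra].
    - by rewrite invr_ge0 mulr_ge0// exprn_ge0// ltW.
    - by rewrite ler_wpM2l ?sqr_ge0//; lra.
    - rewrite lef_pV2 ?posrE ?mulr_gt0 ?exprn_gt0// ler_pM2l//.
      by apply: ler_wiXn2l; rewrite ?ltW.
  lra.
have yb : y <= 2.
  apply: le_trans exp_half; rewrite -[leLHS]lnK ?posrE// ler_expR; exact: ltW.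
have zb : z <= 2 by exact: le_trans zy yb.
have : GG <= 4 * 2.
  have -> : GG = z ^+ 2 * (1 + ell) by rewrite /GG /z; field; rewrite !gt_eqF.
  apply: ler_pM; [exact: sqr_ge0|have := ell0; lra| |lra].
  by have := z1; nra.
lra.
Qed.

Lemma time_bound : (Xb ^ 240)%:R <= wemv_time (240 * 8 * cT) n k Delta eps delta.
Proof.
have X0 : (0 < Xb)%N.
  by rewrite /Xb !muln_gt0 (ltnW n2) k0 (ltnW Q2) q0 K0n P0.
have XR : 0 < Xb%:R :> R by rewrite ltr0n.
rewrite /wemv_time /powR gt_eqF// -/gg -/lam.
rewrite -[leLHS]lnK ?posrE ?ltr0n ?expn_gt0 ?X0// ler_expR natrX lnXn// -[leLHS]mulr_natl.
have cT0 : 0 < cT by rewrite /cT; have := c1_ge; lra.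
have h1 : 240 * ln Xb%:R <= 240 * (cT * t) by rewrite ler_wpM2l// lnX.
apply: (le_trans h1).
have h2 : 240 * (cT * lam) * GG <= 240 * (cT * lam) * (8 * Num.max 1 gg).
  rewrite ler_wpM2l// mulr_ge0// mulr_ge0// ltW//.
rewrite /t; lra.
Qed.

Lemma Xb_ge (m : nat) : (m %| Xb)%N -> (m <= Xb)%N.
Proof.
by apply: dvdn_leq; rewrite /Xb !muln_gt0 (ltnW n2) k0 (ltnW Q2) q0 K0n P0.
Qed.

End TimeBound.

(** * Correctness *)

(** The [s] low digits, in base [n], encode the sample; what is above them encodes its labels in
    base [L]. *)
Lemma digits_exist2 n L s (f g : nat -> nat) : (0 < n)%N ->
  (forall t, (t < s)%N -> (f t < n)%N) -> (forall t, (t < s)%N -> (g t < L)%N) ->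
  exists2 N, (N < n ^ s * L ^ s)%N &
    forall t, (t < s)%N -> Jn n N t = f t /\ Yn n s L N t = g t.
Proof.
move=> n0 fn gL; have [N1 l1 H1] := digits_exist fn; have [N2 l2 H2] := digits_exist gL.
have p0 : (0 < n ^ s)%N by rewrite expn_gt0 n0.
exists (N1 + N2 * n ^ s)%N.
  have : (N2.+1 * n ^ s <= L ^ s * n ^ s)%N by rewrite leq_mul2r l2 orbT.
  by rewrite mulSn; lia.
move=> t ts; rewrite /Jn /Yn; split; last first.
  by rewrite divnDMl// (divn_small l1) add0n H2.
have e : (N2 * n ^ s = N2 * n ^ (s - t).-1 * n * n ^ t)%N.
  rewrite -!mulnA; congr (_ * _)%N; rewrite -expnS -expnD; congr (_ ^ _)%N; lia.
by rewrite e divnDMl ?expn_gt0 ?n0// -modnDmr modnMl addn0 H1.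
Qed.

(** * Near-optimality of the labelling found *)

Section Correct.
Variable R : realType.
Variables (n k Q q K0 : nat) (d w : 'M[R]_n) (eps delta dmin dmax : R) (inp : nat -> R).
Let L := (Q ^ k)%N.
Let s := (q * K0)%N.
Let P := (if (n <= K0)%N then L ^ n else n ^ s * L ^ s)%N.
Let h := eps * dmin / (32 * k%:R).
Hypothesis n2 : (1 < n)%N.
Hypothesis k0 : (0 < k)%N.
Hypothesis Q2 : (1 < Q)%N.
Hypothesis qE : q = up_log 2 Q.
Hypothesis eps01 : 0 < eps < 1.
Hypothesis delta01 : 0 < delta < 1.
Hypothesis dmin0 : 0 < dmin.
Hypothesis d_ge0 : forall i j, 0 <= d i j.
Hypothesis d_off : forall i j, i != j -> dmin <= d i j <= dmax.
Hypothesis w_sym : forall i j, w i j = w j i.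
Hypothesis w_01 : forall i j, 0 <= w i j <= 1.
Hypothesis w_row : forall i, \sum_j w i j = delta * n%:R.
Hypothesis HK : c1 R * k%:R / (eps ^+ 2 * delta ^+ 2) <= K0%:R.
Hypothesis inp_d : forall i j : 'I_n, ddn n inp i j = d i j.
Hypothesis inp_w : forall i j : 'I_n, wwn n inp i j = w i j.

Let e0 : 0 < eps. Proof. by case/andP: eps01. Qed.
Let e1 : eps < 1. Proof. by case/andP: eps01. Qed.
Let de0 : 0 < delta. Proof. by case/andP: delta01. Qed.
Let de1 : delta < 1. Proof. by case/andP: delta01. Qed.
Let kR : 1 <= k%:R :> R. Proof. by rewrite ler1n. Qed.
Let kR0 : 0 < k%:R :> R. Proof. by rewrite ltr0n. Qed.
Let h0 : 0 < h. Proof. by rewrite /h divr_gt0 ?mulr_gt0// ltr0n. Qed.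
Let Q0 : (0 < Q)%N. Proof. exact: ltnW. Qed.
Let n0 : (0 < n)%N. Proof. exact: ltnW. Qed.
Let q0 : (0 < q)%N.
Proof.
rewrite lt0n; apply/eqP => H.
by have := up_logP Q (isT : (1 < 2)%N); rewrite -qE H expn0 leqNgt Q2.
Qed.
Let Q_le : (Q <= 2 ^ q)%N. Proof. by rewrite qE; exact: up_logP. Qed.

Let pp := pt R (k := k) (Q := Q).
Let r := rr R (k := k) (Q := Q).
(** Symmetrised distances in units of the mesh, as the analysis of the greedy labelling assumes
    symmetry. *)
Let d' (i j : 'I_n) : R := (d i j + d j i) / (2 * h).
Let fc := fcost pp r w d'.

Let cn_pcost (i j : 'I_n) (a b : 'I_L) :
  cn n k Q inp h i j a b = h ^+ 2 * pcost pp r w d' i j a b.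
Proof.
rewrite /cn /pcost !inp_d inp_w -[D2n _ _ _ _ _]/(D2 pp a b) -[rrn _ _ _ _ _]/(r a b) /d'.
by field; rewrite gt_eqF.
Qed.

Let costn_fc (y : 'I_n -> 'I_L) (x : nat -> nat) : (forall i : 'I_n, x i = y i) ->
  costn n k Q inp h x = h ^+ 2 * fc y.
Proof.
move=> xy; rewrite /costn /fc /fcost mulr_sumr; apply: eq_bigr => i _.
by rewrite mulr_sumr; apply: eq_bigr => j _; rewrite !xy cn_pcost.
Qed.

(** The antisymmetric part of [d] cancels against the symmetric [w] and [r]: the double sum of [g]
    is its own opposite. *)
Let hcost_fc (y : 'I_n -> 'I_L) : hcost d w h y = SS d w + h ^+ 2 * fc y.
Proof.
pose g i j := w i j * (d j i - d i j) * h * r (y i) (y j).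
have g0 : \sum_i \sum_j g i j = 0.
  have : \sum_i \sum_j g i j = - \sum_i \sum_j g i j.
    rewrite [LHS]exchange_big -sumrN; apply: eq_bigr => i _; rewrite -sumrN.
    apply: eq_bigr => j _; rewrite /g (w_sym j) /r (rr_sym R (y j)); ring.
  by move=> H; lra.
rewrite -[LHS]addr0 -[X in _ + X = _]oppr0 -g0 /hcost /SS /fc /fcost.
rewrite mulr_sumr -sumrN -!big_split; apply: eq_bigr => i _ /=.
rewrite mulr_sumr -sumrN -!big_split; apply: eq_bigr => j _ /=.
rewrite /g /pcost /d' -/pp -/(r _ _); field; by rewrite gt_eqF.
Qed.

Let Sd_SS : h ^+ 2 * Sd w d' <= SS d w.
Proof.
have e : SS d w = \sum_i \sum_j w i j * ((d i j ^+ 2 + d j i ^+ 2) / 2).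
  have E1 : \sum_i \sum_j w i j * d j i ^+ 2 = SS d w.
    rewrite [LHS]exchange_big; apply: eq_bigr => i _; apply: eq_bigr => j _.
    by rewrite (w_sym j).
  have -> : SS d w = (SS d w + \sum_i \sum_j w i j * d j i ^+ 2) / 2 by rewrite E1; field.
  rewrite -big_split mulr_suml; apply: eq_bigr => i _ /=.
  by rewrite -big_split mulr_suml; apply: eq_bigr => j _ /=; field.
rewrite e /Sd mulr_sumr; apply: ler_sum => i _; rewrite /Qd mulr_sumr; apply: ler_sum => j _.
have -> : h ^+ 2 * (w i j * d' i j ^+ 2) = w i j * ((d i j + d j i) ^+ 2 / 4).
  by rewrite /d'; field; rewrite gt_eqF.
apply: ler_wpM2l; first by case/andP: (w_01 i j).
by have := sqr_ge0 (d i j - d j i); rewrite sqrrB sqrrD; lra.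
Qed.

Section Sample.
Hypothesis nK : (K0 < n)%N.
(** The loss 500 * 100 * eta of [sampling_core] becomes eps / 2. *)
Let eta : R := eps / (1000 * 100).
Let Gam : R := (3 * (q * k))%N%:R.

Let KR : c1 R * k%:R <= K0%:R * (eps ^+ 2 * delta ^+ 2).
Proof. by have := HK; rewrite ler_pdivrMr// mulr_gt0// exprn_gt0. Qed.
Let K0n : (0 < K0)%N.
Proof.
rewrite -(ltr0n R); apply: lt_le_trans HK.
by rewrite divr_gt0 ?mulr_gt0 ?exprn_gt0// /c1; lra.
Qed.

(** [K0 < n] turns the lower bound on [K0] into one on the degree: delta n >= K0 eps^2 delta^2 >= c1
    k. *)
Let dn2 : 2 <= delta * n%:R.
Proof.
have h1 : K0%:R <= n%:R :> R by rewrite ler_nat ltnW.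
have h2 : K0%:R * (eps ^+ 2 * delta ^+ 2) <= n%:R * delta.
  apply: ler_pM; rewrite ?ler0n ?mulr_ge0 ?(ltW e0) ?(ltW de0)//.
  have a : eps ^+ 2 <= 1 by rewrite exprn_ile1// ltW.
  have b : delta ^+ 2 <= delta by rewrite expr2 -[leRHS]mulr1 ler_wpM2l// ltW.
  have : eps ^+ 2 * delta ^+ 2 <= 1 * delta by apply: ler_pM; rewrite ?sqr_ge0.
  by rewrite mul1r.
have : c1 R * 1 <= c1 R * k%:R by rewrite ler_wpM2l// /c1; lra.
have := KR; rewrite /c1; lra.
Qed.

(** Off the diagonal [d'] is at least 32 k, by the choice of the mesh. The diagonal weight is at
    most 1, hence at most half the degree, so beta >= 16 k. *)
Let beta_ge i : k%:R <= beta w d' delta i ^+ 2.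
Proof.
have dn0 : 0 < delta * n%:R by have := dn2; lra.
have d'ge j : j != i -> 32 * k%:R <= d' i j.
  move=> ji; have /andP[a1 _] := d_off ji; have /andP[a2 _] : dmin <= d i j <= dmax.
    by apply: d_off; rewrite eq_sym.
  have hh0 : 0 < 2 * h by rewrite (mulr_gt0 _ h0).
  rewrite /d' ler_pdivlMr//.
  have -> : 32 * k%:R * (2 * h) = 2 * (eps * dmin) by rewrite /h; field; rewrite gt_eqF.
  have : eps * dmin <= 1 * dmin by rewrite ler_wpM2r// ltW.
  lra.
have w0 j : 0 <= w i j by case/andP: (w_01 i j).
have d'0 j : 0 <= d' i j by rewrite divr_ge0 ?addr_ge0// mulr_ge0// ltW.
have h1 : (delta * n%:R - 1) * (32 * k%:R) <= \sum_j w i j * d' i j.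
  rewrite (bigD1 i)//= -(w_row i) (bigD1 i)//=.
  have a : (\sum_(j | j != i) w i j) * (32 * k%:R) <= \sum_(j | j != i) w i j * d' i j.
    by rewrite mulr_suml; apply: ler_sum => j ji; apply: ler_wpM2l => //; exact: d'ge.
  have b : 0 <= w i i * d' i i by rewrite mulr_ge0.
  have c : (1 - w i i) * (32 * k%:R) >= 0.
    by rewrite mulr_ge0 ?subr_ge0//; [case/andP: (w_01 i i)|rewrite mulr_ge0].
  lra.
have h2 : 16 * k%:R <= beta w d' delta i.
  rewrite /beta ler_pdivlMr//.
  have : 0 <= (delta * n%:R - 2) * k%:R by rewrite mulr_ge0// subr_ge0 dn2.
  lra.
have : (16 * k%:R) ^+ 2 <= beta w d' delta i ^+ 2.
  by rewrite ler_sqr ?nnegrE//; have := kR; lra.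
have : k%:R * 1 <= k%:R * k%:R :> R by rewrite ler_wpM2l.
have := kR0; rewrite exprMn expr2; lra.
Qed.

(** Since L <= 2^(q k) and 2 <= e, both L^2 and the factor 2 fit into e^(3 q k). *)
Let exp_Gam : 2 * (#|'I_L| * #|'I_L|)%:R <= expR Gam.
Proof.
have e2 : 2 <= expR 1 :> R by have := @expR_ge1Dx R 1; lra.
have -> : expR Gam = expR 1 ^+ (3 * (q * k)) :> R by rewrite -expRM_natl mulr1.
have h1 : 2 ^+ (3 * (q * k)) <= expR 1 ^+ (3 * (q * k)) :> R.
  by rewrite ler_pXn2r ?nnegrE ?expR_ge0//; rewrite muln_gt0 /= muln_gt0 q0.
apply: le_trans h1; rewrite card_ord -natrX -natrM ler_nat.
have LL : (L <= 2 ^ (q * k))%N by rewrite expnM leq_exp2r.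
have t : (2 <= 2 ^ (q * k))%N.
  by rewrite -{1}[2%N]expn1 leq_exp2l// muln_gt0 q0.
have -> : (2 ^ (3 * (q * k)) = 2 ^ (q * k) * (2 ^ (q * k) * 2 ^ (q * k)))%N.
  by rewrite -!expnD !mulSn mul0n addn0.
by apply: leq_mul => //; exact: leq_mul.
Qed.

(** With b = 1 / (4 eta^2 delta), the right-hand side is 1 / (56 b) and s delta / 4 >= Gam b >= Gam
    + b. The exponential of [Gam] beats twice k Q^2, and e^b >= b^2 / 4 >= 28 b because b >= 112. *)
Let bad_small : k%:R * Q.-1%:R ^+ 2 * expR (- (s%:R * delta / 4)) <= eta ^+ 2 * delta / 14.
Proof.
have et0 : 0 < eta by rewrite /eta divr_gt0//; lra.
pose b := (4 * (eta ^+ 2 * delta))^-1.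
have ed0 : 0 < eta ^+ 2 * delta by rewrite mulr_gt0// exprn_gt0.
have ed1 : eta ^+ 2 * delta <= 1 / 448.
  have a1 : eta <= 1 / 448 by rewrite /eta; have := e1; lra.
  have a2 : eta ^+ 2 <= 1 / 448 by have := e1; rewrite expr2; nra.
  by have := de1; nra.
have b112 : 112 <= b.
  have e4 : 0 < 4 * (eta ^+ 2 * delta) by rewrite (mulr_gt0 _ ed0).
  by rewrite /b -[leLHS]invrK lef_pV2 ?posrE ?invr_gt0//; lra.
have G3 : 3 <= Gam.
  rewrite /Gam ler_nat -{1}[3%N]muln1 leq_mul2l /= muln_gt0 q0 k0 //.
have sd : Gam * b <= s%:R * delta / 4.
  rewrite /b ler_pdivrMr; last by rewrite (mulr_gt0 _ ed0).
  have -> : s%:R * delta / 4 * (4 * (eta ^+ 2 * delta)) =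
     q%:R * (K0%:R * (eps ^+ 2 * delta ^+ 2)) / (1000 * 100) ^+ 2.
    by rewrite /s natrM /eta; field.
  have : q%:R * (c1 R * k%:R) <= q%:R * (K0%:R * (eps ^+ 2 * delta ^+ 2)) by rewrite ler_wpM2l.
  by rewrite /Gam !natrM /c1; lra.
have sb : Gam + b <= s%:R * delta / 4 by apply: le_trans sd; nra.
have Eb : b ^+ 2 / 4 <= expR b.
  have -> : expR b = expR (b / 2) ^+ 2 by rewrite -expRM_natl; congr expR; field.
  have h1 : b / 2 <= expR (b / 2) by have := expR_ge1Dx (b / 2); lra.
  have : (b / 2) ^+ 2 <= expR (b / 2) ^+ 2 by rewrite ler_sqr ?nnegrE ?expR_ge0//; lra.
  by have -> : b ^+ 2 / 4 = (b / 2) ^+ 2 by field.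
have kM : 2 * (k%:R * Q.-1%:R ^+ 2) <= expR Gam.
  apply: le_trans exp_Gam; rewrite ler_wpM2l// card_ord -natrX -natrM ler_nat.
  have a1 : (k * Q <= L * 1)%N.
    rewrite muln1 /L -(prednK k0) expnS mulnC leq_mul2l prednK//.
    apply/orP; right; apply: leq_trans (_ : 2 ^ k.-1 <= _)%N; last by case: k.-1 => // m; rewrite leq_exp2r.
    by rewrite -{1}(prednK k0) ltn_expl.
  have a2 : (Q <= L)%N by rewrite /L -{1}[Q]expn1 leq_exp2l.
  have a3 : (Q.-1 ^ 2 <= Q * Q)%N by rewrite -mulnn leq_mul ?leq_pred.
  apply: (leq_trans (leq_mul (leqnn k) a3)); rewrite mulnA; apply: leq_mul => //.
  by rewrite -[leqRHS]muln1.
rewrite expRN ler_pdivrMr ?expR_gt0//.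
have X1 : expR (Gam + b) <= expR (s%:R * delta / 4) by rewrite ler_expR.
have X2 : expR Gam * (b ^+ 2 / 4) <= expR (Gam + b) by rewrite expRD ler_wpM2l ?expR_ge0.
have ee : eta ^+ 2 * delta / 14 = (56 * b)^-1 by rewrite /b; field; rewrite !gt_eqF.
rewrite ee [leRHS]mulrC ler_pdivlMr; last by lra.
have X3 : expR Gam * (28 * b) <= expR Gam * (b ^+ 2 / 4).
  by rewrite ler_wpM2l ?expR_ge0//; nra.
have X4 : 2 * (k%:R * Q.-1%:R ^+ 2) * (28 * b) <= expR Gam * (28 * b).
  by rewrite ler_wpM2r//; lra.
lra.
Qed.

(** The guess encodes a good sample with its optimal labels. For it, the means and radii of the
    program are those of the analysis, and its estimates agree up to the factor [h ^ 2]. *)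
Lemma sample_cand (xs : 'I_n -> 'I_L) : (forall y, fc xs <= fc y) ->
  exists2 N, (N < n ^ s * L ^ s)%N & forall z, candS n k Q inp h s L N z ->
    costn n k Q inp h z <= h ^+ 2 * fc xs + eps / 2 * SS d w.
Proof.
move=> xs_opt.
have s0 : (0 < s)%N by rewrite muln_gt0 q0.
have et : 0 < eta <= 1 by rewrite /eta; have := e0; have := e1; lra.
have Gam1 : 1 <= Gam by rewrite /Gam ler1n !muln_gt0 q0 k0.
have sG : Gam <= s%:R * (eta ^+ 2 * delta ^+ 2).
  have -> : s%:R * (eta ^+ 2 * delta ^+ 2) =
     q%:R * (K0%:R * (eps ^+ 2 * delta ^+ 2)) / (1000 * 100) ^+ 2.
    by rewrite /s natrM /eta; field.
  have : q%:R * (c1 R * k%:R) <= q%:R * (K0%:R * (eps ^+ 2 * delta ^+ 2)) by rewrite ler_wpM2l ?KR.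
  by rewrite /Gam !natrM /c1; lra.
have d'sym i j : d' i j = d' j i by rewrite /d' addrC.
have d'0 i j : 0 <= d' i j by rewrite divr_ge0 ?addr_ge0// mulr_ge0// ltW.
have dd : 0 < delta <= 1 by rewrite de0 ltW.
have [J HJ] := sampling_core n0 s0 k0 w_sym w_01 d'sym d'0 dd w_row
  (rr_sym R (k := k) (Q := Q)) (rr_le R Q0) (rr_lip R Q0) (pt_box R Q0)
  (pt_near Q0) beta_ge xs_opt et Gam1 sG exp_Gam bad_small.
pose f t := if insub t is Some t' then nat_of_ord (J t') else 0%N.
pose g t := if insub t is Some t' then nat_of_ord (xs (J t')) else 0%N.
have fE (t : 'I_s) : f t = J t by rewrite /f valK.
have gE (t : 'I_s) : g t = xs (J t) by rewrite /g valK.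
have [||N NP HN] := @digits_exist2 n L s f g n0.
- by move=> t ts; rewrite (fE (Ordinal ts)).
- by move=> t ts; rewrite (gE (Ordinal ts)).
have JE (t : 'I_s) : Jn n N t = J t by have [-> _] := HN t (ltn_ord t); rewrite fE.
have YE (t : 'I_s) : Yn n s L N t = xs (J t) by have [_ ->] := HN t (ltn_ord t); rewrite gE.
exists N => // z Hz.
pose zh (i : 'I_n) : 'I_L := Ordinal (proj1 (Hz i (ltn_ord i))).
have zE i : z (nat_of_ord i) = zh i by [].
have dist (i : 'I_n) (a : 'I_L) : distn k Q (ctrn n Q inp s L N i) a =
    nsq (fun l => pp a l - ctr pp w xs J i l).
  apply: eq_bigr => l _; congr (_ ^+ 2); congr (_ - _); rewrite /ctrn /ctr.
  congr (_ / _); apply: eq_bigr => t _; first by rewrite JE YE inp_w.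
  by rewrite JE inp_w.
have rhoE (i : 'I_n) : rhon n inp h i = 100 * beta w d' delta i ^+ 2.
  rewrite /rhon /beta.
  have -> : \sum_(j < n) wwn n inp i j = delta * n%:R.
    by rewrite -(w_row i); apply: eq_bigr => j _.
  have -> : \sum_j w i j * d' i j =
      (\sum_(j < n) wwn n inp i j * (ddn n inp i j + ddn n inp j i)) / (2 * h).
    rewrite mulr_suml; apply: eq_bigr => j _; rewrite inp_w !inp_d /d'.
    by rewrite mulrA.
  have n0R : n%:R != 0 :> R by rewrite pnatr_eq0 -lt0n.
  by field; rewrite n0R !gt_eqF.
have estE (i : 'I_n) (a : 'I_L) : estn n k Q inp h s L N z i a =
    h ^+ 2 * est pp r w d' xs J zh i a.
  rewrite /estn /est mulrDr; congr (_ + _).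
    rewrite (big_ord_widen n (fun j => cn n k Q inp h i j a (z j)) (ltnW (ltn_ord i))).
    by rewrite mulr_sumr; apply: eq_bigr => j _; rewrite zE cn_pcost.
  rewrite mulrCA; congr (_ * _); rewrite mulr_sumr; apply: eq_bigr => t _.
  rewrite JE YE addn1 /mk; case: ifP => _; last by rewrite mul0r mulr0.
  by rewrite mul1r cn_pcost.
have G : greedy pp r w d' delta xs J zh.
  move=> i a; rewrite /feas -!dist -rhoE => fa.
  have [f1 f2] := proj2 (Hz i (ltn_ord i)) a (ltn_ord a) fa.
  by split=> //; move: f2; rewrite !zE !estE ler_pM2l ?exprn_gt0.
have := HJ _ G; rewrite (costn_fc zE) -/fc => H.
have {}H : h ^+ 2 * fc zh <= h ^+ 2 * (fc xs + 500 * 100 * eta * Sd w d').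
  by rewrite ler_wpM2l ?sqr_ge0.
have : eps / 2 * (h ^+ 2 * Sd w d') <= eps / 2 * SS d w.
  by rewrite ler_wpM2l// divr_ge0// ltW.
move: H; rewrite /eta; lra.
Qed.

End Sample.

Lemma search_correct (x : nat -> nat) (xL : forall i, (i < n)%N -> (x i < L)%N) :
  (forall N, (N < P)%N -> exists2 y, cand n k Q inp h s L K0 N y &
     costn n k Q inp h x <= costn n k Q inp h y) ->
  577 * k%:R ^+ 2 * dmax <= Q%:R * (dmin * eps ^+ 2) -> dmin <= dmax ->
  wemv d w (fun i => \row_(l < k) (h * (dig Q (x i) l)%:R))
    <= opt_wemv k d w + eps * wmean w (fun i j => d i j ^+ 2).
Proof.
move=> Hx Qbig dmm.
pose y (i : 'I_n) : 'I_L := Ordinal (xL i (ltn_ord i)).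
have W0 : 0 < \sum_i \sum_j w i j.
  rewrite (eq_bigr (fun=> delta * n%:R)) => [|i _]; last exact: w_row.
  by rewrite sumr_const card_ord pmulrn_lgt0// mulr_gt0// ltr0n.
have hE : h * (32 * k%:R) = eps * dmin by rewrite /h; field; rewrite gt_eqF.
have w0 i j : 0 <= w i j by case/andP: (w_01 i j).
apply: (opt_from_hcost w0 d_ge0 k0 Q0 eps01 dmin0 d_off dmm hE Qbig (y := y) W0) => y'.
rewrite !hcost_fc.
have SS0 : 0 <= eps / 2 * SS d w.
  apply: mulr_ge0; first by rewrite divr_ge0// ltW.
  by apply: sumr_ge0 => i _; apply: sumr_ge0 => j _; rewrite mulr_ge0// sqr_ge0.
have xy : costn n k Q inp h x = h ^+ 2 * fc y by exact: costn_fc.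
rewrite -xy -addrA lerD2l; move: Hx; rewrite /P /cand /brute; case: ifPn => nK Hx.
  (* Here the competitor [y'] is itself among the labellings tried. *)
  pose f t := if insub t is Some t' then nat_of_ord (y' t') else 0%N.
  have fE (t : 'I_n) : f t = y' t by rewrite /f valK.
  have [|N NP HN] := @digits_exist L n f.
    by move=> t ts; rewrite (fE (Ordinal ts)).
  have [z Hz cz] := Hx N NP; apply: (le_trans cz).
  rewrite (@costn_fc y') ?lerDl// => i; rewrite Hz// HN// fE.
pose i0 : {ffun 'I_n -> 'I_L} := [ffun i => y i].
pose xs : {ffun 'I_n -> 'I_L} := [arg min_(v < i0) fc v]%O.
have xs_opt (v : 'I_n -> 'I_L) : fc xs <= fc v.
  have -> : fc v = fc [ffun i => v i].
    by apply: eq_bigr => i _; apply: eq_bigr => j _; rewrite !ffunE.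
  by rewrite /xs; case: arg_minP => // v0 _; exact.
rewrite -ltnNge in nK.
have [N NP HN] := sample_cand nK xs_opt.
have [z Hz cz] := Hx N NP; apply: (le_trans cz); apply: (le_trans (HN z Hz)).
by rewrite lerD2r ler_wpM2l ?sqr_ge0.
Qed.

End Correct.

(** * Reading the input and assembling the theorem *)

Lemma nat_ceil (R : realType) (x : R) : 0 <= x -> exists c : nat, x <= c%:R < x + 1.
Proof.
move=> x0; have /andP[h1 h2] := truncn_itv x0; rewrite -natr1 in h2.
have [e|ne] := eqVneq x (Num.truncn x)%:R.
  by exists (Num.truncn x); lra.
exists (Num.truncn x).+1; rewrite -natr1.
have : (Num.truncn x)%:R < x by rewrite lt_neqAle eq_sym ne.
lra.
Qed.

Lemma nth_allpairs (S T U : Type) (f : S -> T -> U) (x0 : S) (y0 : T) (z0 : U) s t i j :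
  (i < size s)%N -> (j < size t)%N ->
  nth z0 [seq f x y | x <- s, y <- t] (i * size t + j) = f (nth x0 s i) (nth y0 t j).
Proof.
move=> + jt; elim: s i => //= x s IH [|i] si; rewrite nth_cat size_map.
  by rewrite mul0n add0n jt (nth_map y0).
rewrite mulSn -addnA ltnNge leq_addr /= addKn; exact: IH.
Qed.

Lemma nth_grid (R : realType) n (f : 'I_n -> 'I_n -> R) (i j : 'I_n) :
  nth 0 [seq f a b | a <- enum 'I_n, b <- enum 'I_n] (i * n + j) = f i j.
Proof.
have := @nth_allpairs _ _ _ f i i 0 (enum 'I_n) (enum 'I_n) i j.
by rewrite size_enum_ord !nth_ord_enum; apply.
Qed.

Lemma input_cells (R : realType) n k eps (d w : 'M[R]_n) (inp : nat -> R) :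
  (forall c, (c < (n + n) * n + 1)%N -> inp c = rmem (wemv_input k eps d w) c) ->
  [/\ inp 0%N = eps, forall i j : 'I_n, ddn n inp i j = d i j &
      forall i j : 'I_n, wwn n inp i j = w i j].
Proof.
move=> H; have lt (i j : 'I_n) : (i * n + j < n * n)%N.
  have : (i.+1 * n <= n * n)%N by rewrite leq_mul2r ltn_ord orbT.
  by rewrite mulSn; have := ltn_ord j; lia.
have sz (f : 'I_n -> 'I_n -> R) :
    size [seq f a b | a <- enum 'I_n, b <- enum 'I_n] = (n * n)%N.
  by rewrite size_allpairs !size_enum_ord.
split=> [|i j|i j].
- by rewrite H// addn1.
- rewrite /ddn H; last by have := lt i j; lia.
  by rewrite /= nth_cat sz lt nth_grid.
- rewrite /wwn H; last by have := lt i j; lia.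
  rewrite -[LHS]/(nth 0 (_ ++ _) (n * n + (i * n + j))%N).
  by rewrite nth_cat sz ltnNge leq_addr addKn nth_grid.
Qed.

Theorem theorem5p12 (R : realType) :
  exists (p : cmd) (C : R), 0 < C /\
  forall (n k : nat) (d w : 'M[R]_n) (Delta eps delta : R),
    (0 < k)%N ->
    0 < eps < 1 ->
    0 < delta < 1 ->
    (forall i j, 0 <= d i j) ->
    is_aspect_ratio d Delta ->
    weighted_graph w ->
    regular w (delta * n%:R) ->
    exists m : nat,
      (forall r : m.-tuple bool, exists (s : state R) (t : nat),
          run_on p (wemv_input k eps d w) r s t /\
          t%:R <= wemv_time C n k Delta eps delta) /\
      99%:R / 100%:R <=
        coin_prob R m (fun r => exists (s : state R) (t : nat),
          run_on p (wemv_input k eps d w) r s t /\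
          wemv d w (wemv_output n k s)
            <= opt_wemv k d w + eps * wmean w (fun i j => d i j ^+ 2)).
Proof.
exists pAll, (240 * 8 * cT R); split; first by rewrite /cT /c1; lra.
move=> n k d w Delta eps delta k0 eps01 delta01 d0.
move=> [dmin [dmax [dmin0 [i1 [j1 [ij1 E1]]] [i2 [j2 [ij2 E2]]] d_off DE]]] [w_sym w_01] w_row.
have e0 : 0 < eps by case/andP: eps01.
have e1 : eps < 1 by case/andP: eps01.
have de0 : 0 < delta by case/andP: delta01.
have kR : 1 <= k%:R :> R by rewrite ler1n.
(* The pair that attains [dmin] has distinct indices. *)
have n2 : (1 < n)%N.
  have : nat_of_ord i1 != j1 by [].
  by have := ltn_ord i1; have := ltn_ord j1; lia.
have n0 : (0 < n)%N by exact: ltnW.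
have dmm : dmin <= dmax by rewrite -E2; case/andP: (d_off _ _ ij2).
have dmax0 : 0 < dmax by exact: lt_le_trans dmm.
have Delta1 : 1 <= Delta by rewrite DE ler_pdivlMr// mul1r.
have es0 : 0 < eps ^+ 2 by rewrite exprn_gt0.
have ds0 : 0 < delta ^+ 2 by rewrite exprn_gt0.
have u0 : 0 < dmin * eps ^+ 2 by rewrite (mulr_gt0 dmin0 es0).
have xQ0 : 0 <= 600 * k%:R ^+ 2 * dmax / (dmin * eps ^+ 2).
  by rewrite divr_ge0 ?(ltW u0)// mulr_ge0 ?(ltW dmax0)// mulr_ge0// sqr_ge0.
have [Q HQ] := nat_ceil xQ0.
have xK0 : 0 <= c1 R * k%:R / (eps ^+ 2 * delta ^+ 2).
  by rewrite divr_ge0 ?(ltW (mulr_gt0 es0 ds0))// mulr_ge0// /c1; lra.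
have [K0 HK] := nat_ceil xK0.
have k2 : 1 <= k%:R ^+ 2 :> R by exact: exprn_ege1.
have Qlow : 600 * k%:R ^+ 2 * dmax <= Q%:R * (dmin * eps ^+ 2).
  by case/andP: HQ => h _; rewrite -ler_pdivrMr.
have kd : dmax <= k%:R ^+ 2 * dmax by rewrite -[leLHS]mul1r ler_wpM2r// ltW.
have Qbig : 577 * k%:R ^+ 2 * dmax <= Q%:R * (dmin * eps ^+ 2) by lra.
have Q2 : (1 < Q)%N.
  rewrite ltnNge; apply/negP => Q1.
  have h1 : Q%:R * (dmin * eps ^+ 2) <= 1 * (dmin * eps ^+ 2).
    by rewrite ler_wpM2r ?(ltW u0)// -[leRHS]/(1%:R) ler_nat.
  have h2 : dmin * eps ^+ 2 <= dmin * 1.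
    by rewrite ler_wpM2l ?(ltW dmin0)// exprn_ile1// ltW.
  lra.
have HQ' : Q%:R < 600 * k%:R ^+ 2 * Delta / eps ^+ 2 + 1.
  case/andP: HQ => _; suff -> : 600 * k%:R ^+ 2 * dmax / (dmin * eps ^+ 2) =
    600 * k%:R ^+ 2 * Delta / eps ^+ 2 by [].
  by rewrite DE; field; rewrite !gt_eqF.
pose q := up_log 2 Q; pose L := (Q ^ k)%N; pose s := (q * K0)%N.
pose P := (if (n <= K0)%N then L ^ n else n ^ s * L ^ s)%N.
pose X := Xb n k Q q K0.
have XE : X = (100 * (n * n * k * Q * q * K0 * P))%N by [].
have dvX m c : X = (c * m)%N -> (m <= X)%N.
  move=> e; apply: (Xb_ge n2 k0 eps01 delta01 Q2 erefl HK).
  by apply/dvdnP; exists c.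
have X0 : (0 < X)%N by apply: dvX (esym (muln1 _)).
have q0 : (0 < q)%N by move: X0; rewrite XE; case: (q) => //; rewrite !(muln0, mul0n).
have K0n : (0 < K0)%N.
  by rewrite -(ltr0n R); apply: lt_le_trans (proj1 (andP HK)); rewrite !mulr_gt0 ?invr_gt0 ?mulr_gt0// /c1; lra.
have s0 : (0 < s)%N by rewrite muln_gt0 q0.
have PX : (P %| X)%N by rewrite XE mulnA dvdn_mull.
have LP : (L %| P)%N.
  rewrite /P; case: ifP => _; first by rewrite dvdn_exp.
  by rewrite dvdn_mull// dvdn_exp.
have X_ge : (100 <= X)%N by apply: (dvX _ (n * n * k * Q * q * K0 * P)%N); rewrite XE mulnC.
have TX : ((n + n) * n + 1 <= X)%N.
  have : (100 * (n * n) <= X)%N.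
    by apply: (dvX _ (k * Q * q * K0 * P)%N); rewrite XE; ring.
  have : (0 < n * n)%N by rewrite muln_gt0 n0.
  by clear; rewrite mulnDl; lia.
have nkX : (n * k <= X)%N by apply: (dvX _ (100 * n * Q * q * K0 * P)%N); rewrite XE; ring.
have kQX : (k * Q <= X)%N by apply: (dvX _ (100 * n * n * q * K0 * P)%N); rewrite XE; ring.
have qX : (q <= X)%N by apply: (dvX _ (100 * n * n * k * Q * K0 * P)%N); rewrite XE; ring.
have KX : (K0 <= X)%N by apply: (dvX _ (100 * n * n * k * Q * q * P)%N); rewrite XE; ring.
have sX : (s <= X)%N by apply: (dvX _ (100 * n * n * k * Q * P)%N); rewrite XE /s; ring.
have LX : (L <= X)%N by apply: dvdn_leq => //; exact: dvdn_trans PX.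
have PX' : (P <= X)%N by exact: dvdn_leq.
have ok inp : (forall c, (c < (n + n) * n + 1)%N -> inp c = rmem (wemv_input k eps d w) c) ->
    setup_ok n k Q K0 eps dmin dmax inp.
  move=> /input_cells[c0 cd cw].
  have sw : \sum_(j < n) wwn n inp 0%N j = delta * n%:R.
    by rewrite -(w_row (Ordinal n0)); apply: eq_bigr => j _; rewrite -cw.
  have xK : c1 R * (k%:R * (n%:R / (delta * n%:R)) ^+ 2) / eps ^+ 2 =
      c1 R * k%:R / (eps ^+ 2 * delta ^+ 2).
    have nR : n%:R != 0 :> R by rewrite pnatr_eq0 -lt0n.
    by field; rewrite nR !gt_eqF.
  split=> //; split; rewrite ?sw -?/(c1 R) ?xK//.
  - move=> i j iN jN ij; rewrite (cd (Ordinal iN) (Ordinal jN)).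
    exact: d_off.
  - by exists i1, j1; rewrite cd E1; split.
  - by exists i2, j2; rewrite cd E2; split.
have [|s' [t [ex tX [inp [x [agr xL Hx out]]]]]] := @prog_spec R X X_ge n k Q q K0 eps dmin dmax n2 k0 (ltnW Q2)
  erefl TX nkX kQX qX KX LX (fun=> sX) PX' (wemv_input k eps d w) erefl erefl _ ok [::].
- by case=> [|[|a]]//= _; rewrite nth_nil.
have [_ cd cw] := input_cells agr.
have run : run_on pAll (wemv_input k eps d w) [::] s' t by exists [::].
(* No coin is tossed: the empty sequence is the only outcome, so success has probability 1. *)
exists 0%N; split.
  move=> r; rewrite (tuple0 r); exists s', t; split=> //.
  apply: le_trans (time_bound n2 k0 eps01 delta01 Delta1 Q2 erefl HQ' HK).
  by rewrite ler_nat.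
rewrite /coin_prob expn0 divr1; apply: (@le_trans _ _ 1); first by lra.
rewrite ler1n; apply/card_gt0P; exists [tuple]; rewrite inE; apply/asboolP.
exists s', t; split=> //.
have -> : wemv_output n k s' =
    fun i => \row_(l < k) (eps * dmin / (32 * k%:R) * (dig Q (x i) l)%:R).
  by apply/funext => i; apply/rowP => l; rewrite !mxE out.
exact: (search_correct n2 k0 Q2 erefl eps01 delta01 dmin0 d0 d_off w_sym w_01 w_row
  (proj1 (andP HK)) cd cw xL Hx Qbig dmm).
Qed.
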